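(* Let $d\ge 3$, $-2\le\gamma<0$ and $T>0$. Let $f_{\rm in}\in L^1_2(\mathbb{R}^d)\cap L\log L(\mathbb{R}^d)$ be a nonnegative initial datum with $\int f_{\rm in}\,dv=1$, $\int v f_{\rm in}\,dv=0$, $\int |v|^2 f_{\rm in}\,dv=d$, and let $f(t,v)$ be any global weak solution to the Landau equation with initial datum $f_{\rm in}$. Then, for any $\varepsilon>0$, there exists $C>0$, depending on $\varepsilon$, $\gamma$, $f_{\rm in}$ and $T$, such that for any smooth function $\phi$ on $\mathbb{R}^d$ and all $t\in[0,T]$, $$-\int_{\mathbb{R}^d}\phi^2\,\boldsymbol{c}_\gamma[f(t)]\,dv\le \varepsilon\int_{\mathbb{R}^d}\left|\nabla\left(\langle v\rangle^{\frac{\gamma}{2}}\phi(v)\right)\right|^2dv+C\int_{\mathbb{R}^d}\phi^2\langle v\rangle^\gamma\,dv.$$ Moreover, if $\gamma\in(-2,0)$, one has $C=C_0\left(1+\varepsilon^{\frac{\gamma}{2+\gamma}}\right)$ where $C_0$ only depends on $\|f_{\rm in}\|_{L^1_2}$ (with $d$ and $\gamma$ fixed).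
   Context: Notation: $\langle v\rangle=\sqrt{1+|v|^2}$; $\|f\|_{L^p_s}=\left(\int_{\mathbb{R}^d}|f|^p\langle v\rangle^s\,dv\right)^{1/p}$ and $L^p_s(\mathbb{R}^d)$ is the corresponding space; $L\log L(\mathbb{R}^d)$ is the space of $f$ with $\int |f||\log|f||\,dv<\infty$. For $i,j\in\{1,\dots,d\}$ set $a_{i,j}(z)=|z|^{\gamma+2}\left(\delta_{i,j}-\frac{z_iz_j}{|z|^2}\right)$, $b_i(z)=-(d-1)z_i|z|^\gamma$, and $c(z)=-(d-1)(\gamma+d)|z|^\gamma$. Define $\mathcal{A}[f]=(a_{i,j}\ast f)_{i,j}$, $\boldsymbol{b}[f]=(b_i\ast f)_i$, and $$\boldsymbol{c}_\gamma[f](v)=(c\ast f)(v)=-(d-1)(\gamma+d)\int_{\mathbb{R}^d}|v-v_*|^\gamma f(v_* )\,dv_*.$$ The (spatially homogeneous) Landau equation is $\partial_t f=\nabla\cdot(\mathcal{A}[f]\nabla f-\boldsymbol{b}[f]f)$, $f(0)=f_{\rm in}$. Weak solution: for $f_{\rm in}\in L^1_2\cap L\log L(\mathbb{R}^d)$, $f$ is a (global) weak solution if (1) $f\ge0$, $f\in\mathcal{C}([0,\infty);\mathcal{D}'(\mathbb{R}^d))\cap L^\infty([0,\infty);L^1_2\cap L\log L(\mathbb{R}^d))$; (2) for all $t\ge0$, $\int f(t,v)\varphi(v)\,dv=\int f_{\rm in}(v)\varphi(v)\,dv$ for $\varphi\in\{1,v,|v|^2\}$ and $\int f(t)\log f(t)\,dv\le\int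 f_{\rm in}\log f_{\rm in}\,dv$; (3) for any $\varphi\in\mathcal{C}^1([0,\infty);\mathcal{C}^\infty_c(\mathbb{R}^d))$ and $t\ge0$, $$\int f(t,v)\varphi(t,v)\,dv=\int f_{\rm in}(v)\varphi(0,v)\,dv+\int_0^t\!\!\int f\,\partial_t\varphi\,dv\,d\tau+\frac12\sum_{i,j}\int_0^t\!\!\iint f(\tau,v)f(\tau,v_* )a_{i,j}(v-v_* )\left[\partial^2_{i,j}\varphi(\tau,v)+\partial^2_{i,j}\varphi(\tau,v_* )\right]dv\,dv_*\,d\tau+\sum_i\int_0^t\!\!\iint f(\tau,v)f(\tau,v_* )b_i(v-v_* )\left[\partial_i\varphi(\tau,v)-\partial_i\varphi(\tau,v_* )\right]dv\,dv_*\,d\tau.$$ *)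

(* Defs.v *)
From HB Require Import structures.
From mathcomp Require Import all_boot all_order all_algebra.
From mathcomp Require Import all_classical all_reals all_analysis.

Set Implicit Arguments.
Unset Strict Implicit.
Unset Printing Implicit Defensive.
Import Order.TTheory GRing.Theory Num.Theory.
Import numFieldNormedType.Exports.

Local Open Scope classical_set_scope.
Local Open Scope ring_scope.

(* R^n is 'rV[R]_n with the sigma-algebra generated by the coordinates, as the
   library does for n.-tuple T; this is the Borel sigma-algebra. *)
Definition measure_rV_display : measure_display -> measure_display.
Proof. exact. Qed.

Section measurable_rV.
Context {d : measure_display} {T : sigmaRingType d}.
Variable n : nat.

Let coors : 'I_n -> 'rV[T]_n -> T := fun i v => v ord0 i.

Let rV_set0 : g_sigma_preimage coors set0.
Proof. exact: sigma_algebra0. Qed.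

Let rV_setC A : g_sigma_preimage coors A -> g_sigma_preimage coors (~` A).
Proof. exact: sigma_algebraC. Qed.

Let rV_bigcup (F : _^nat) : (forall i, g_sigma_preimage coors (F i)) ->
  g_sigma_preimage coors (\bigcup_i (F i)).
Proof. exact: sigma_algebra_bigcup. Qed.

HB.instance Definition _ := @isMeasurable.Build (measure_rV_display d)
  'rV[T]_n (g_sigma_preimage coors) rV_set0 rV_setC rV_bigcup.

End measurable_rV.

Lemma measurable_coord d (T : sigmaRingType d) n (i : 'I_n) :
  measurable_fun [set: 'rV[T]_n] (fun v => v ord0 i).
Proof.
move=> _ Y mY; rewrite setTI; apply: sub_sigma_algebra => /=.
rewrite -bigcup_seq/=; exists i => /=; first by rewrite mem_index_enum.
by exists Y => //; rewrite setTI.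
Qed.

Lemma measurable_fun_coordP d1 d2 (T1 : measurableType d1)
    (T2 : measurableType d2) n (f : T1 -> 'rV[T2]_n) :
  measurable_fun [set: T1] f <->
  forall i, measurable_fun [set: T1] (fun x => f x ord0 i).
Proof.
split=> [mf i|mf].
  exact: (@measurableT_comp _ _ _ _ _ _ (fun v : 'rV[T2]_n => v ord0 i) _ f
    (@measurable_coord _ _ _ _) mf).
move=> _ A mA; rewrite setTI.
suff: (measurable : set_system 'rV[T2]_n) `<=`
      [set B | measurable (f @^-1` B)] by apply.
apply: smallest_sub.
  split=> [|B mB|F mF] /=.
  - by rewrite preimage_set0.
  - by rewrite setTD preimage_setC; exact: measurableC.
  - by rewrite preimage_bigcup; apply: bigcup_measurable => k _; exact: mF.
case: n => [|n] in f mf A mA *; first by rewrite big_ord0.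
rewrite -bigcup_mkord_ord; apply: bigcup_sub => i _ B [C mC <-] /=.
by have := mf (inord i) measurableT C mC; rewrite !setTI.
Qed.

Section lebesgue_rV.
Context {R : realType}.

Definition rV_cons n (p : R * 'rV[R]_n) : 'rV[R]_n.+1 :=
  \row_i oapp (fun j => p.2 ord0 j) p.1 (unlift ord0 i).

Definition rV_uncons n (v : 'rV[R]_n.+1) : R * 'rV[R]_n :=
  (v ord0 ord0, \row_j v ord0 (lift ord0 j)).

Lemma rV_consK n : cancel (@rV_cons n) (@rV_uncons n).
Proof.
move=> [x v]; congr pair; first by rewrite mxE unlift_none.
by apply/rowP => j; rewrite !mxE liftK.
Qed.

Lemma rV_unconsK n : cancel (@rV_uncons n) (@rV_cons n).
Proof.
move=> v; apply/rowP => i; rewrite mxE.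
by case: unliftP => [j ->|->] /=; rewrite ?mxE.
Qed.

Lemma measurable_rV_cons n : measurable_fun [set: R * 'rV[R]_n] (@rV_cons n).
Proof.
apply/measurable_fun_coordP => i.
under eq_fun do rewrite mxE.
case: unliftP => [j _|_] /=; last exact: measurable_fst.
apply: (@measurableT_comp _ _ _ _ _ _ (fun v : 'rV[R]_n => v ord0 j)) => //.
exact: measurable_coord.
Qed.

Lemma measurable_rV_uncons n :
  measurable_fun [set: 'rV[R]_n.+1] (@rV_uncons n).
Proof.
apply: measurable_fun_pair => /=; first exact: measurable_coord.
apply/measurable_fun_coordP => i.
by under eq_fun do rewrite mxE; exact: measurable_coord.
Qed.

Section step.
Variables (n : nat) (mu : {sigma_finite_measure set 'rV[R]_n -> \bar R}).

Definition lebesgue_rV_step : set 'rV[R]_n.+1 -> \bar R :=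
  pushforward (@lebesgue_measure R \x mu)%E (@rV_cons n).

Let step0 : lebesgue_rV_step set0 = 0%E.
Proof. by rewrite /lebesgue_rV_step /pushforward preimage_set0 measure0. Qed.

Let step_ge0 A : (0 <= lebesgue_rV_step A)%E.
Proof.
by apply: measure_ge0; exact: measurable_rV_cons.
Qed.

Let step_sigma_additive : semi_sigma_additive lebesgue_rV_step.
Proof.
move=> F mF tF mUF; rewrite /lebesgue_rV_step /pushforward preimage_bigcup.
apply: measure_semi_sigma_additive.
- by move=> k; rewrite -[X in measurable X]setTI; exact: measurable_rV_cons.
- apply/trivIsetP => /= i j _ _ ij; rewrite -preimage_setI.
  by move/trivIsetP : tF => /(_ _ _ _ _ ij) ->//; rewrite preimage_set0.
- rewrite -preimage_bigcup -[X in measurable X]setTI.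
  exact: measurable_rV_cons.
Qed.

HB.instance Definition _ := isMeasure.Build _ _ _
  lebesgue_rV_step step0 step_ge0 step_sigma_additive.

Let step_sigma_finite : sigma_finite setT lebesgue_rV_step.
Proof.
have /sigma_finiteP[F [TF ndF Foo]] := sigma_finiteT (@lebesgue_measure R).
have /sigma_finiteP[G [TG ndG Goo]] := sigma_finiteT mu.
exists (fun k => @rV_uncons n @^-1` (F k `*` G k)).
  rewrite -preimage_bigcup (_ : bigcup _ _ = setT) ?preimage_setT//.
  rewrite -setXTT TF TG predeqE => -[x y]; split.
    by move=> [k _ []/= ? ?]; split; exists k.
  move=> [/= [k _ Fkx] [l _ Gly]]; exists (maxn k l) => //; split.
  - by move: x Fkx; exact/subsetPset/ndF/leq_maxl.
  - by move: y Gly; exact/subsetPset/ndG/leq_maxr.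
move=> k; have [mF ?] := Foo k; have [mG ?] := Goo k; split.
  rewrite -[X in measurable X]setTI; apply: measurable_rV_uncons => //.
  exact: measurableX.
rewrite /lebesgue_rV_step /pushforward -comp_preimage.
rewrite (_ : _ \o _ = id) ?preimage_id; last first.
  by apply/funext => p /=; rewrite rV_consK.
by rewrite product_measure1E// lte_mul_pinfty// ge0_fin_numE.
Qed.

HB.instance Definition _ := Measure_isSigmaFinite.Build _ _ _
  lebesgue_rV_step step_sigma_finite.

End step.

(* Lebesgue measure on R^n: the n-fold product of the one on R. *)
Fixpoint lebesgue_rV n : {sigma_finite_measure set 'rV[R]_n -> \bar R} :=
  if n is n'.+1 then lebesgue_rV_step (lebesgue_rV n') else \d_(0 : 'rV[R]_0).

Lemma lebesgue_rV_box n (A : 'I_n -> set R) :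
  (forall i, measurable (A i)) ->
  lebesgue_rV n [set v | forall i, A i (v ord0 i)] =
  (\prod_(i < n) lebesgue_measure (A i))%E.
Proof.
elim: n A => [|n IH] A mA.
  rewrite big_ord0.
  transitivity (lebesgue_rV 0 [set: 'rV[R]_0]); last exact: diracT.
  by congr (lebesgue_rV 0 _); apply/seteqP; split => // v _ [].
have mB : measurable [set v : 'rV[R]_n | forall i, A (lift ord0 i) (v ord0 i)].
  have -> : [set v : 'rV[R]_n | forall i, A (lift ord0 i) (v ord0 i)] =
      \bigcap_(i in [set: 'I_n])
        [set v : 'rV[R]_n | A (lift ord0 i) (v ord0 i)].
    by apply/seteqP; split => v /= vA i; [move=> _; exact: vA|exact: vA].
  apply: fin_bigcap_measurable => // i _.
  by rewrite -[X in measurable X]setTI; exact: measurable_coord.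
rewrite big_ord_recl -(IH (A \o lift ord0))//= /lebesgue_rV_step /pushforward.
rewrite -product_measure1E//=; last exact: mA.
congr (product_measure1 _ _ _); apply/seteqP; split => -[x v] /=.
  move=> xvA; split; first by have := xvA ord0; rewrite mxE unlift_none.
  by move=> i; have := xvA (lift ord0 i); rewrite mxE liftK.
move=> [xA vA] i; rewrite mxE.
by case: unliftP => [j ->|->] //=; exact: vA.
Qed.

End lebesgue_rV.

Section velocity_space.
Context {R : realType} {d : nat}.
Implicit Types (v w z : 'rV[R]_d) (f g phi : 'rV[R]_d -> R) (i j : 'I_d).

Local Notation leb := (@lebesgue_rV R d).

(* The library's norm on 'rV[R]_d is the sup norm. *)
Definition enorm v : R := Num.sqrt (\sum_i v ord0 i ^+ 2).

Definition bracket v : R := Num.sqrt (1 + enorm v ^+ 2).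

Definition Lps_norm (p s : R) f : \bar R :=
  ((\int[leb]_v (`|f v| `^ p * bracket v `^ s)%:E) `^ p^-1)%E.

Definition Lps (p s : R) : set ('rV[R]_d -> R) :=
  [set f | measurable_fun setT f /\ (Lps_norm p s f < +oo)%E].

(* Here and in the entropy, ln 0 = 0 gives 0 ln 0 = 0. *)
Definition LlogL_int f : \bar R := \int[leb]_v (`|f v| * `|ln `|f v| |)%:E.

Definition LlogL : set ('rV[R]_d -> R) :=
  [set f | measurable_fun setT f /\ (LlogL_int f < +oo)%E].

Definition partial i phi : 'rV[R]_d -> R :=
  fun v => 'D_(delta_mx ord0 i) phi v.

Definition partials (s : seq 'I_d) phi : 'rV[R]_d -> R := foldr partial phi s.

Definition smooth phi : Prop := forall s : seq 'I_d,
  continuous (partials s phi) /\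
  forall i v, derivable (partials s phi) v (delta_mx ord0 i).

Definition grad phi v : 'rV[R]_d := \row_i partial i phi v.

Definition test_function phi : Prop :=
  smooth phi /\ exists r : R, forall v, r < enorm v -> phi v = 0.

(* u \in C([0, oo); C_c^oo(R^d)) for the usual topology of test functions: on
   each [0, T] the supports lie in a common ball, and every derivative varies
   continuously in time for the uniform norm. *)
Definition test_curve (u : R -> 'rV[R]_d -> R) : Prop :=
  [/\ forall t, 0 <= t -> smooth (u t),
      forall T : R, exists r : R, forall t v,
        0 <= t <= T -> r < enorm v -> u t v = 0 &
      forall (s : seq 'I_d) (t e : R), 0 <= t -> 0 < e ->
        \forall t' \near t, 0 <= t' -> forall v,
          `|partials s (u t') v - partials s (u t) v| <= e].

(* u \in C^1([0, oo); C_c^oo(R^d)), with time derivative du (one-sided at 0). *)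
Definition test_curve_C1 (u du : R -> 'rV[R]_d -> R) : Prop :=
  [/\ test_curve u, test_curve du &
      forall (s : seq 'I_d) (t e : R), 0 <= t -> 0 < e ->
        \forall t' \near t, 0 <= t' -> forall v,
          `|partials s (u t') v - partials s (u t) v
              - (t' - t) * partials s (du t) v| <= e * `|t' - t| ].

Section landau.
Variable gamma : R.

(* The values at z = 0 are junk; they only matter on a null set. *)
Definition coef_a i j z : R :=
  enorm z `^ (gamma + 2) *
  ((i == j)%:R - z ord0 i * z ord0 j / enorm z ^+ 2).

Definition coef_b i z : R := - (d%:R - 1) * z ord0 i * enorm z `^ gamma.

Definition coef_c z : R :=
  - (d%:R - 1) * (gamma + d%:R) * enorm z `^ gamma.

(* c_gamma[f] = c * f, extended-real valued: for f in L^1 the convolution may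
   be infinite at some points. *)
Definition conv_c f v : \bar R := \int[leb]_w (coef_c (v - w) * f w)%:E.

Definition weak_form (fin : 'rV[R]_d -> R) (f : R -> 'rV[R]_d -> R) : Prop :=
  forall phi dphi : R -> 'rV[R]_d -> R, test_curve_C1 phi dphi ->
  forall t, 0 <= t ->
  \int[leb]_v (f t v * phi t v) =
    \int[leb]_v (fin v * phi 0 v)
    + \int[@lebesgue_measure R]_(tau in `[0, t])
        \int[leb]_v (f tau v * dphi tau v)
    + 2^-1 * (\sum_i \sum_j \int[@lebesgue_measure R]_(tau in `[0, t])
        \int[(leb \x leb)%E]_p
          (f tau p.1 * f tau p.2 * coef_a i j (p.1 - p.2) *
           (partials [:: i; j] (phi tau) p.1
            + partials [:: i; j] (phi tau) p.2)))
    + \sum_i \int[@lebesgue_measure R]_(tau in `[0, t])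
        \int[(leb \x leb)%E]_p
          (f tau p.1 * f tau p.2 * coef_b i (p.1 - p.2) *
           (partial i (phi tau) p.1 - partial i (phi tau) p.2)).

Record weak_solution (fin : 'rV[R]_d -> R) (f : R -> 'rV[R]_d -> R) : Prop := {
  ws_measurable :
    @measurable_fun _ _ (R * 'rV[R]_d)%type R
      (`[0, +oo[%classic `*` setT) (fun p => f p.1 p.2) ;
  ws_ge0 : forall t, 0 <= t -> {ae leb, forall v, 0 <= f t v} ;
  ws_distr_continuous : forall phi, test_function phi ->
    {within `[0, +oo[, continuous (fun t => \int[leb]_v (f t v * phi v))} ;
  ws_space : forall t, 0 <= t -> (Lps 1 2 `&` LlogL) (f t) ;
  ws_bounded : exists K : R, {ae @lebesgue_measure R, forall t, 0 <= t ->
    (Lps_norm 1 2 (f t) <= K%:E)%E /\ (LlogL_int (f t) <= K%:E)%E} ;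
  ws_mass : forall t, 0 <= t -> \int[leb]_v f t v = \int[leb]_v fin v ;
  ws_momentum : forall t, 0 <= t -> forall i,
    \int[leb]_v (f t v * v ord0 i) = \int[leb]_v (fin v * v ord0 i) ;
  ws_energy : forall t, 0 <= t ->
    \int[leb]_v (f t v * enorm v ^+ 2) = \int[leb]_v (fin v * enorm v ^+ 2) ;
  ws_entropy : forall t, 0 <= t ->
    \int[leb]_v (f t v * ln (f t v)) <= \int[leb]_v (fin v * ln (fin v)) ;
  ws_weak_form : weak_form fin f }.

(* Both sides may be +oo, as phi need not decay. *)
Definition eps_poincare (eps C : R) f phi : Prop :=
  (- (\int[leb]_v ((phi v ^+ 2)%:E * conv_c f v))
   <= eps%:E *
        (\int[leb]_v (enorm (grad (fun w => bracket w `^ (gamma / 2) * phi w) v)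
                        ^+ 2)%:E)
      + C%:E * (\int[leb]_v (phi v ^+ 2 * bracket v `^ gamma)%:E))%E.

End landau.

Record normalized_datum (fin : 'rV[R]_d -> R) : Prop := {
  nd_space : (Lps 1 2 `&` LlogL) fin ;
  nd_ge0 : {ae leb, forall v, 0 <= fin v} ;
  nd_mass : \int[leb]_v fin v = 1 ;
  nd_momentum : forall i, \int[leb]_v (fin v * v ord0 i) = 0 ;
  nd_energy : \int[leb]_v (fin v * enorm v ^+ 2) = d%:R }.

End velocity_space.

(* Main.v *)
(* Put psi = <v>^(gamma/2) phi. Peetre's inequality reduces -\int phi^2 c[f] to
   \int <w>^2 f(w) (\int psi(v)^2 |v - w|^gamma dv) dw up to a multiple of \int psi^2.
   For |v - w| <= r the kernel is at most r^(2 + gamma) |v - w|^-2, and a local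
   Hardy inequality bounds \int psi(v)^2 |v - w|^-2 dv over a ball centred at w by the
   Dirichlet energy and the mass of psi on a cube, with constants independent of w.
   Since \int <w>^2 f(t, w) dw is conserved, a small r settles the case gamma > -2.
   When gamma = -2 the radius gives no gain. Instead <w>^2 f(t, w) is split into a
   bounded density and a part of small mass, on which the Hardy inequality has a
   small constant. This must be uniform in t and f: the entropy bound makes f
   uniformly integrable, and no energy escapes to infinity before time T, as one
   sees by testing the weak formulation with a truncation of |v|^2; for gamma = -2
   the kernel this produces is bounded and vanishes where the truncation is
   inactive. *)

Require Import Defs.
From HB Require Import structures.
From mathcomp Require Import all_boot all_order all_algebra.
From mathcomp Require Import all_classical all_reals all_analysis.
From mathcomp Require Import ring lra measurable_realfun.

Set Implicit Arguments.
Unset Strict Implicit.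
Unset Printing Implicit Defensive.
Import Order.TTheory GRing.Theory Num.Theory.
Import numFieldNormedType.Exports.

Local Open Scope classical_set_scope.
Local Open Scope ring_scope.

(** * Derivatives, continuity and measurability on row vectors *)

(** The bound [gamma >= -2] enters through the weight: Peetre's inequality costs a factor
    [<w>^(-gamma) <= <w>^2], so mass and energy are the only moments of [f] required, and for
    normalized data they add up to [1 + d]. For [gamma > -2], making the Dirichlet term small forces
    [r^(2 + gamma)] of order [eps], and the remainder [r^gamma] is then of order
    [eps^(gamma/(2 + gamma))], the exponent in the statement. The Hardy inequality comes from a
    vector field whose divergence integrates to zero. The field must be C^1, hence a denominator
    [|v - w|^2 + del] and the square of a positive part as cutoff; [del] goes to 0 at the end. For
    [gamma = -2] the entropy density has no sign: a Gaussian and the energy density are added to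
    make it nonnegative before restricting to large values of [f]. The truncated energy is a
    dilation of one fixed profile, so its second derivatives are bounded uniformly in the radius;
    the [1/|z|] singularity of [b] is absorbed by a difference of gradients. The resulting constant
    depends on the initial datum through its entropy and the decay of its energy tail, and on [T]
    through the leak of energy. *)

(** A directional derivative sees a function only along one line: the two difference quotients are
    the same function of [h]. This is how derivatives on row vectors are passed to coordinate slices
    and back. *)
Lemma is_derive_transfer (K : numFieldType) (V1 V2 W : normedModType K)
    (f1 : V1 -> W) (f2 : V2 -> W) a1 v1 a2 v2 df :
  (forall h : K, f1 (h *: v1 + a1) = f2 (h *: v2 + a2)) ->
  is_derive a1 v1 f1 df -> is_derive a2 v2 f2 df.
Proof.
move=> f12; have f0 : f1 a1 = f2 a2 by have := f12 0; rewrite !scale0r !add0r.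
have E : (fun h : K => h^-1 *: ((f1 \o shift a1) (h *: v1) - f1 a1)) =
         (fun h : K => h^-1 *: ((f2 \o shift a2) (h *: v2) - f2 a2)).
  by apply/funext => h; rewrite /= f12 f0.
by move=> -[d1 d2]; split; move: d1 d2; rewrite /derivable /derive E.
Qed.

Lemma rV_ballP (R : realType) n (x y : 'rV[R]_n) (e : R) :
  0 < e -> (forall i, `|x ord0 i - y ord0 i| < e) -> ball x e y.
Proof.
move=> e0 xy; split => // i j; rewrite (ord1 i).
exact: xy.
Qed.

(** The sigma-algebra is generated by coordinates, so Borel sets have to be recovered: an open set
    is the union of the cubes with rational centre and radius [1/(k + 1)] that it contains. A radius
    below [e / 2] suffices, as the centre is within one radius of [v] and every point of the cube
    within another. *)
Lemma open_measurable_rV (R : realType) n (U : set 'rV[R]_n) :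
  open U -> measurable U.
Proof.
move=> oU.
pose B (q : 'rV[rat]_n * nat) : set 'rV[R]_n :=
  [set v | forall i, `|ratr (q.1 ord0 i) - v ord0 i| < q.2.+1%:R^-1].
have mB q : measurable (B q).
  have -> : B q = \bigcap_(i in [set: 'I_n])
      [set v : 'rV[R]_n | `|ratr (q.1 ord0 i) - v ord0 i| < q.2.+1%:R^-1].
    by apply/seteqP; split => v /= Bv i; [move=> _; exact: Bv|exact: Bv].
  apply: fin_bigcap_measurable => // i _.
  have m1 : measurable_fun [set: 'rV[R]_n]
      (fun v => `|ratr (q.1 ord0 i) - v ord0 i|).
    apply: measurableT_comp => //; apply: measurable_funB => //.
    exact: measurable_coord.
  have := m1 measurableT `]-oo, q.2.+1%:R^-1[%classic (measurable_itv _).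
  by rewrite setTI.
have -> : U = \bigcup_q (if `[< B q `<=` U >] then B q else set0).
  apply/seteqP; split => [v Uv|v [q _]]; last first.
    by case: asboolP => // BU /BU.
  have /nbhs_ballP[e /= e0 eU] : nbhs v U by exact: open_nbhs_nbhs.
  pose k := Num.truncn (2 / e).
  have ke : (k.+1%:R^-1 : R) < e / 2.
    have : 2 / e < k.+1%:R by exact: truncnS_gt.
    by rewrite ltr_pdivrMr // => h; rewrite invf_plt ?posrE ?divr_gt0// invf_div ltr_pdivrMr.
  have ex i : exists q : rat, `|ratr q - v ord0 i| < k.+1%:R^-1.
    have [|q] := @rat_in_itvoo R (v ord0 i - k.+1%:R^-1) (v ord0 i + k.+1%:R^-1).
      by rewrite ltrBlDr -addrA ltrDl -mulr2n mulrn_wgt0.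
    rewrite in_itv/= => /andP[h1 h2].
    by exists q; rewrite ltr_distl h1 h2.
  pose q := \row_i xchoose (ex i).
  exists (q, k) => //; case: asboolP => [_ i|[]].
    by rewrite mxE; exact: (xchooseP (ex i)).
  apply: subset_trans eU => w Bw; apply: rV_ballP => // i.
  have h1 := Bw i; have := xchooseP (ex i); rewrite /= mxE in h1 => h2.
  move: h1 h2; set r : R := ratr _ => h1 h2.
  have -> : v ord0 i - w ord0 i = (r - w ord0 i) - (r - v ord0 i) by lra.
  apply: le_lt_trans (ler_normB _ _) _.
  by rewrite [e]splitr ltrD// (lt_trans _ ke).
apply: countable_bigcupT_measurable => [|q]; last by case: asboolP.
exact: countableP.
Qed.

Lemma continuous_measurable_rV (R : realType) n (f : 'rV[R]_n -> R) :
  continuous f -> measurable_fun [set: 'rV[R]_n] f.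
Proof.
move=> cf; apply: (measurability _ (RGenOpens.measurableE R)).
move=> _ [_ [a [b ->] <-]]; rewrite setTI.
apply: open_measurable_rV; apply: open_comp; last exact: interval_open.
by move=> v _; exact: cf.
Qed.

Lemma measurable_rV_sub (R : realType) n :
  measurable_fun [set: 'rV[R]_n * 'rV[R]_n] (fun p => p.1 - p.2).
Proof.
apply/measurable_fun_coordP => i.
have -> : (fun x : 'rV[R]_n * 'rV[R]_n => (x.1 - x.2) ord0 i) =
          (fun x => x.1 ord0 i - x.2 ord0 i).
  by apply/funext => x; rewrite !mxE.
by apply: measurable_funB; apply: (measurableT_comp (measurable_coord _)).
Qed.

Lemma measurable_rV_subl (R : realType) n (w : 'rV[R]_n) :
  measurable_fun [set: 'rV[R]_n] (fun v => v - w).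
Proof.
apply/measurable_fun_coordP => i.
under eq_fun do rewrite !mxE.
by apply: measurable_funB => //; exact: measurable_coord.
Qed.

Section continuous_real.
Context {R : realType} {T : topologicalType}.
Implicit Types f g : T -> R.

Lemma continuous_cst (c : R) : continuous (fun _ : T => c).
Proof. by move=> x; exact: cvg_cst. Qed.

Lemma continuous_addf f g : continuous f -> continuous g ->
  continuous (fun x => f x + g x).
Proof. by move=> cf cg x; exact: (continuousD (cf x) (cg x)). Qed.

Lemma continuous_oppf f : continuous f -> continuous (fun x => - f x).
Proof. by move=> cf x; exact: (continuousN (cf x)). Qed.

Lemma continuous_mulf f g : continuous f -> continuous g ->
  continuous (fun x => f x * g x).
Proof. by move=> cf cg x; exact: (continuousM (cf x) (cg x)). Qed.

Lemma continuous_powf f k : continuous f -> continuous (fun x => f x ^+ k).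
Proof.
move=> cf x; apply: (@continuous_comp _ _ _ f (fun y => y ^+ k)); first exact: cf.
exact: exprn_continuous.
Qed.

Lemma continuous_invf f : (forall x, f x != 0) -> continuous f ->
  continuous (fun x => (f x)^-1).
Proof. by move=> f0 cf x; exact: (continuousV (f0 x) (cf x)). Qed.

Lemma continuous_sumf (I : Type) (r : seq I) (F : I -> T -> R) :
  (forall i, continuous (F i)) -> continuous (fun x => \sum_(i <- r) F i x).
Proof.
move=> cF x; apply: cvg_big => [|i _]; last exact: cF.
exact: add_continuous.
Qed.

Lemma continuous_compf (h : R -> R) f : continuous h -> continuous f ->
  continuous (fun x => h (f x)).
Proof. by move=> ch cf x; apply: (@continuous_comp _ _ _ f h); [exact: cf|exact: ch]. Qed.

End continuous_real.

Ltac cont := lazymatch goal with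
  | |- forall x, @continuous_at _ _ x ?f => lazymatch f with
    | (fun _ => ?c) => exact: continuous_cst
    | (fun v => @fun_of_matrix _ _ _ v _ _) => exact: coord_continuous
    | (fun v => @?a v + @?b v) => apply: (@continuous_addf _ _ a b); cont
    | (fun v => - @?a v) => apply: (@continuous_oppf _ _ a); cont
    | (fun v => @?a v * @?b v) => apply: (@continuous_mulf _ _ a b); cont
    | (fun v => @?a v ^+ ?k) => apply: (@continuous_powf _ _ a); cont
    | (fun v => @bigop.body _ _ _ _ (@?F v)) => apply: continuous_sumf => ?; cont
    | _ => idtac
    end
  | _ => idtac
  end.

Section enorm_bracket.
Context {R : realType} {n : nat}.
Implicit Types v w : 'rV[R]_n.

Lemma enorm_sqr v : enorm v ^+ 2 = \sum_i v ord0 i ^+ 2.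
Proof. by rewrite sqr_sqrtr// sumr_ge0// => i _; exact: sqr_ge0. Qed.

Lemma enorm_ge0 v : 0 <= enorm v. Proof. exact: sqrtr_ge0. Qed.

Lemma bracket_sqr v : bracket v ^+ 2 = 1 + enorm v ^+ 2.
Proof. by rewrite sqr_sqrtr// addr_ge0// sqr_ge0. Qed.

Lemma bracket_ge1 v : 1 <= bracket v.
Proof. by rewrite -sqrtr1 ler_wsqrtr// lerDl sqr_ge0. Qed.

Lemma bracket_gt0 v : 0 < bracket v.
Proof. exact: lt_le_trans ltr01 (bracket_ge1 v). Qed.

Lemma enorm_eq0 v : (enorm v == 0) = (v == 0).
Proof.
rewrite -sqrf_eq0 enorm_sqr; apply/eqP/eqP => [|->]; last first.
  by rewrite big1// => i _; rewrite mxE expr0n.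
move/eqP; rewrite psumr_eq0 => [/allP h|i _]; last exact: sqr_ge0.
apply/rowP => i; rewrite mxE; apply/eqP; rewrite -sqrf_eq0.
by apply: h; rewrite mem_index_enum.
Qed.

Lemma coord_le_enorm v i : `|v ord0 i| <= enorm v.
Proof.
rewrite -(@ler_pXn2r _ 2)// ?nnegrE ?enorm_ge0// enorm_sqr real_normK ?num_real//.
by rewrite (bigD1 i)//= lerDl sumr_ge0// => j _; exact: sqr_ge0.
Qed.

Lemma continuous_enorm_sqr : continuous (fun v => enorm v ^+ 2).
Proof.
rewrite (_ : (fun v => _) = (fun v : 'rV[R]_n => \sum_i v ord0 i ^+ 2)); last first.
  by apply/funext => v; exact: enorm_sqr.
by cont.
Qed.

Lemma continuous_enorm : continuous (@enorm R n).
Proof.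
rewrite /enorm; apply: continuous_compf; first exact: sqrt_continuous.
by cont.
Qed.

Lemma continuous_bracket : continuous (@bracket R n).
Proof.
rewrite /bracket; apply: continuous_compf; first exact: sqrt_continuous.
by apply: continuous_addf; [cont|exact: continuous_enorm_sqr].
Qed.

Lemma measurable_enorm : measurable_fun [set: 'rV[R]_n] (@enorm R n).
Proof. exact: continuous_measurable_rV continuous_enorm. Qed.

Lemma measurable_bracket : measurable_fun [set: 'rV[R]_n] (@bracket R n).
Proof. exact: continuous_measurable_rV continuous_bracket. Qed.

End enorm_bracket.

(** * Fubini for row vectors; integrals of partial derivatives *)

Section rV_fubini.
Context {R : realType}.
Local Notation leb n := (@lebesgue_rV R n).
Local Notation mu := (@lebesgue_measure R).
Local Open Scope ereal_scope.

Lemma ge0_integral_rV_cons n (f : 'rV[R]_n.+1 -> \bar R) :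
  measurable_fun setT f -> (forall v, 0 <= f v) ->
  \int[leb n.+1]_v f v = \int[mu \x leb n]_p f (rV_cons p).
Proof.
move=> mf f0.
have := @ge0_integral_pushforward _ _ (measurableTypeR R * 'rV[R]_n)%type
  'rV[R]_n.+1 R _ (@measurable_rV_cons R n) (mu \x leb n) setT f measurableT mf.
by rewrite preimage_setT; apply => v _; exact: f0.
Qed.

Lemma integrable_rV_cons n (f : 'rV[R]_n.+1 -> \bar R) :
  (leb n.+1).-integrable setT f ->
  (mu \x leb n).-integrable setT (f \o @rV_cons R n).
Proof.
move=> /integrableP[mf foo]; apply/integrableP; split.
  exact: (measurableT_comp mf (@measurable_rV_cons R n)).
rewrite -(ge0_integral_rV_cons (f := fun v => `|f v|))//.
exact: measurableT_comp.
Qed.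

Lemma integral_rV_cons n (f : 'rV[R]_n.+1 -> \bar R) :
  (leb n.+1).-integrable setT f ->
  \int[leb n.+1]_v f v = \int[mu \x leb n]_p f (rV_cons p).
Proof.
move=> intf.
have := @integral_pushforward _ _ (measurableTypeR R * 'rV[R]_n)%type
  'rV[R]_n.+1 R _ (@measurable_rV_cons R n) (mu \x leb n) setT f.
rewrite preimage_setT; apply => //; first exact: measurable_int intf.
exact: integrable_rV_cons.
Qed.

End rV_fubini.

Section integral_partial.
Context {R : realType}.
Local Notation leb n := (@lebesgue_rV R n).
Local Notation mu := (@lebesgue_measure R).

(** The fundamental theorem of calculus on an interval beyond the support: [u] vanishes at both
    ends, and outside the interval [g] is zero because [u] is locally constant there. *)
Lemma integral_derive_bounded_support (u g : R -> R) (M : R) :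
  (forall x : R, is_derive x (1 : R) u (g x)) -> continuous g ->
  (forall x, M < `|x| -> u x = 0) ->
  (\int[mu]_x (g x)%:E = 0)%E.
Proof.
move=> ug cg u0.
have u0' (x : R) : `|M| < `|x| -> u x = 0.
  by move=> Mx; apply: u0; apply: le_lt_trans Mx; exact: ler_norm.
pose N : R := `|M| + 1.
(* The absolute value covers a negative [M]; the added 1 puts the endpoints strictly outside the
   support. *)
have N0 : 0 < N by rewrite ltr_wpDl.
have g0 x : N < `|x| -> g x = 0.
  move=> Nx; have /= := ug x => -[_ <-].
  have near_u : \near x, u x = cst 0 x.
    have [e e0 he] : exists2 e : R, 0 < e & forall y, `|x - y| < e -> N < `|y|.
      exists (`|x| - N); first by rewrite subr_gt0.
      move=> y xy; have := ler_normB x (x - y); rewrite subKr => h.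
      have := ler_distD y x 0; rewrite !subr0; lra.
    apply/nbhs_ballP; exists e => //= y /he Ny; apply: u0'.
    by apply: lt_trans Ny; rewrite ltrDl.
  rewrite (near_eq_derive _ near_u).
  by rewrite derive_cst.
rewrite [LHS](_ : _ = \int[mu]_(x in `[(- N)%R, N]) (g x)%:E)%E; last first.
  rewrite [in RHS]integral_mkcond; apply: eq_integral => x _.
  rewrite patchE; case: ifPn => // /negP h.
  rewrite g0// ltNge; apply/negP => xN; apply: h.
  by rewrite inE /= in_itv/= -ler_norml.
rewrite (@continuous_FTC2 _ g u); last 4 first.
- by rewrite gtrN.
- exact: continuous_subspaceT.
- have cu : continuous u.
    move=> x; apply: differentiable_continuous; apply/derivable1_diffP.
    exact: ex_derive.
  split => //.
  + exact/cvg_at_right_filter/cu.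
  + exact/cvg_at_left_filter/cu.
- by move=> x _; rewrite derive1E; have [] := ug x.
have MN : `|M| < `|N| by rewrite (gtr0_norm N0) ltrDl.
by rewrite (u0' _ MN) u0' ?normrN// subee.
Qed.

Lemma scale_delta_cons0 n (h x : R) (v : 'rV[R]_n) :
  h *: delta_mx ord0 ord0 + rV_cons (x, v) = rV_cons (h + x, v).
Proof.
apply/rowP => i; rewrite !mxE eqxx /=.
case: unliftP => [j ->|->] /=.
  by rewrite mulr0 add0r.
by rewrite mulr1.
Qed.

Lemma scale_delta_cons_lift n (h x : R) (v : 'rV[R]_n) j :
  h *: delta_mx ord0 (lift ord0 j) + rV_cons (x, v) =
  rV_cons (x, h *: delta_mx ord0 j + v).
Proof.
apply/rowP => i; rewrite !mxE eqxx /=.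
case: unliftP => [k ->|->] /=.
  by rewrite !mxE (inj_eq lift_inj).
by rewrite mulr0 add0r.
Qed.

Lemma continuous_rV_cons1 n (v : 'rV[R]_n) : continuous (fun x => rV_cons (x, v)).
Proof.
move=> x A /= /nbhs_ballP[e /= e0 eA]; apply/nbhs_ballP; exists e => //= y xy.
apply: eA; apply: rV_ballP => // i; rewrite !mxE.
by case: unliftP => [j _|_] //=; rewrite subrr normr0.
Qed.

Lemma continuous_rV_cons2 n (x : R) : continuous (fun v : 'rV[R]_n => rV_cons (x, v)).
Proof.
move=> v A /= /nbhs_ballP[e /= e0 eA]; apply/nbhs_ballP; exists e => //= w [_ vw].
apply: eA; apply: rV_ballP => // i; rewrite !mxE.
by case: unliftP => [j _|_] /=; [exact: vw|rewrite subrr normr0].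
Qed.

(** Induction on the dimension, splitting off the first coordinate. If [i] is that coordinate, it is
    integrated first and the one-dimensional case applies to each slice; otherwise the first
    coordinate is frozen and the induction hypothesis applies. Only boundedness of the support in
    direction [i] is asked for, a condition that slices inherit. *)
Lemma integral_partial_eq0 n (i : 'I_n) (u g : 'rV[R]_n -> R) (M : R) :
  (forall v, is_derive v (delta_mx ord0 i) u (g v)) -> continuous g ->
  (forall v : 'rV[R]_n, M < `|v ord0 i| -> u v = 0) ->
  (leb n).-integrable setT (EFin \o g) ->
  (\int[leb n]_v (g v)%:E = 0)%E.
Proof.
elim: n i u g => [[]//|n IH i] u g ug cg u0 intg.
rewrite (integral_rV_cons intg)//.
have intg' := integrable_rV_cons intg.
case: (unliftP ord0 i) => [j|] iE.
  rewrite -(integral12_prod_meas1 intg').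
  (* Fubini makes only almost every slice integrable, so the inner integral is shown to vanish
     almost everywhere. *)
  rewrite (@ae_eq_integral _ _ _ _ _ (cst 0)) ?integral0//.
    exact: (measurable_fubini_F intg').
  apply: filterS (ae_integrable1 intg') => x intx _.
  rewrite /fubini_F; apply: (IH j (fun v => u (rV_cons (x, v)))) => //.
  - move=> v; have := ug (rV_cons (x, v)); apply: is_derive_transfer => h.
    by rewrite iE scale_delta_cons_lift.
  - by move=> v; apply: (@continuous_comp _ _ _ (fun v => rV_cons (x, v)) g);
      [exact: continuous_rV_cons2|exact: cg].
  - by move=> v Mv; apply: u0; rewrite iE mxE liftK.
rewrite -(integral21_prod_meas1 intg').
rewrite integral0_eq// => v _; rewrite /fubini_G.
apply: (@integral_derive_bounded_support (fun x => u (rV_cons (x, v))) _ M).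
- move=> x; have := ug (rV_cons (x, v)); apply: is_derive_transfer => h.
  by rewrite iE scale_delta_cons0/= /GRing.scale/= mulr1.
- by move=> x; apply: (@continuous_comp _ _ _ (fun x => rV_cons (x, v)) g);
      [exact: continuous_rV_cons1|exact: cg].
- by move=> x Mx; apply: u0; rewrite iE mxE unlift_none.
Qed.

End integral_partial.

(** * Differentiation rules in a fixed direction *)

Section derivatives.
Context {R : realType} {V : normedModType R}.
Implicit Types (f g : V -> R) (x v : V).

Lemma is_derive_addf f g x v a b : is_derive x v f a -> is_derive x v g b ->
  is_derive x v (fun y => f y + g y) (a + b).
Proof. by move=> fa gb; exact: is_deriveD. Qed.

Lemma is_derive_oppf f x v a : is_derive x v f a ->
  is_derive x v (fun y => - f y) (- a).
Proof. by move=> fa; exact: is_deriveN. Qed.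

Lemma is_derive_mulf f g x v a b : is_derive x v f a -> is_derive x v g b ->
  is_derive x v (fun y => f y * g y) (a * g x + f x * b).
Proof.
move=> fa gb; have := @is_deriveM _ _ f g x v a b fa gb.
by rewrite /GRing.scale/= addrC [g x * a]mulrC.
Qed.

Lemma is_derive_sqrf f x v a : is_derive x v f a ->
  is_derive x v (fun y => f y ^+ 2) (2 * f x * a).
Proof.
move=> fa; have := @is_deriveX _ _ f 2 x v a fa.
by rewrite /= expr1.
Qed.

Lemma is_derive_invf f x v a : f x != 0 -> is_derive x v f a ->
  is_derive x v (fun y => (f y)^-1) (- (a / f x ^+ 2)).
Proof.
move=> fx0 [df fa]; split; first exact: derivableV.
by rewrite deriveV// fa /GRing.scale/= mulNr mulrC.
Qed.

Lemma is_derive_sumf (I : Type) (r : seq I) (F : I -> V -> R) x v (a : I -> R) :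
  (forall i, is_derive x v (F i) (a i)) ->
  is_derive x v (fun y => \sum_(i <- r) F i y) (\sum_(i <- r) a i).
Proof.
move=> Fa; elim: r => [|i r IH].
  rewrite big_nil [X in is_derive _ _ X](_ : _ = cst 0).
    exact: is_derive_cst.
  by apply/funext => y; rewrite big_nil.
rewrite big_cons [X in is_derive _ _ X](_ : _ = (fun y => F i y + \sum_(j <- r) F j y)).
  exact: is_derive_addf.
by apply/funext => y; rewrite big_cons.
Qed.

Lemma is_derive_lineP f x v a :
  is_derive x v f a <-> is_derive (0 : R) (1 : R) (fun h => f (h *: v + x)) a.
Proof.
by split; apply: is_derive_transfer => h; rewrite ?addr0 /GRing.scale/= ?mulr1 ?addr0.
Qed.

(** Restricted to a line this is the one-dimensional chain rule, so a single directional derivative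
    of [f] is enough. *)
Lemma is_derive_compf (h : R -> R) f x v a b :
  is_derive (f x) (1 : R) h b -> is_derive x v f a ->
  is_derive x v (fun y => h (f y)) (b * a).
Proof.
move=> hb /is_derive_lineP fa; apply/is_derive_lineP.
apply: is_derive1_comp => //=.
by rewrite scale0r add0r.
Qed.

End derivatives.

(** The error of the difference quotient is at most [C |h|]. Meant for points where a function
    changes formula: the squared positive part, and [flat_exp] at 0. *)
Lemma is_derive_quadratic (R : realType) (f : R -> R) (x a C : R) :
  (forall h, `|f (x + h) - f x - a * h| <= C * h ^+ 2) ->
  is_derive x (1 : R) f a.
Proof.
move=> fC.
have lim : h^-1 *: ((f \o shift x) (h *: (1:R)) - f x) @[h --> (0:R)^'] --> a.
  have C0 : 0 <= C by have := le_trans (normr_ge0 _) (fC 1); rewrite expr1n mulr1.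
  apply/cvgrPdist_le => e e0; near=> h.
  have h0 : h != 0 by near: h; exact: nbhs_dnbhs_neq.
  rewrite -normrN opprB /GRing.scale/= mulr1.
  rewrite -[X in _ - X](mulKf h0) -mulrBr normrM normfV ler_pdivrMl ?normr_gt0//.
  rewrite [h + x]addrC [h * a]mulrC; apply: le_trans (fC h) _.
  rewrite -[in leLHS](real_normK (num_real h)) expr2 mulrA [leRHS]mulrC.
  rewrite ler_wpM2r//.
  have hC : `|h| <= e / (C + 1).
    by near: h; apply: dnbhs0_le; rewrite divr_gt0// ltr_wpDl.
  apply: le_trans (_ : (C + 1) * `|h| <= _); first by rewrite ler_wpM2r// lerDl.
  by rewrite mulrC -ler_pdivlMr// ltr_wpDl.
split; first by apply/cvg_ex; exists a.
exact: cvg_lim.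
Unshelve. all: by end_near. Qed.

Lemma is_derive_coord (R : realType) n (i j : 'I_n) (v : 'rV[R]_n) :
  is_derive v (delta_mx ord0 i) (fun u : 'rV[R]_n => u ord0 j) (j == i)%:R.
Proof.
apply/is_derive_lineP; apply: (@is_derive_quadratic _ _ _ _ 0) => h.
by rewrite !mxE !eqxx/= add0r mul0r add0r mul0r addrK mulrC subrr normr0.
Qed.

Lemma is_derive_sqr_pos (R : realType) (x : R) :
  is_derive x (1 : R) (fun t => Num.max 0 t ^+ 2) (2 * Num.max 0 x).
Proof.
apply: (@is_derive_quadratic _ _ _ _ 1) => h; rewrite ler_norml.
case: (lerP 0 x) => x0; case: (lerP 0 (x + h)) => xh0; apply/andP; split; nra.
Qed.

Section box.
Context {R : realType} {n : nat}.
Implicit Types v w : 'rV[R]_n.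
Local Notation leb := (@lebesgue_rV R n).

(** Cubes rather than Euclidean balls: compactness and volume are then those of a product of
    intervals. *)
Definition box w (r : R) : set 'rV[R]_n := [set v | forall i, `|v ord0 i - w ord0 i| <= r].

Lemma boxE w r : box w r = [set v | forall i, `[w ord0 i - r, w ord0 i + r]%classic (v ord0 i)].
Proof.
by apply/seteqP; split => v /= h i; have := h i; rewrite in_itv/= -ler_distl.
Qed.

Lemma compact_box w r : compact (box w r).
Proof.
rewrite boxE; apply: (@rV_compact _ _ (fun i => `[w ord0 i - r, w ord0 i + r]%classic)).
by move=> i; exact: segment_compact.
Qed.

Lemma measurable_box w r : measurable (box w r).
Proof.
have -> : box w r = \bigcap_(i in [set: 'I_n])
    [set v : 'rV[R]_n | `[w ord0 i - r, w ord0 i + r]%classic (v ord0 i)].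
  by rewrite boxE; apply/seteqP; split => v /= vA i; [move=> _; exact: vA|exact: vA].
apply: fin_bigcap_measurable => // i _.
by rewrite -[X in measurable X]setTI; exact: measurable_coord.
Qed.

Lemma lebesgue_box w (r : R) : 0 <= r -> leb (box w r) = ((2 * r) ^+ n)%:E.
Proof.
move=> r0; rewrite boxE.
rewrite (@lebesgue_rV_box _ _ (fun i => `[w ord0 i - r, w ord0 i + r]%classic))//.
under eq_bigr => i _.
  rewrite lebesgue_measure_itv/= lte_fin.
  rewrite (_ : (if _ then _ else _) = (2 * r)%:E); first over.
  case: ltP => h; first by rewrite -EFinD; congr EFin; lra.
  by congr EFin; lra.
by rewrite prodEFin big_const card_ord iter_mulr_1.
Qed.

Lemma continuous_bounded_box (g : 'rV[R]_n -> R) w r : continuous g ->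
  exists M : R, forall v, box w r v -> `|g v| <= M.
Proof.
move=> cg; have [->|/set0P b0] := eqVneq (box w r) set0; first by exists 0.
have cg' : continuous (fun v : 'rV[R]_n => `|g v|).
  by apply: continuous_compf => //; exact: norm_continuous.
have [c _ hc] := compact_EVT_max b0 (@compact_box w r) (continuous_subspaceT cg').
by exists (`|g c|) => v bv; apply: hc; rewrite inE.
Qed.

Lemma integrable_continuous_box (g : 'rV[R]_n -> R) w r : 0 <= r -> continuous g ->
  leb.-integrable (box w r) (EFin \o g).
Proof.
move=> r0 cg; apply: measurable_bounded_integrable => //.
- exact: measurable_box.
- by have := ltry ((2 * r) ^+ n); rewrite -(lebesgue_box w r0).
- exact: measurable_funTS (continuous_measurable_rV cg).
have [M hM] := continuous_bounded_box w r cg.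
exists M; split; first exact: num_real.
by move=> x /ltW Mx y /= /hM h; exact: le_trans h Mx.
Qed.

Lemma integrable_bounded_support (g : 'rV[R]_n -> R) w r : 0 <= r -> continuous g ->
  (forall v, ~ box w r v -> g v = 0) -> leb.-integrable setT (EFin \o g).
Proof.
move=> r0 cg g0.
have := integrable_continuous_box w r0 cg.
move/(integrable_mkcond _ (measurable_box w r)); apply: eq_integrable => // v _.
by rewrite /= patchE; case: ifPn => // /negP h; rewrite g0// => h'; apply: h; rewrite inE.
Qed.

End box.

(** * A local Hardy inequality *)

Section hardy.
Context {R : realType} {n : nat}.
Hypothesis n3 : (3 <= n)%N.
Local Notation leb := (@lebesgue_rV R n).
Variables (psi : 'rV[R]_n -> R) (D : 'I_n -> 'rV[R]_n -> R) (w : 'rV[R]_n).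
Hypothesis Dpsi : forall i v, is_derive v (delta_mx ord0 i) psi (D i v).
Hypothesis cpsi : continuous psi.
Hypothesis cD : forall i, continuous (D i).

Let z i (v : 'rV[R]_n) : R := v ord0 i - w ord0 i.
Let s (v : 'rV[R]_n) : R := \sum_i z i v ^+ 2.
(** Only the square of this positive part enters the field: it is C^1, and it vanishes outside the
    cube of radius 1 about [w]. *)
Let m (v : 'rV[R]_n) : R := Num.max 0 (1 - s v).

Let cz i : continuous (z i). Proof. by rewrite /z; cont. Qed.
Let cs : continuous s. Proof. by rewrite /s; cont. Qed.
Let cm : continuous m.
Proof.
apply: (continuous_compf (h := fun t => Num.max 0 t)); last by cont; exact: cs.
by move=> x; apply: continuous_max; [exact: cvg_cst|exact: cvg_id].
Qed.

Let s_ge0 v : 0 <= s v. Proof. by apply: sumr_ge0 => i _; exact: sqr_ge0. Qed.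

Let derive_z i j v : is_derive v (delta_mx ord0 i) (z j) (j == i)%:R.
Proof.
rewrite -[(j == i)%:R]addr0; apply: is_derive_addf; first exact: is_derive_coord.
Qed.

Let derive_s i v : is_derive v (delta_mx ord0 i) s (2 * z i v).
Proof.
have -> : 2 * z i v = \sum_j 2 * z j v * (j == i)%:R.
  rewrite (bigD1 i)//= eqxx mulr1 big1 ?addr0// => j /negbTE ->.
  by rewrite mulr0.
by apply: is_derive_sumf => j; apply: is_derive_sqrf; exact: derive_z.
Qed.

Let derive_m2 i v :
  is_derive v (delta_mx ord0 i) (fun v => m v ^+ 2) (- (4 * m v * z i v)).
Proof.
rewrite (_ : - _ = 2 * m v * (0 - 2 * z i v)); last by ring.
apply: (@is_derive_compf _ _ (fun t => Num.max 0 t ^+ 2) (fun v => 1 - s v)).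
  exact: is_derive_sqr_pos.
apply: is_derive_addf.
by apply: is_derive_oppf; exact: derive_s.
Qed.

Section regularized.
Variable del : R.
Hypothesis del0 : 0 < del.

Let sd_gt0 v : 0 < s v + del. Proof. by rewrite ltr_wpDl. Qed.
Let sd_neq0 v : s v + del != 0. Proof. exact: lt0r_neq0. Qed.

(* The vector field psi^2 q z, with z = v - w, has divergence of zero integral; its
   main term is (n - 2) psi^2 q, and n >= 3. *)
Definition hardy_weight v : R := m v ^+ 2 / (s v + del).
Let q := hardy_weight.
(** Radial factor of the gradient of [q]: the i-th derivative of [q] is [z i * r]. Accordingly [g i]
    is the i-th derivative of the component [u i] of the field. *)
Let r v : R := - (4 * m v / (s v + del)) - 2 * m v ^+ 2 / (s v + del) ^+ 2.
Let u i v : R := psi v ^+ 2 * (z i v * q v).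
Let g i v : R :=
  2 * psi v * D i v * (z i v * q v) + psi v ^+ 2 * (q v + z i v ^+ 2 * r v).

Let cinv : continuous (fun v => (s v + del)^-1).
Proof. by apply: continuous_invf => //; cont; exact: cs. Qed.
Let cq : continuous q. Proof. by rewrite /q /hardy_weight; cont; [exact: cm|exact: cinv]. Qed.
Let cr : continuous r.
Proof.
rewrite (_ : r = fun v => - (4 * m v / (s v + del)) - 2 * m v ^+ 2 * (s v + del)^-1 ^+ 2).
  by cont; first [exact: cinv | exact: cm].
by apply/funext => v; rewrite exprVn.
Qed.
Let cg i : continuous (g i).
Proof. by rewrite /g; cont; first [exact: cpsi | exact: cD | exact: cz | exact: cq | exact: cr]. Qed.

Let derive_u i v : is_derive v (delta_mx ord0 i) (u i) (g i v).
Proof.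
rewrite /g; apply: is_derive_mulf; first exact: is_derive_sqrf.
rewrite (_ : q v + _ = (i == i)%:R * q v + z i v * (z i v * r v)); last first.
  by rewrite eqxx mul1r mulrA.
apply: is_derive_mulf; first exact: derive_z.
rewrite (_ : z i v * r v = - (4 * m v * z i v) * (s v + del)^-1 +
   m v ^+ 2 * (- ((2 * z i v + 0) / (s v + del) ^+ 2))); last first.
  by rewrite /r; field; rewrite sd_neq0.
apply: is_derive_mulf; first exact: derive_m2.
apply: is_derive_invf => //.
by apply: is_derive_addf; exact: derive_s.
Qed.

Let m_eq0 v : ~ box w 1 v -> m v = 0.
Proof.
move=> nb; apply/max_idPl; rewrite subr_le0 leNgt; apply/negP => s1; apply: nb => i.
rewrite -(@ler_pXn2r _ 2)// ?nnegrE// expr1n real_normK ?num_real//.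
by apply: le_trans (ltW s1); rewrite /s (bigD1 i)//= lerDl sumr_ge0// => j _; exact: sqr_ge0.
Qed.

Let u_eq0 i (v : 'rV[R]_n) : 1 + `|w ord0 i| < `|v ord0 i| -> u i v = 0.
Proof.
move=> h; rewrite /u /q /hardy_weight m_eq0 ?expr0n/= ?mul0r ?mulr0// => /(_ i).
have := ler_distD (w ord0 i) (v ord0 i) 0; rewrite !subr0; lra.
Qed.

Let g_eq0 i v : ~ box w 1 v -> g i v = 0.
Proof.
move=> /m_eq0 mv; rewrite /g /r /q /hardy_weight mv expr0n/=.
by rewrite !(mul0r,mulr0,oppr0,subr0,addr0).
Qed.

Let int_g i : leb.-integrable setT (EFin \o g i).
Proof. by apply: (integrable_bounded_support (w := w) (r := 1)) => //; exact: g_eq0. Qed.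

Let integral_g i : (\int[leb]_v (g i v)%:E = 0)%E.
Proof.
apply: (@integral_partial_eq0 _ _ i (u i) (g i) (1 + `|w ord0 i|)) => //.
exact: u_eq0.
Qed.

Let G v : R := \sum_i D i v ^+ 2.

(** On the cube, [\sum_i g i = 2 psi q (D . z) + psi^2 (n q + s r)]. Since [s r >= -(4 + 2 q)] and
    [n >= 3], the last term is at least [psi^2 (q - 4)]. Young's inequality bounds the cross term
    below by [-(2 G + psi^2 q^2 s / 2)], and [q^2 s <= q], so it consumes only half of [psi^2 q].
    Doubling what remains gives the constants 4, 8 and 2. *)
Let pointwise v : psi v ^+ 2 * q v <=
  (if v \in box w 1 then 4 * G v + 8 * psi v ^+ 2 else 0) + 2 * \sum_i g i v.
Proof.
case: ifPn => [_|/negP nb]; last first.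
  have nb' : ~ box w 1 v by move=> h; apply: nb; rewrite inE.
  rewrite /q /hardy_weight m_eq0// expr0n/= mul0r mulr0 add0r big1 ?mulr0// => i _.
  exact: g_eq0.
have sumg : \sum_i g i v = 2 * psi v * q v * (\sum_i D i v * z i v) +
    psi v ^+ 2 * (n%:R * q v + s v * r v).
  have -> : n%:R * q v = \sum_(i < n) q v by rewrite sumr_const card_ord mulr_natl.
  rewrite /s mulr_suml -big_split/= !mulr_sumr -big_split/=.
  by apply: eq_bigr => i _; rewrite /g; ring.
have cross : - (2 * G v + psi v ^+ 2 * q v ^+ 2 * s v / 2) <=
   2 * psi v * q v * (\sum_i D i v * z i v).
  rewrite /G /s mulr_sumr mulr_sumr [X in _ + X]mulr_suml -big_split/= mulr_sumr -sumrN.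
  apply: ler_sum => i _.
  rewrite -subr_ge0; set a := D i v; set b := psi v; set c := q v; set d := z i v.
  have -> : 2 * b * c * (a * d) - - (2 * a ^+ 2 + b ^+ 2 * c ^+ 2 * d ^+ 2 / 2) =
    (2 * a + b * c * d) ^+ 2 / 2 by field.
  by rewrite divr_ge0// sqr_ge0.
have m0 : 0 <= m v by rewrite le_max lexx.
have m1 : m v <= 1 by rewrite ge_max ler01 gerBl s_ge0.
have sd : s v / (s v + del) <= 1 by rewrite ler_pdivrMr// mul1r lerDl ltW.
have sd0 : 0 <= s v / (s v + del) by rewrite divr_ge0// ltW.
have q0 : 0 <= q v by rewrite /q /hardy_weight divr_ge0// ?sqr_ge0// ltW.
have q2s : q v ^+ 2 * s v <= q v.
  rewrite (_ : q v ^+ 2 * s v = q v * (m v ^+ 2 * (s v / (s v + del)))).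
    by rewrite ler_piMr// mulr_ile1// ?sqr_ge0// expr_le1.
  by rewrite /q /hardy_weight; field; rewrite sd_neq0.
have sr : - (4 + 2 * q v) <= s v * r v.
  rewrite (_ : s v * r v = - (4 * (m v * (s v / (s v + del))) + 2 * (q v * (s v / (s v + del))))).
    have h1 : m v * (s v / (s v + del)) <= 1 by rewrite mulr_ile1.
    have h2 : q v * (s v / (s v + del)) <= q v by rewrite ler_piMr.
    lra.
  by rewrite /r /q /hardy_weight; field; rewrite sd_neq0.
have nq : 3 * q v <= n%:R * q v by rewrite ler_wpM2r// ler_nat.
have p0 : 0 <= psi v ^+ 2 by exact: sqr_ge0.
rewrite sumg.
have k1 : psi v ^+ 2 * (q v ^+ 2 * s v) <= psi v ^+ 2 * q v by rewrite ler_wpM2l.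
have k2 : psi v ^+ 2 * (q v - 4) <= psi v ^+ 2 * (n%:R * q v + s v * r v).
  by rewrite ler_wpM2l//; lra.
rewrite -(mulrA (psi v ^+ 2) (q v ^+ 2)) in cross; rewrite mulrBr in k2.
move: k1 k2 cross; move: (psi v ^+ 2 * (q v ^+ 2 * s v)) (psi v ^+ 2 * q v) => A B.
move: (2 * psi v * q v * _) (psi v ^+ 2 * (n%:R * q v + s v * r v)) => C1 K.
move: (psi v ^+ 2) (G v) p0 => P G1 p0.
lra.
Qed.

Lemma hardy_regularized :
  (\int[leb]_v (psi v ^+ 2 * hardy_weight v)%:E <=
   \int[leb]_(v in box w 1) (4 * G v + 8 * psi v ^+ 2)%:E)%E.
Proof.
have iH : leb.-integrable (box w 1) (EFin \o (fun v => 4 * G v + 8 * psi v ^+ 2)).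
  by apply: integrable_continuous_box => //; rewrite /G; cont; first [exact: cD | exact: cpsi].
rewrite [leRHS](integral_mkcond).
set H := _ \_ _.
have iH' : leb.-integrable setT H by exact/(integrable_mkcond _ (measurable_box w 1)).
have i2g i : leb.-integrable setT (fun v => (2 * g i v)%:E).
  exact: (@integrableZl _ _ _ leb _ measurableT 2 _ (int_g i)).
have iS : leb.-integrable setT (fun v => \sum_i (2 * g i v)%:E)%E.
  by apply: (integrable_sum measurableT) => i _; exact: i2g.
(* The divergence has zero integral, so adding it twice is free and reduces the claim to
   [pointwise]. *)
have -> : (\int[leb]_v H v = \int[leb]_v (H v + (\sum_i (2 * g i v)%:E)))%E.
  rewrite integralD// integral_sum//.
  rewrite big1 ?adde0// => i _.
  transitivity (2%:E * \int[leb]_v (g i v)%:E)%E; last by rewrite integral_g mule0.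
  exact: (@integralZl _ _ _ leb _ measurableT _ (int_g i) 2).
apply: le_integral => //.
- apply: (integrable_bounded_support (w := w) (r := 1)) => //.
    by cont; [exact: cpsi | exact: cq].
  by move=> v /m_eq0 mv; rewrite /hardy_weight mv expr0n/= mul0r mulr0.
- exact: integrableD.
- move=> v _; rewrite /H patchE /= sumEFin -mulr_sumr.
  by have := pointwise v; case: ifPn => _; rewrite -EFinD lee_fin.
Qed.

End regularized.

End hardy.

(** Obtained from measurability of real powers, which agree with the inverse on nonnegative reals;
    the negative side follows by oddness. *)
Lemma measurable_invr (R : realType) : measurable_fun [set: R] (@GRing.inv R).
Proof.
rewrite (_ : GRing.inv = fun x : R =>
    if 0 <= x then x `^ (-1) else - ((- x) `^ (-1))); last first.
  apply/funext => x; case: (lerP 0 x) => x0; first by rewrite powR_inv1.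
  by rewrite powR_inv1 ?oppr_ge0 ?ltW// invrN opprK.
apply: measurable_fun_ifT.
- by apply: measurable_fun_ler => //; exact: measurable_cst.
- exact: measurable_powR.
- apply: measurable_funN; apply: (measurableT_comp (measurable_powR _)).
  exact: measurable_funN.
Qed.

Section hardy_local.
Context {R : realType} {n : nat}.
Local Notation leb := (@lebesgue_rV R n).

(** Cut at [|z| = 1/2], where [(1 - |z|^2)^2 >= 9/16]: there the cutoff in [hardy_weight] loses less
    than a factor 2. At [z = 0] the value is 0, the default inverse. *)
Definition hardy_kernel (z : 'rV[R]_n) : R :=
  if enorm z ^+ 2 <= 4^-1 then (enorm z ^+ 2)^-1 else 0.

Lemma hardy_kernel_ge0 z : 0 <= hardy_kernel z.
Proof. by rewrite /hardy_kernel; case: ifP => // _; rewrite invr_ge0 sqr_ge0. Qed.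

Lemma measurable_hardy_kernel : measurable_fun [set: 'rV[R]_n] hardy_kernel.
Proof.
have mE : measurable_fun [set: 'rV[R]_n] (fun z => enorm z ^+ 2).
  exact: continuous_measurable_rV continuous_enorm_sqr.
apply: measurable_fun_ifT => //.
- by apply: measurable_fun_ler => //; exact: measurable_cst.
- exact: (measurableT_comp (@measurable_invr R) mE).
Qed.

Variables (psi : 'rV[R]_n -> R) (D : 'I_n -> 'rV[R]_n -> R) (w : 'rV[R]_n).
Hypothesis n3 : (3 <= n)%N.
Hypothesis Dpsi : forall i v, is_derive v (delta_mx ord0 i) psi (D i v).
Hypothesis cpsi : continuous psi.
Hypothesis cD : forall i, continuous (D i).

Let s (v : 'rV[R]_n) : R := enorm (v - w) ^+ 2.

(** Approximation with [del = 1/(k + 1)]. Excluding [s v = 0] keeps the sequence convergent at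
    [v = w], with the default value 0 of the kernel as limit. *)
Let f k v : R :=
  psi v ^+ 2 * (if (0 < s v) && (s v <= 4^-1) then (s v + k.+1%:R^-1)^-1 else 0).

Let ms : measurable_fun [set: 'rV[R]_n] s.
Proof.
apply: (measurableT_comp (f := fun z : 'rV[R]_n => enorm z ^+ 2)).
  exact: continuous_measurable_rV continuous_enorm_sqr.
exact: measurable_rV_subl.
Qed.

Let f_ge0 k v : 0 <= f k v.
Proof.
rewrite mulr_ge0 ?sqr_ge0//; case: ifP => // /andP[s0 _].
by rewrite invr_ge0 addr_ge0// ltW.
Qed.

Let mf k : measurable_fun [set: 'rV[R]_n] (f k).
Proof.
apply: measurable_funM.
  by apply: measurable_funX; exact: continuous_measurable_rV.
apply: measurable_fun_ifT => //.
- apply: measurable_and.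
    by apply: measurable_fun_ltr => //; exact: measurable_cst.
  by apply: measurable_fun_ler => //; exact: measurable_cst.
- apply: (measurableT_comp (@measurable_invr R)).
  by apply: measurable_funD => //; exact: measurable_cst.
Qed.

Let f_le k v : f k v <= 2 * (psi v ^+ 2 * hardy_weight w k.+1%:R^-1 v).
Proof.
have k0 : 0 < (k.+1%:R^-1 : R) by rewrite invr_gt0 ltr0n.
have sE : s v = \sum_i (v ord0 i - w ord0 i) ^+ 2.
  by rewrite /s enorm_sqr; apply: eq_bigr => i _; rewrite !mxE.
rewrite mulrCA /f ler_wpM2l ?sqr_ge0// /hardy_weight -sE.
have sk0 : 0 <= (s v + k.+1%:R^-1)^-1.
  by rewrite invr_ge0 addr_ge0// ?sqr_ge0// ltW.
case: ifPn => [/andP[_ s4]|_]; last by rewrite mulr_ge0// mulr_ge0// sqr_ge0.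
rewrite mulrA ler_peMl//.
have -> : Num.max 0 (1 - s v) = 1 - s v by apply/max_idPr; lra.
nra.
Qed.

Let nd_f v k l : (k <= l)%N -> f k v <= f l v.
Proof.
move=> kl; rewrite /f ler_wpM2l ?sqr_ge0//; case: ifP => // /andP[s0 _].
have i0 j : 0 < (j.+1%:R^-1 : R) by rewrite invr_gt0 ltr0n.
rewrite lef_pV2 ?posrE ?addr_gt0//.
by rewrite lerD2l lef_pV2 ?posrE ?ltr0n// ler_nat ltnS.
Qed.

(** Monotone convergence in [k], since the regularized bound does not involve [del]. The constants 8
    and 16 are those of [hardy_regularized] doubled by [f_le]. *)
Lemma hardy_local :
  (\int[leb]_v (psi v ^+ 2 * hardy_kernel (v - w))%:E <=
   \int[leb]_(v in box w 1) (8 * \sum_i D i v ^+ 2 + 16 * psi v ^+ 2)%:E)%E.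
Proof.
have fk k : (\int[leb]_v (f k v)%:E <=
    \int[leb]_(v in box w 1) (8 * \sum_i D i v ^+ 2 + 16 * psi v ^+ 2)%:E)%E.
  have k0 : 0 < (k.+1%:R^-1 : R) by rewrite invr_gt0 ltr0n.
  have hw0 v : 0 <= hardy_weight w k.+1%:R^-1 v.
    rewrite /hardy_weight divr_ge0 ?sqr_ge0// addr_ge0//.
    by apply: sumr_ge0 => i _; exact: sqr_ge0.
  have mhw : measurable_fun [set: 'rV[R]_n] (fun v => psi v ^+ 2 * hardy_weight w k.+1%:R^-1 v).
    apply: measurable_funM.
      by apply: measurable_funX; exact: continuous_measurable_rV.
    have mq : measurable_fun [set: 'rV[R]_n] (fun v => \sum_i (v ord0 i - w ord0 i) ^+ 2).
      by apply: continuous_measurable_rV; cont.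
    apply: measurable_funM.
      apply: measurable_funX; apply: measurable_maxr; first exact: measurable_cst.
      by apply: measurable_funB => //; exact: measurable_cst.
    apply: (measurableT_comp (@measurable_invr R)).
    by apply: measurable_funD => //; exact: measurable_cst.
  apply: le_trans (_ : \int[leb]_v (2%:E * (psi v ^+ 2 * hardy_weight w k.+1%:R^-1 v)%:E) <= _)%E.
    apply: ge0_le_integral => //.
    - by move=> v _; rewrite lee_fin.
    - exact/measurable_EFinP.
    - by apply/measurable_EFinP; apply: measurable_funM => //; exact: measurable_cst.
    - by move=> v _; rewrite -EFinM lee_fin.
  rewrite ge0_integralZl//; last 2 first.
    - exact/measurable_EFinP.
    - by move=> v _; rewrite lee_fin mulr_ge0// sqr_ge0.
  apply: le_trans (lee_wpmul2l _ (hardy_regularized n3 w Dpsi cpsi cD k0)) _ => //.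
  rewrite -ge0_integralZl//.
  - rewrite le_eqVlt; apply/orP; left; apply/eqP.
    by apply: eq_integral => v _; rewrite -EFinM; congr EFin; ring.
  - exact: measurable_box.
  - apply/measurable_EFinP; apply: measurable_funTS; apply: continuous_measurable_rV.
    by cont; first [exact: cD | exact: cpsi].
  - move=> v _; rewrite lee_fin addr_ge0// mulr_ge0// ?sqr_ge0//.
    by apply: sumr_ge0 => i _; exact: sqr_ge0.
have fE v : limn (fun k => (f k v)%:E) = (psi v ^+ 2 * hardy_kernel (v - w))%:E.
  apply/cvg_lim => //; apply: cvg_EFin.
    by near=> k.
  apply: (@cvgM _ _ _ _ (fun=> psi v ^+ 2)); first exact: cvg_cst.
  rewrite /hardy_kernel -/(s v); have [s0|s0] := ltP 0 (s v); last first.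
    have -> : s v = 0 by apply/eqP; rewrite eq_le s0 sqr_ge0.
    by rewrite invr0 if_same; exact: cvg_cst.
  case: ifP => _ /=; last exact: cvg_cst.
  apply: cvgV; first by rewrite gt_eqF.
  rewrite -[X in _ --> X]addr0; apply: cvgD; first exact: cvg_cst.
  exact: cvg_harmonic.
rewrite (_ : \int[leb]_v _ = \int[leb]_v (limn (fun k => (f k v)%:E)))%E; last first.
  by apply: eq_integral => v _; rewrite fE.
rewrite monotone_convergence//.
- apply: lime_le; last by near=> k; exact: fk.
  apply: ereal_nondecreasing_is_cvgn => k l kl; apply: ge0_le_integral => //.
  + by move=> v _; rewrite lee_fin.
  + exact/measurable_EFinP.
  + exact/measurable_EFinP.
  + by move=> v _; rewrite lee_fin; exact: nd_f.
- by move=> k; exact/measurable_EFinP.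
- by move=> k v _; rewrite lee_fin.
- by move=> v _ k l kl; rewrite lee_fin; exact: nd_f.
Unshelve. all: by end_near. Qed.

End hardy_local.

(** * The weighted function <v>^a phi *)

Section weighted.
Context {R : realType} {n : nat}.
Implicit Types v w : 'rV[R]_n.

(** Moves the square root into the exponent: the base [1 + |v|^2] is smooth and positive, while
    [enorm] is not differentiable at 0. *)
Lemma bracket_powR v (a : R) : bracket v `^ a = (1 + enorm v ^+ 2) `^ (a / 2).
Proof.
by rewrite /bracket -powR12_sqrt ?addr_ge0 ?sqr_ge0// -powRrM mulrC.
Qed.

Let B v : R := 1 + \sum_i v ord0 i ^+ 2.

Let B_gt0 v : 0 < B v.
Proof. by rewrite ltr_wpDr// sumr_ge0// => i _; exact: sqr_ge0. Qed.

Lemma continuous_bracket_powR (a : R) : continuous (fun v : 'rV[R]_n => bracket v `^ a).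
Proof.
rewrite (_ : (fun v => _) = fun v => B v `^ (a / 2)); last first.
  by apply/funext => v; rewrite bracket_powR enorm_sqr.
move=> v; apply: (@continuous_comp _ _ _ B (fun x => x `^ (a / 2))).
  by have cB : continuous B by [rewrite /B; cont]; exact: cB.
apply: differentiable_continuous; apply/derivable1_diffP.
by have [] := is_derive1_powR (a / 2) (B_gt0 v).
Qed.

Lemma is_derive_bracket_powR (a : R) i v :
  is_derive v (delta_mx ord0 i) (fun v : 'rV[R]_n => bracket v `^ a)
    (a * v ord0 i * bracket v `^ (a - 2)).
Proof.
rewrite (_ : (fun v => _) = fun v => B v `^ (a / 2)); last first.
  by apply/funext => u; rewrite bracket_powR enorm_sqr.
rewrite (_ : a * v ord0 i * _ = (a / 2) * B v `^ (a / 2 - 1) * (2 * v ord0 i)); last first.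
  rewrite bracket_powR enorm_sqr -/(B v).
  by rewrite (_ : (a - 2) / 2 = a / 2 - 1); [field|field].
apply: (@is_derive_compf _ _ (fun x => x `^ (a / 2)) B); first exact: is_derive1_powR.
rewrite -[2 * _]add0r; apply: is_derive_addf.
rewrite [X in is_derive _ _ _ X](_ : _ = \sum_j 2 * v ord0 j * (j == i)%:R).
  by apply: is_derive_sumf => j; apply: is_derive_sqrf; exact: is_derive_coord.
rewrite (bigD1 i)//= eqxx mulr1 big1 ?addr0// => j /negbTE ->.
by rewrite mulr0.
Qed.

Variables (phi : 'rV[R]_n -> R) (a : R).
Hypothesis sphi : smooth phi.

Let psi := fun v : 'rV[R]_n => bracket v `^ a * phi v.

Lemma smooth_continuous : continuous phi.
Proof. by have [] := sphi [::]. Qed.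

Lemma is_derive_weighted i v : is_derive v (delta_mx ord0 i) psi (partial i psi v).
Proof.
have [_ d] := sphi [::].
have h : is_derive v (delta_mx ord0 i) phi (partial i phi v).
  by apply: derivableP; exact: d.
have := is_derive_mulf (is_derive_bracket_powR a i v) h => h'.
by apply: derivableP; exact: ex_derive.
Qed.

Lemma continuous_partial_weighted i : continuous (partial i psi).
Proof.
have [_ d] := sphi [::].
rewrite (_ : partial i psi = fun v => (a * v ord0 i * bracket v `^ (a - 2)) * phi v +
    bracket v `^ a * partial i phi v).
  by cont; first [exact: continuous_bracket_powR | exact: smooth_continuous
    | have [] := sphi [:: i]].
apply/funext => v.
have h : is_derive v (delta_mx ord0 i) phi (partial i phi v).
  by apply: derivableP; exact: d.
by have [_] := is_derive_mulf (is_derive_bracket_powR a i v) h.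
Qed.

Lemma continuous_weighted : continuous psi.
Proof.
by rewrite /psi; cont; [exact: continuous_bracket_powR|exact: smooth_continuous].
Qed.

Lemma enorm_grad v : enorm (grad psi v) ^+ 2 = \sum_i partial i psi v ^+ 2.
Proof. by rewrite enorm_sqr; apply: eq_bigr => i _; rewrite mxE. Qed.

End weighted.

(** * Pointwise bounds on the kernel *)

Section kernel_bound.
Context {R : realType} {n : nat}.
Implicit Types v w z : 'rV[R]_n.

Lemma enormD v w : enorm (v + w) <= enorm v + enorm w.
Proof.
have vw0 : 0 <= enorm v + enorm w by rewrite addr_ge0// enorm_ge0.
rewrite -(@ler_pXn2r _ 2)// ?nnegrE ?enorm_ge0//.
have cs : (\sum_i v ord0 i * w ord0 i) <= enorm v * enorm w.
  have [v0|v0] := eqVneq v 0.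
    rewrite big1 ?mulr_ge0 ?enorm_ge0// => i _; by rewrite v0 mxE mul0r.
  have [w0|w0] := eqVneq w 0.
    rewrite big1 ?mulr_ge0 ?enorm_ge0// => i _; by rewrite w0 mxE mulr0.
  have a0 : 0 < enorm v by rewrite lt_neqAle enorm_ge0 andbT eq_sym enorm_eq0.
  have b0 : 0 < enorm w by rewrite lt_neqAle enorm_ge0 andbT eq_sym enorm_eq0.
  (* Cauchy-Schwarz by Young's inequality in each coordinate, with weights balanced so that either
     half sums to [|v| |w| / 2]. *)
  have : \sum_i (v ord0 i * w ord0 i) <=
      \sum_i (enorm w / enorm v / 2 * v ord0 i ^+ 2 + enorm v / enorm w / 2 * w ord0 i ^+ 2).
    apply: ler_sum => i _; rewrite -subr_ge0.
    set x := v ord0 i; set y := w ord0 i; set p := enorm v; set q := enorm w.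
    have -> : q / p / 2 * x ^+ 2 + p / q / 2 * y ^+ 2 - x * y =
      (q * x - p * y) ^+ 2 / (2 * p * q).
      by field; rewrite !gt_eqF.
    by rewrite divr_ge0 ?sqr_ge0// mulr_ge0 ?mulr_ge0// ltW.
  rewrite big_split/= -!mulr_sumr -!enorm_sqr => /le_trans; apply.
  rewrite le_eqVlt; apply/orP; left; apply/eqP.
  by field; rewrite !gt_eqF.
rewrite sqrrD !enorm_sqr.
have -> : \sum_i (v + w) ord0 i ^+ 2 =
   \sum_i v ord0 i ^+ 2 + (\sum_i v ord0 i * w ord0 i) *+ 2 + \sum_i w ord0 i ^+ 2.
  rewrite -sumrMnl -!big_split/=; apply: eq_bigr => i _.
  by rewrite !mxE sqrrD.
by rewrite lerD2r lerD2l lerMn2r.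
Qed.

Lemma enormN v : enorm (- v) = enorm v.
Proof. by rewrite /enorm; under eq_bigr do rewrite mxE sqrrN. Qed.

Lemma hardy_kernelN z : hardy_kernel (- z) = hardy_kernel z.
Proof. by rewrite /hardy_kernel enormN. Qed.

(** Peetre's inequality: [1 + (|w| + |v - w|)^2 <= 2 <w>^2 + 2 |v - w|^2]. The maximum, rather than
    a product, is what lets [weighted_kernel_le] separate two regimes. *)
Lemma bracket_le_max v w : bracket v <= 2 * Num.max (bracket w) (enorm (v - w)).
Proof.
have h : enorm v <= enorm w + enorm (v - w).
  by have := enormD w (v - w); rewrite addrC subrK.
have M0 : 0 <= Num.max (bracket w) (enorm (v - w)).
  by rewrite le_max ltW// bracket_gt0.
rewrite -(@ler_pXn2r _ 2)// ?nnegrE ?mulr_ge0// ?ltW ?bracket_gt0//.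
rewrite bracket_sqr.
have w0 := enorm_ge0 w; have z0 := enorm_ge0 (v - w); have v0 := enorm_ge0 v.
have b0 := ltW (bracket_gt0 w); have bE := bracket_sqr w.
have : bracket w <= Num.max (bracket w) (enorm (v - w)) by rewrite le_max lexx.
have : enorm (v - w) <= Num.max (bracket w) (enorm (v - w)) by rewrite le_max lexx orbT.
move: (Num.max _ _) M0 => M M0; move: (enorm (v - w)) (enorm v) (enorm w) (bracket w) h w0 z0 v0 b0 bE.
move=> z a b c h w0 z0 v0 b0 bE zM cM.
have c2 : c ^+ 2 <= M ^+ 2 by rewrite ler_pXn2r// nnegrE.
have z2 : z ^+ 2 <= M ^+ 2 by rewrite ler_pXn2r// nnegrE.
have a2 : a ^+ 2 <= (b + z) ^+ 2 by rewrite ler_pXn2r// nnegrE// addr_ge0.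
nra.
Qed.

(** For [|z| <= r] write [|z|^gamma = |z|^(2 + gamma) |z|^-2], where [r <= 1/2] keeps [z] in the
    support of [hardy_kernel]; for [|z| > r] the power is decreasing. At [z = 0] the left side is 0
    by convention. *)
Lemma powR_enorm_le (gamma r : R) z : -2 <= gamma < 0 -> 0 < r <= 2^-1 ->
  enorm z `^ gamma <= r `^ (2 + gamma) * hardy_kernel z + r `^ gamma.
Proof.
move=> /andP[g2 g0] /andP[r0 r2].
have rg := powR_ge0 r gamma; have hk := hardy_kernel_ge0 z; have rg2 := powR_ge0 r (2 + gamma).
have [->|z0] := eqVneq (enorm z) 0.
  by rewrite powR0 ?lt_eqF// addr_ge0// mulr_ge0.
have zp : 0 < enorm z by rewrite lt_neqAle eq_sym z0 enorm_ge0.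
have [zr|rz] := leP (enorm z) r.
  rewrite ler_wpDr// /hardy_kernel ifT; last first.
    rewrite (_ : 4^-1 = 2^-1 ^+ 2); last by field.
    by rewrite ler_pXn2r ?nnegrE ?(ltW zp)// (le_trans zr).
  rewrite -powR_mulrn ?(ltW zp)// -powRN.
  have -> : enorm z `^ gamma = enorm z `^ (2 + gamma) * enorm z `^ (- 2).
    by rewrite -powRD ?z0 ?implybT//; congr (_ `^ _); lra.
  by rewrite ler_wpM2r ?powR_ge0// ge0_ler_powR ?nnegrE ?(ltW zp) ?(ltW r0)//; lra.
rewrite ler_wpDl ?mulr_ge0//.
rewrite -[gamma]opprK !(powRN _ (- gamma)) lef_pV2 ?posrE ?powR_gt0//.
by rewrite ge0_ler_powR ?nnegrE ?(ltW r0) ?(ltW zp) ?(ltW rz)// oppr_ge0 ltW.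
Qed.

(** If [|v - w|] dominates [<w>], the two powers of [|v - w|] cancel and leave [2^(-gamma) <= 4].
    Otherwise the weight is at most [4 <w>^(-gamma) <= 4 <w>^2], as [<w> >= 1] and [-gamma <= 2]. *)
Lemma weighted_kernel_le (gamma r : R) v w : -2 <= gamma < 0 -> 0 < r <= 2^-1 ->
  bracket v `^ (- gamma) * enorm (v - w) `^ gamma <=
  4 + 4 * bracket w ^+ 2 * (r `^ (2 + gamma) * hardy_kernel (v - w) + r `^ gamma).
Proof.
move=> g r2; have := powR_enorm_le (v - w) g r2; move/andP: g => [g2 g0].
move=> zR.
have z0 := powR_ge0 (enorm (v - w)) gamma.
have b2 : 0 <= bracket w ^+ 2 by exact: sqr_ge0.
apply: le_trans (_ : 4 + 4 * bracket w ^+ 2 * enorm (v - w) `^ gamma <= _); last first.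
  by rewrite lerD2l ler_wpM2l// mulr_ge0.
have [z00|zn0] := eqVneq (enorm (v - w)) 0.
  by rewrite z00 powR0 ?lt_eqF// !mulr0 addr0.
have zp : 0 < enorm (v - w) by rewrite lt_neqAle eq_sym zn0 enorm_ge0.
have p0 : 0 <= - gamma by rewrite oppr_ge0 ltW.
have M0 : 0 <= Num.max (bracket w) (enorm (v - w)).
  by rewrite le_max ltW// bracket_gt0.
have four : (2 : R) `^ (- gamma) <= 4.
  rewrite (_ : 4 = 2 `^ 2); last by rewrite powR_mulrn//; ring.
  by rewrite ler_powR ?ler1n//; lra.
have hb : bracket v `^ (- gamma) <= 4 * Num.max (bracket w) (enorm (v - w)) `^ (- gamma).
  apply: le_trans (_ : (2 * Num.max (bracket w) (enorm (v - w))) `^ (- gamma) <= _).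
    by apply: ge0_ler_powR; rewrite ?nnegrE ?mulr_ge0 ?bracket_le_max ?(ltW (bracket_gt0 v)).
  by rewrite powRM// ler_wpM2r// powR_ge0.
apply: le_trans (ler_wpM2r z0 hb) _.
have [wz|zw] := leP (bracket w) (enorm (v - w)).
  have e1 : enorm (v - w) `^ (- gamma) * enorm (v - w) `^ gamma = 1.
    by rewrite -powRD ?zn0 ?implybT// addNr powRr0.
  rewrite -[X in X <= _]mulrA e1 mulr1.
  by rewrite lerDl mulr_ge0// mulr_ge0.
rewrite ler_wpDl// ler_wpM2r// ler_wpM2l//.
rewrite -powR_mulrn ?(ltW (bracket_gt0 w))//.
by rewrite ler_powR ?bracket_ge1//; lra.
Qed.

End kernel_bound.

(** * Reduction to the Hardy potential *)

Ltac nonneg := lazymatch goal with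
  | |- is_true (0 <= ?x) => lazymatch x with
    | _ * _ => apply: mulr_ge0; nonneg
    | _ + _ => apply: addr_ge0; nonneg
    | _ ^+ 2 => exact: sqr_ge0
    | _ `^ _ => exact: powR_ge0
    | hardy_kernel _ => exact: hardy_kernel_ge0
    | `|_| => exact: normr_ge0
    | _ => try done
    end
  end.

Lemma measurable_rV_subr (R : realType) n (v : 'rV[R]_n) :
  measurable_fun [set: 'rV[R]_n] (fun w => v - w).
Proof.
apply/measurable_fun_coordP => i.
under eq_fun do rewrite !mxE.
by apply: measurable_funB => //; exact: measurable_coord.
Qed.

Section convolution_estimate.
Context {R : realType} {n : nat}.
Local Notation leb := (@lebesgue_rV R n).
Variables (gamma : R) (f phi : 'rV[R]_n -> R).
Hypothesis n3 : (3 <= n)%N.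
Hypothesis g : -2 <= gamma < 0.
Hypothesis mf : measurable_fun setT f.
Hypothesis f0 : {ae leb, forall v, 0 <= f v}.
Hypothesis sphi : smooth phi.

Let psi := fun v : 'rV[R]_n => bracket v `^ (gamma / 2) * phi v.
(** The absolute value makes the density nonnegative everywhere, as Tonelli arguments need; [f]
    itself is so only almost everywhere. *)
Let h (w : 'rV[R]_n) : R := bracket w ^+ 2 * `|f w|.
Let c0 : R := (n%:R - 1) * (gamma + n%:R).

Definition weighted_mass : \bar R :=
  (\int[leb]_v (phi v ^+ 2 * bracket v `^ gamma)%:E)%E.

Definition weighted_dirichlet : \bar R :=
  (\int[leb]_v (enorm (grad (fun w => (bracket w `^ (gamma / 2) * phi w)%R) v) ^+ 2)%:E)%E.

Definition hardy_potential (w : 'rV[R]_n) : \bar R :=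
  (\int[leb]_v ((bracket v `^ (gamma / 2) * phi v) ^+ 2 * hardy_kernel (v - w))%:E)%E.

Let N := weighted_mass.
Let G := weighted_dirichlet.
Let H := hardy_potential.

Let g2 : -2 <= gamma. Proof. by case/andP: g. Qed.
Let g0 : gamma < 0. Proof. by case/andP: g. Qed.

Let c0_ge0 : 0 <= c0.
Proof.
have : 3%:R <= n%:R :> R by rewrite ler_nat.
by move=> n3'; rewrite /c0 mulr_ge0//; have := g2; lra.
Qed.

Let cphi : continuous phi. Proof. exact: smooth_continuous. Qed.
Let cpsi : continuous psi. Proof. exact: continuous_weighted. Qed.

Let psi_sqr v : psi v ^+ 2 = phi v ^+ 2 * bracket v `^ gamma.
Proof.
rewrite /psi exprMn mulrC; congr (_ * _).
rewrite -powR_mulrn ?powR_ge0// -powRrM; congr (_ `^ _); by field.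
Qed.

Let NE : N = (\int[leb]_v (psi v ^+ 2)%:E)%E.
Proof. by rewrite /N /weighted_mass; apply: eq_integral => v _; rewrite psi_sqr. Qed.

Let mpsi2 : measurable_fun setT (fun v => psi v ^+ 2).
Proof. by apply: measurable_funX; exact: continuous_measurable_rV. Qed.

Let h_ge0 w : 0 <= h w. Proof. by rewrite mulr_ge0// sqr_ge0. Qed.

Let mh : measurable_fun setT h.
Proof.
apply: measurable_funM; first by apply: measurable_funX; exact: measurable_bracket.
exact: measurableT_comp.
Qed.

Let m_kernel (k : 'rV[R]_n -> R) : measurable_fun setT k ->
  measurable_fun setT (fun p : 'rV[R]_n * 'rV[R]_n => k (p.1 - p.2)).
Proof. by move=> mk; apply: (measurableT_comp mk); exact: measurable_rV_sub. Qed.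

Let mz : measurable_fun setT (fun z : 'rV[R]_n => enorm z `^ gamma).
Proof. exact: (measurableT_comp (measurable_powR gamma) measurable_enorm). Qed.

Let m_fst (k : 'rV[R]_n -> R) : measurable_fun setT k ->
  measurable_fun setT (fun p : 'rV[R]_n * 'rV[R]_n => k p.1).
Proof. by move=> mk; apply: (measurableT_comp mk). Qed.

Let m_snd (k : 'rV[R]_n -> R) : measurable_fun setT k ->
  measurable_fun setT (fun p : 'rV[R]_n * 'rV[R]_n => k p.2).
Proof. by move=> mk; apply: (measurableT_comp mk). Qed.

Local Open Scope ereal_scope.

Let I (v : 'rV[R]_n) := \int[leb]_w (enorm (v - w) `^ gamma * `|f w|)%:E.

Let I_ge0 v : 0 <= I v.
Proof. by apply: integral_ge0 => w _; rewrite lee_fin mulr_ge0// powR_ge0. Qed.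

Let mzf (v : 'rV[R]_n) : measurable_fun setT (fun w : 'rV[R]_n => (enorm (v - w) `^ gamma * `|f w|)%R).
Proof.
apply: measurable_funM; last exact: measurableT_comp.
by apply: (measurableT_comp mz); exact: measurable_rV_subr.
Qed.

Let conv_cE v : conv_c gamma f v = - (c0%:E * I v).
Proof.
rewrite /conv_c -ge0_integralZl_EFin//; last 2 first.
- by move=> w _; rewrite lee_fin mulr_ge0// powR_ge0.
- exact/measurable_EFinP.
rewrite -integral_ge0N; last first.
  by move=> w _; rewrite -EFinM lee_fin mulr_ge0// mulr_ge0// powR_ge0.
have mzv : measurable_fun setT (fun w : 'rV[R]_n => enorm (v - w) `^ gamma)%R.
  by apply: (measurableT_comp mz); exact: measurable_rV_subr.
apply: ae_eq_integral => //.
- apply/measurable_EFinP; apply: measurable_funM => //.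
  exact: measurable_funM.
- by apply: measurableT_comp => //; apply/measurable_EFinP; apply: measurable_funM.
- apply: filterS f0 => w fw _; rewrite ger0_norm// -EFinM -EFinN /coef_c /c0.
  by congr EFin; ring.
Qed.

Let lhsE : - (\int[leb]_v ((phi v ^+ 2)%:E * conv_c gamma f v)) =
  c0%:E * \int[leb]_v ((phi v ^+ 2)%:E * I v).
Proof.
have mI : measurable_fun setT I.
  apply: (measurable_fun_fubini_tonelli_F
    (fun p : 'rV[R]_n * 'rV[R]_n => (enorm (p.1 - p.2) `^ gamma * `|f p.2|)%:E)) => /=; last first.
    by move=> p; rewrite lee_fin mulr_ge0// powR_ge0.
  apply/measurable_EFinP; apply: measurable_funM; first exact: (m_kernel mz).
  by apply: (@m_snd (fun w => `|f w|%R)); exact: measurableT_comp.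
have phi2 v : 0 <= (phi v ^+ 2)%:E by rewrite lee_fin sqr_ge0.
rewrite -ge0_integralZl_EFin//; last 2 first.
- by move=> v _; rewrite mule_ge0.
- apply: emeasurable_funM => //; apply/measurable_EFinP; apply: measurable_funX.
  exact: continuous_measurable_rV.
under [in LHS]eq_integral do rewrite conv_cE muleN muleCA.
by rewrite integral_ge0N ?oppeK// => v _; rewrite !mule_ge0.
Qed.

(** Tonelli puts the [w] integral outside, and [weighted_kernel_le] is integrated against
    [psi^2 |f|]. From here on only the Hardy potential weighted by [<w>^2 |f(w)|] remains to be
    estimated. *)
Lemma conv_c_le (r : R) : (0 < r <= 2^-1)%R ->
  - (\int[leb]_v ((phi v ^+ 2)%:E * conv_c gamma f v)) <=
  c0%:E * \int[leb]_w ((h w)%:E *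
    ((4 * (1 + r `^ gamma))%:E * N + (4 * r `^ (2 + gamma))%:E * H w)).
Proof.
move=> r2; rewrite lhsE lee_wpmul2l//.
have mK : measurable_fun setT (fun p : 'rV[R]_n * 'rV[R]_n =>
    (phi p.1 ^+ 2 * (enorm (p.1 - p.2) `^ gamma * `|f p.2|))%:E).
  apply/measurable_EFinP; apply: measurable_funM.
    by apply: (@m_fst (fun v => phi v ^+ 2)%R); apply: measurable_funX; exact: continuous_measurable_rV.
  apply: measurable_funM; first exact: (m_kernel mz).
  by apply: (@m_snd (fun w => `|f w|%R)); exact: measurableT_comp.
have K0 (p : 'rV[R]_n * 'rV[R]_n) : 0 <= (phi p.1 ^+ 2 * (enorm (p.1 - p.2) `^ gamma * `|f p.2|))%:E.
  by rewrite lee_fin; nonneg.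
have -> : \int[leb]_v ((phi v ^+ 2)%:E * I v) =
    \int[leb]_w \int[leb]_v (phi v ^+ 2 * (enorm (v - w) `^ gamma * `|f w|))%:E.
  rewrite -(fubini_tonelli (m1 := leb) (m2 := leb) _ mK K0).
  apply: eq_integral => v _; rewrite /I -ge0_integralZl_EFin ?sqr_ge0//.
  - by move=> w _; rewrite lee_fin mulr_ge0// powR_ge0.
  - exact/measurable_EFinP.
have mH : measurable_fun setT H.
  apply: (measurable_fun_fubini_tonelli_G
    (fun p : 'rV[R]_n * 'rV[R]_n => (psi p.1 ^+ 2 * hardy_kernel (p.1 - p.2))%:E)) => /=; last first.
    by move=> p; rewrite lee_fin; nonneg.
  apply/measurable_EFinP; apply: measurable_funM; first exact: (@m_fst (fun v => psi v ^+ 2)%R).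
  by apply: m_kernel; exact: measurable_hardy_kernel.
have H0 w : 0 <= H w.
  by apply: integral_ge0 => v _; rewrite lee_fin; nonneg.
have N0 : 0 <= N by rewrite NE; apply: integral_ge0 => v _; rewrite lee_fin sqr_ge0.
have a0 : (0 <= 4 * (1 + r `^ gamma))%R by rewrite mulr_ge0// addr_ge0// powR_ge0.
have b0 : (0 <= 4 * r `^ (2 + gamma))%R by rewrite mulr_ge0// powR_ge0.
apply: ge0_le_integral => //.
- by move=> w _; apply: integral_ge0 => v _; exact: (K0 (v, w)).
- exact: (measurable_fun_fubini_tonelli_G _ mK K0).
- apply: emeasurable_funM; first exact/measurable_EFinP.
  apply: emeasurable_funD; first exact: measurable_cst.
  by apply: emeasurable_funM => //; exact: measurable_cst.
move=> w _.
have mhk : measurable_fun setT (fun v => psi v ^+ 2 * hardy_kernel (v - w))%R.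
  apply: measurable_funM => //.
  apply: (measurableT_comp measurable_hardy_kernel); exact: measurable_rV_subl.
rewrite NE -!ge0_integralZl_EFin//; try (by [exact/measurable_EFinP]); try (by move=> v _; rewrite lee_fin; nonneg).
rewrite -ge0_integralD//; last 4 first.
- by move=> v _; rewrite -EFinM lee_fin; nonneg.
- by apply/measurable_EFinP; apply: measurable_funM => //; exact: measurable_cst.
- by move=> v _; rewrite -EFinM lee_fin; nonneg.
- by apply/measurable_EFinP; apply: measurable_funM => //; exact: measurable_cst.
rewrite -ge0_integralZl_EFin//; last 2 first.
- by move=> v _; rewrite -!EFinM -EFinD lee_fin; nonneg.
- apply/measurable_EFinP; apply: measurable_funD; apply: measurable_funM => //; exact: measurable_cst.
apply: ge0_le_integral => //.
- by move=> v _; exact: (K0 (v, w)).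
- apply/measurable_EFinP; apply: measurable_funM.
    by apply: measurable_funX; exact: continuous_measurable_rV.
  apply: measurable_funM; last exact: measurable_cst.
  by apply: (measurableT_comp mz); exact: measurable_rV_subl.
- apply/measurable_EFinP; apply: measurable_funM; first exact: measurable_cst.
  by apply: measurable_funD; apply: measurable_funM => //; exact: measurable_cst.
move=> v _.
suff : (phi v ^+ 2 * (enorm (v - w) `^ gamma * `|f w|) <= h w * (4 * (1 + r `^ gamma) * psi v ^+ 2 +
    4 * r `^ (2 + gamma) * (psi v ^+ 2 * hardy_kernel (v - w))))%R by rewrite -lee_fin.
have kle := weighted_kernel_le v w g r2.
have phiE : (phi v ^+ 2 = psi v ^+ 2 * bracket v `^ (- gamma))%R.
  rewrite psi_sqr -mulrA -powRD ?subrr ?powRr0 ?mulr1//.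
  by rewrite (gt_eqF (bracket_gt0 v)) implybT.
(* Lets the isolated constant 4 of [weighted_kernel_le] be absorbed into the factor [<w>^2]. *)
have b1 : (1 <= bracket w ^+ 2)%R by rewrite bracket_sqr lerDl sqr_ge0.
have fw : (0 <= psi v ^+ 2 * `|f w|)%R by nonneg.
have -> : (phi v ^+ 2 * (enorm (v - w) `^ gamma * `|f w|) =
    psi v ^+ 2 * `|f w| * (bracket v `^ (- gamma) * enorm (v - w) `^ gamma))%R.
  by rewrite phiE; ring.
apply: le_trans (ler_wpM2l fw kle) _.
have -> : (h w * (4 * (1 + r `^ gamma) * psi v ^+ 2 +
    4 * r `^ (2 + gamma) * (psi v ^+ 2 * hardy_kernel (v - w))) =
  psi v ^+ 2 * `|f w| * (bracket w ^+ 2 * (4 * (1 + r `^ gamma) +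
   4 * r `^ (2 + gamma) * hardy_kernel (v - w))))%R.
  by rewrite /h; ring.
rewrite ler_wpM2l//.
lra.
Qed.

(** The local Hardy inequality on the unit cube about [w], enlarged to the whole space: the right
    side no longer depends on [w]. *)
Lemma hardy_potential_le w : H w <= 8%:E * G + 16%:E * N.
Proof.
have Dpsi i v := is_derive_weighted (gamma / 2)%R sphi i v.
have cD := @continuous_partial_weighted R n phi (gamma / 2)%R sphi.
have mD : measurable_fun setT (fun v => \sum_i partial i psi v ^+ 2)%R.
  by apply: continuous_measurable_rV; cont; exact: cD.
have D0 v : (0 <= \sum_i partial i psi v ^+ 2)%R by apply: sumr_ge0 => i _; exact: sqr_ge0.
apply: le_trans (hardy_local w n3 Dpsi cpsi cD) _.
have -> : G = \int[leb]_v (\sum_i partial i psi v ^+ 2)%:E.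
  by apply: eq_integral => v _; rewrite enorm_grad.
have m8 : measurable_fun setT (fun v => (8 * \sum_i partial i psi v ^+ 2 + 16 * psi v ^+ 2)%:E).
  by apply/measurable_EFinP; apply: measurable_funD; apply: measurable_funM => //; exact: measurable_cst.
apply: le_trans (_ : \int[leb]_v (8 * \sum_i partial i psi v ^+ 2 + 16 * psi v ^+ 2)%:E <= _).
  apply: ge0_subset_integral => //; first exact: measurable_box.
  by move=> v _; rewrite lee_fin addr_ge0// mulr_ge0// sqr_ge0.
rewrite NE -!ge0_integralZl_EFin//; try exact/measurable_EFinP; try (by move=> v _; rewrite lee_fin; nonneg).
rewrite -ge0_integralD//.
- by move=> v _; rewrite -EFinM lee_fin mulr_ge0.
- by apply/measurable_EFinP; apply: measurable_funM => //; exact: measurable_cst.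
- by move=> v _; rewrite -EFinM lee_fin mulr_ge0// sqr_ge0.
- by apply/measurable_EFinP; apply: measurable_funM => //; exact: measurable_cst.
Qed.

End convolution_estimate.

Section assembly.
Context {R : realType} {n : nat}.
Local Notation leb := (@lebesgue_rV R n).
Variables (gamma : R) (f : 'rV[R]_n -> R).
Hypothesis n3 : (3 <= n)%N.
Hypothesis g : -2 <= gamma < 0.
Hypothesis mf : measurable_fun setT f.
Hypothesis f0 : {ae leb, forall v, 0 <= f v}.
Variable M : R.
Hypothesis fM : (\int[leb]_w (bracket w ^+ 2 * `|f w|)%:E = M%:E)%E.
Let c0 : R := (n%:R - 1) * (gamma + n%:R).

Local Open Scope ereal_scope.

Let mh : measurable_fun setT (fun w : 'rV[R]_n => (bracket w ^+ 2 * `|f w|)%R).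
Proof.
apply: measurable_funM; first by apply: measurable_funX; exact: measurable_bracket.
exact: measurableT_comp.
Qed.

Let M0 : (0 <= M)%R.
Proof.
by rewrite -lee_fin -fM; apply: integral_ge0 => w _; rewrite lee_fin; nonneg.
Qed.

Lemma measurable_hardy_potential (phi : 'rV[R]_n -> R) : smooth phi ->
  measurable_fun setT (hardy_potential gamma phi).
Proof.
move=> sphi.
apply: (measurable_fun_fubini_tonelli_G (fun p : 'rV[R]_n * 'rV[R]_n =>
  ((bracket p.1 `^ (gamma / 2) * phi p.1) ^+ 2 * hardy_kernel (p.1 - p.2))%:E)); last first.
  by move=> p /=; rewrite lee_fin; nonneg.
apply/measurable_EFinP; apply: measurable_funM.
  apply: measurable_funX.
  apply: (measurableT_comp (f := fun v : 'rV[R]_n => (bracket v `^ (gamma / 2) * phi v)%R)).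
    by apply: continuous_measurable_rV; exact: continuous_weighted.
  exact: measurable_fst.
apply: (measurableT_comp measurable_hardy_kernel); exact: measurable_rV_sub.
Qed.

Lemma hardy_potential_ge0 (phi : 'rV[R]_n -> R) w : 0 <= hardy_potential gamma phi w.
Proof. by apply: integral_ge0 => v _; rewrite lee_fin; nonneg. Qed.

(** Common end of both cases, which differ in how [a], [b] and [r] are obtained: for [gamma > -2]
    smallness comes from [r], for [gamma = -2] from [a]. *)
Lemma eps_poincare_of_hardy (phi : 'rV[R]_n -> R) (r a b eps C : R) :
  smooth phi -> (0 < r <= 2^-1)%R -> (0 <= a)%R -> (0 <= b)%R -> (0 < eps)%R -> (0 < C)%R ->
  \int[leb]_w ((bracket w ^+ 2 * `|f w|)%:E * hardy_potential gamma phi w) <=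
    a%:E * weighted_dirichlet gamma phi + b%:E * weighted_mass gamma phi ->
  (c0 * (4 * r `^ (2 + gamma) * a) <= eps)%R ->
  (c0 * (4 * (1 + r `^ gamma) * M + 4 * r `^ (2 + gamma) * b) <= C)%R ->
  eps_poincare gamma eps C f phi.
Proof.
move=> sphi r2 a0 b0 eps0 C0 Q he hC.
have [g2 g0] := andP g.
have c00 : (0 <= c0)%R.
  have n3' : (3%:R <= n%:R :> R)%R by rewrite ler_nat.
  by rewrite /c0 mulr_ge0//; lra.
rewrite /eps_poincare -/(weighted_dirichlet gamma phi) -/(weighted_mass gamma phi).
have G0 : 0 <= weighted_dirichlet gamma phi.
  by apply: integral_ge0 => v _; rewrite lee_fin; nonneg.
have N0 : 0 <= weighted_mass gamma phi.
  by apply: integral_ge0 => v _; rewrite lee_fin; nonneg.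
apply: le_trans (conv_c_le n3 g mf f0 sphi r2) _; rewrite -/c0.
set G := weighted_dirichlet gamma phi in Q G0 *.
set N := weighted_mass gamma phi in Q N0 *.
have := hardy_potential_ge0 phi; have := measurable_hardy_potential sphi.
set H := hardy_potential gamma phi in Q * => mH H0.
(* If the energy or the mass is infinite, so is the right side, because [eps] and [C] are strictly
   positive; otherwise the estimate is one between real numbers. *)
have [GE|Gfin] := eqVneq G +oo.
  by rewrite GE gt0_muley ?lte_fin// addye ?leey// gt_eqF// (lt_le_trans (ltNye 0))// mule_ge0// lee_fin ltW.
have [NE|Nfin] := eqVneq N +oo.
  have -> : C%:E * N = +oo by rewrite NE gt0_muley ?lte_fin.
  by rewrite addey ?leey// gt_eqF// (lt_le_trans (ltNye 0))// mule_ge0// lee_fin ltW.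
have {Gfin}GE : G = (fine G)%:E by rewrite fineK// ge0_fin_numE// ltey.
have {Nfin}NE : N = (fine N)%:E by rewrite fineK// ge0_fin_numE// ltey.
have gf0 : (0 <= fine G)%R by rewrite fine_ge0.
have nf0 : (0 <= fine N)%R by rewrite fine_ge0.
have A0 : (0 <= 4 * (1 + r `^ gamma))%R by nonneg.
have B0 : (0 <= 4 * r `^ (2 + gamma))%R by nonneg.
move: Q; rewrite GE NE; move: (fine G) (fine N) gf0 nf0 => x y x0 y0 Q.
have -> : \int[leb]_w ((bracket w ^+ 2 * `|f w|)%:E *
     ((4 * (1 + r `^ gamma))%:E * y%:E + (4 * r `^ (2 + gamma))%:E * H w)) =
   (4 * (1 + r `^ gamma) * y)%:E * \int[leb]_w (bracket w ^+ 2 * `|f w|)%:E +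
   (4 * r `^ (2 + gamma))%:E * \int[leb]_w ((bracket w ^+ 2 * `|f w|)%:E * H w).
  rewrite -!ge0_integralZl_EFin//; last 5 first.
  - by move=> w _; rewrite mule_ge0// lee_fin; nonneg.
  - by apply: emeasurable_funM => //; exact/measurable_EFinP.
  - by move=> w _; rewrite lee_fin; nonneg.
  - exact/measurable_EFinP.
  - by rewrite mulr_ge0.
  rewrite -ge0_integralD//; last 4 first.
  - by move=> w _; rewrite -EFinM lee_fin; nonneg.
  - by apply/measurable_EFinP; apply: measurable_funM => //; exact: measurable_cst.
  - by move=> w _; rewrite mule_ge0 ?lee_fin// mule_ge0// lee_fin; nonneg.
  - apply: emeasurable_funM; first exact: measurable_cst.
    by apply: emeasurable_funM => //; exact/measurable_EFinP.
  apply: eq_integral => w _; rewrite ge0_muleDr//; last by rewrite mule_ge0 ?lee_fin.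
    by rewrite -!EFinM muleCA; congr (_ + _); congr EFin; ring.
  by rewrite -EFinM lee_fin mulr_ge0.
rewrite fM.
apply: (@le_trans _ _ (c0%:E * ((4 * (1 + r `^ gamma) * y)%:E * M%:E +
   (4 * r `^ (2 + gamma))%:E * (a%:E * x%:E + b%:E * y%:E)))).
  by rewrite lee_wpmul2l ?lee_fin// leeD2l// lee_wpmul2l ?lee_fin.
suff : (c0 * ((4 * (1 + r `^ gamma) * y) * M + (4 * r `^ (2 + gamma)) * (a * x + b * y)) <=
    eps * x + C * y)%R by rewrite -lee_fin.
have h1 := ler_wpM2r x0 he; have h2 := ler_wpM2r y0 hC.
apply: le_trans (lerD h1 h2).
rewrite le_eqVlt; apply/orP; left; apply/eqP; ring.
Qed.

Lemma hardy_potential_total (phi : 'rV[R]_n -> R) : smooth phi ->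
  \int[leb]_w ((bracket w ^+ 2 * `|f w|)%:E * hardy_potential gamma phi w) <=
    (8 * M)%:E * weighted_dirichlet gamma phi + (16 * M)%:E * weighted_mass gamma phi.
Proof.
move=> sphi.
have G0 : 0 <= weighted_dirichlet gamma phi.
  by apply: integral_ge0 => v _; rewrite lee_fin; nonneg.
have N0 : 0 <= weighted_mass gamma phi.
  by apply: integral_ge0 => v _; rewrite lee_fin; nonneg.
apply: (@le_trans _ _ (\int[leb]_w ((bracket w ^+ 2 * `|f w|)%:E *
    (8%:E * weighted_dirichlet gamma phi + 16%:E * weighted_mass gamma phi)))).
  apply: ge0_le_integral => //.
  - by move=> w _; rewrite mule_ge0 ?hardy_potential_ge0// lee_fin; nonneg.
  - by apply: emeasurable_funM; [exact/measurable_EFinP|exact: measurable_hardy_potential].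
  - by apply: emeasurable_funM; [exact/measurable_EFinP|exact: measurable_cst].
  - move=> w _; apply: lee_wpmul2l; first by rewrite lee_fin; nonneg.
    exact: hardy_potential_le.
rewrite ge0_integralZr//; last 3 first.
- exact/measurable_EFinP.
- by move=> w _; rewrite lee_fin; nonneg.
- by rewrite adde_ge0// mule_ge0// lee_fin.
rewrite fM ge0_muleDr; last 2 first.
- by rewrite mule_ge0// lee_fin.
- by rewrite mule_ge0// lee_fin.
by rewrite !muleA -!EFinM ![(M * _)%R]mulrC.
Qed.

End assembly.

Section moments.
Context {R : realType} {n : nat}.
Local Notation leb := (@lebesgue_rV R n).
Variable f : 'rV[R]_n -> R.
Hypothesis Lf : Lps 1 2 f.

Lemma Lps12_integrable : leb.-integrable setT (fun w => (bracket w ^+ 2 * `|f w|)%:E).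
Proof.
have [mf] := Lf; rewrite /Lps_norm invr1 => foo.
have E : (\int[leb]_v (`|f v| `^ 1 * bracket v `^ 2)%:E =
          \int[leb]_v (bracket v ^+ 2 * `|f v|)%:E)%E.
  apply: eq_integral => v _; congr EFin.
  by rewrite powRr1// powR_mulrn ?(ltW (bracket_gt0 v))// mulrC.
have I0 : (0 <= \int[leb]_v (bracket v ^+ 2 * `|f v|)%:E)%E.
  by apply: integral_ge0 => v _; rewrite lee_fin; nonneg.
apply/integrableP; split.
  apply/measurable_EFinP; apply: measurable_funM; last exact: measurableT_comp.
  by apply: measurable_funX; exact: measurable_bracket.
move: foo; rewrite E poweRe1// => /le_lt_trans; apply.
rewrite le_eqVlt; apply/orP; left; apply/eqP; apply: eq_integral => v _.
by rewrite gee0_abs// lee_fin; nonneg.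
Qed.

Lemma Lps12_dominated (k : 'rV[R]_n -> R) : measurable_fun setT k ->
  (forall v, `|k v| <= bracket v ^+ 2) ->
  leb.-integrable setT (fun w => (f w * k w)%:E).
Proof.
move=> mk kb; have [mf _] := Lf.
apply: le_integrable Lps12_integrable => //.
  by apply/measurable_EFinP; exact: measurable_funM.
move=> v _; rewrite !abse_EFin lee_fin normrM [leRHS]ger0_norm; last by nonneg.
by rewrite mulrC ler_wpM2r.
Qed.

(** A real-valued integral turns an infinite value into 0; membership in [L^1_2] is what allows the
    conserved quantities to be read as a genuine finite moment. *)
Lemma bracket_sqr_moment (m e : R) : {ae leb, forall v, 0 <= f v} ->
  \int[leb]_v f v = m -> \int[leb]_v (f v * enorm v ^+ 2) = e ->
  (\int[leb]_w (bracket w ^+ 2 * `|f w|)%:E = (m + e)%:E)%E.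
Proof.
move=> f0 fm fe; have [mf _] := Lf.
have i1 : leb.-integrable setT (fun w => (f w * 1)%:E).
  apply: Lps12_dominated; first exact: measurable_cst.
  by move=> v; rewrite normr1 bracket_sqr lerDl sqr_ge0.
have i2 : leb.-integrable setT (fun w => (f w * enorm w ^+ 2)%:E).
  apply: Lps12_dominated; first by apply: measurable_funX; exact: measurable_enorm.
  by move=> v; rewrite ger0_norm ?sqr_ge0// bracket_sqr lerDr.
transitivity (\int[leb]_w ((f w * 1)%:E + (f w * enorm w ^+ 2)%:E))%E.
  apply: ae_eq_integral => //.
  - exact: measurable_int Lps12_integrable.
  - by apply: emeasurable_funD; [exact: measurable_int i1|exact: measurable_int i2].
  - apply: filterS f0 => v fv _; rewrite ger0_norm// bracket_sqr -EFinD.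
    by congr EFin; ring.
rewrite integralD// EFinD; congr (_ + _)%E.
  have -> : (\int[leb]_x (f x * 1)%:E = \int[leb]_x (f x)%:E)%E.
    by apply: eq_integral => v _; rewrite mulr1.
  rewrite -fm /Rintegral fineK//; apply: integrable_fin_num => //.
  by apply: eq_integrable i1 => // v _; rewrite mulr1.
by rewrite -fe /Rintegral fineK//; exact: integrable_fin_num.
Qed.

End moments.

(** * The case gamma > -2 *)

Section solution_moments.
Context {R : realType} {n : nat}.
Local Notation leb := (@lebesgue_rV R n).
Variables (gamma : R) (fin : 'rV[R]_n -> R) (f : R -> 'rV[R]_n -> R).
Hypothesis nd : normalized_datum fin.
Hypothesis ws : weak_solution gamma fin f.

Lemma weak_solution_moment t : 0 <= t ->
  (\int[leb]_w (bracket w ^+ 2 * `|f t w|)%:E = (1 + n%:R)%:E)%E.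
Proof.
move=> t0; apply: bracket_sqr_moment.
- by have [] := ws_space ws t0.
- exact: (ws_ge0 ws t0).
- by rewrite (ws_mass ws t0) (nd_mass nd).
- by rewrite (ws_energy ws t0) (nd_energy nd).
Qed.

End solution_moments.

Section subcritical.
Context {R : realType} {n : nat}.
Variable gamma : R.
Hypothesis n3 : (3 <= n)%N.
Hypothesis g : -2 < gamma < 0.

Let g' : -2 <= gamma < 0. Proof. by move/andP: g => [/ltW -> ->]. Qed.

(** [K] is fixed before the datum, the solution and the time: normalization makes the second moment
    equal to [1 + n] for all of them. *)
Lemma eps_poincare_subcritical : exists2 K : R, 0 < K &
  forall (fin : 'rV[R]_n -> R) (f : R -> 'rV[R]_n -> R) (eps : R), 0 < eps ->
  normalized_datum fin -> weak_solution gamma fin f ->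
  forall (phi : 'rV[R]_n -> R) (t : R), smooth phi -> 0 <= t ->
  eps_poincare gamma eps (K * (1 + eps `^ (gamma / (2 + gamma)))) (f t) phi.
Proof.
have [g2 g0] := andP g.
have g20 : 0 < 2 + gamma by lra.
have n3R : 3%:R <= n%:R :> R by rewrite ler_nat.
pose M : R := 1 + n%:R.
pose c0 : R := (n%:R - 1) * (gamma + n%:R).
have M0 : 0 < M by rewrite /M; lra.
have c00 : 0 < c0 by rewrite /c0 mulr_gt0//; lra.
(* Collects the constants in front of [r^(2 + gamma)]: with [a = 8 M] the Dirichlet coefficient is
   [c0 * 4 * 8 M * r^(2 + gamma)]. *)
pose kap : R := 32 * c0 * M.
have kap0 : 0 < kap by rewrite /kap mulr_gt0// mulr_gt0.
pose p := gamma / (2 + gamma).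
(* The mass coefficient is [c0 M (4 + 4 r^gamma + 64 r^(2 + gamma))]; inserting [r^(2 + gamma) <= 1]
   and [r^gamma <= 4 + eps^p kap^(-p)] gives [84 = 4 + 16 + 64]. *)
pose K := c0 * M * (84 + 4 * kap^-1 `^ p).
have cM0 : 0 < c0 * M by rewrite mulr_gt0.
have kp0 := powR_ge0 kap^-1 p.
exists K; first by rewrite /K mulr_gt0//; lra.
move=> fin f eps eps0 nd ws phi t sphi t0.
have [mf _] := (ws_space ws t0).1.
(* The radius at which the Dirichlet coefficient equals [eps] exactly; it is then capped at 1/2 for
   [powR_enorm_le]. *)
pose r0 := (eps / kap) `^ (2 + gamma)^-1.
have ek0 : 0 < eps / kap by rewrite divr_gt0.
have r00 : 0 < r0 by exact: powR_gt0.
have r0E : r0 `^ (2 + gamma) = eps / kap.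
  by rewrite -powRrM mulVf ?gt_eqF// powRr1// ltW.
have r0g : r0 `^ gamma = eps `^ p * kap^-1 `^ p.
  by rewrite -powRrM [_^-1 * gamma]mulrC -/p powRM ?invr_ge0 ?(ltW eps0) ?(ltW kap0).
pose r := Num.min (2^-1) r0.
have rpos : 0 < r by rewrite lt_min r00 andbT invr_gt0.
have r2 : 0 < r <= 2^-1 by rewrite rpos ge_min lexx.
have rr0 : r `^ (2 + gamma) <= eps / kap.
  by rewrite -r0E ge0_ler_powR ?nnegrE ?(ltW rpos) ?(ltW r00) ?(ltW g20)// ge_min lexx orbT.
have r1 : r `^ (2 + gamma) <= 1.
  have r_1 : r <= 1 by apply: le_trans (andP r2).2 _; rewrite invf_le1// ler1n.
  rewrite [leRHS](_ : 1 = 1 `^ (2 + gamma)); last by rewrite powR1.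
  by rewrite ge0_ler_powR ?nnegrE ?(ltW rpos) ?(ltW g20).
have ep0 := powR_ge0 eps p.
have rg : r `^ gamma <= 4 + eps `^ p * kap^-1 `^ p.
  rewrite -r0g /r; case: (leP (2^-1) r0) => h; last by rewrite lerDr.
  rewrite ler_wpDr ?powR_ge0// -powR_inv1// -powRrM mulN1r.
  rewrite (_ : 4 = 2 `^ 2); last by rewrite powR_mulrn//; ring.
  by rewrite ler_powR ?ler1n//; lra.
apply: (@eps_poincare_of_hardy _ _ _ _ n3 g' mf (ws_ge0 ws t0) M
  (weak_solution_moment nd ws t0) phi r (8 * M) (16 * M)) => //.
- by rewrite mulr_ge0// ltW.
- by rewrite mulr_ge0// ltW.
- rewrite mulr_gt0//; first by rewrite /K mulr_gt0//; lra.
  by rewrite -/p; lra.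
- apply: hardy_potential_total => //; exact: (weak_solution_moment nd ws t0).
- rewrite -/c0 (_ : c0 * _ = r `^ (2 + gamma) * kap); last by rewrite /kap; ring.
  by rewrite -ler_pdivlMr.
- rewrite -/c0 -/p (_ : c0 * _ = c0 * M * (4 + 4 * r `^ gamma + 64 * r `^ (2 + gamma))); last by ring.
  rewrite /K -[leRHS]mulrA ler_wpM2l ?(ltW cM0)//.
  nra.
Qed.

End subcritical.

(** * Splitting off a bounded density *)

Section critical_split.
Context {R : realType} {n : nat}.
Local Notation leb := (@lebesgue_rV R n).
Hypothesis n3 : (3 <= n)%N.
Local Open Scope ereal_scope.

(** The local Hardy inequality applied to the constant 1: the gradient drops out and 16 times the
    volume [2^n] of the cube is left, with no polar coordinates. *)
Lemma integral_hardy_kernel (v : 'rV[R]_n) :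
  \int[leb]_w (hardy_kernel (v - w))%:E <= (16 * 2 ^+ n)%:E.
Proof.
have D1 i (u : 'rV[R]_n) : is_derive u (delta_mx ord0 i) (fun=> 1%R : R) (0%R : R).
  exact: is_derive_cst.
have := hardy_local v n3 D1 (@continuous_cst _ _ 1%R) (fun=> @continuous_cst _ _ 0%R).
rewrite (_ : \int[leb]_w _ = \int[leb]_w (hardy_kernel (v - w))%:E); last first.
  (* The kernel is even, so the roles of [v] and [w] can be exchanged. *)
  by apply: eq_integral => w _; rewrite expr1n mul1r -hardy_kernelN opprB.
move=> /le_trans; apply.
have -> : (8 * (\sum_(i < n) 0 ^+ 2) + 16 * 1 ^+ 2 = 16 :> R)%R.
  by rewrite big1 => [|i _]; rewrite ?expr0n// mulr0 add0r expr1n mulr1.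
rewrite integral_cst; last exact: measurable_box.
by rewrite EFinM lee_wpmul2l ?lee_fin// -[in leRHS](mulr1 2%R) -(lebesgue_box v ler01).
Qed.

Variables (gamma : R) (f phi : 'rV[R]_n -> R) (E : set 'rV[R]_n) (eta L : R).
Hypothesis mf : measurable_fun setT f.
Hypothesis sphi : smooth phi.
Hypothesis mE : measurable E.
Let h (w : 'rV[R]_n) : R := (bracket w ^+ 2 * `|f w|)%R.
Hypothesis hE : \int[leb]_(w in E) (h w)%:E <= eta%:E.
Hypothesis hL : forall w, ~ E w -> (h w <= L)%R.
Hypothesis L0 : (0 <= L)%R.

Let mh : measurable_fun setT h.
Proof.
apply: measurable_funM; first by apply: measurable_funX; exact: measurable_bracket.
exact: measurableT_comp.
Qed.

Let h0 w : (0 <= h w)%R. Proof. by rewrite /h; nonneg. Qed.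

(** On [E] the uniform Hardy bound is integrated against a mass of at most [eta]. Off [E] the
    density is at most [L], and by Tonelli the total Hardy potential is controlled by the mass of
    [psi] alone. Hence the Dirichlet energy carries only the factor [eta]. *)
Lemma hardy_potential_split :
  \int[leb]_w ((h w)%:E * hardy_potential gamma phi w) <=
  (8 * eta)%:E * weighted_dirichlet gamma phi +
  (16 * eta + 16 * 2 ^+ n * L)%:E * weighted_mass gamma phi.
Proof.
set G := weighted_dirichlet gamma phi; set N := weighted_mass gamma phi.
have G0 : 0 <= G by apply: integral_ge0 => v _; rewrite lee_fin; nonneg.
have N0 : 0 <= N by apply: integral_ge0 => v _; rewrite lee_fin; nonneg.
have mH := measurable_hardy_potential gamma sphi.
have H0 := hardy_potential_ge0 gamma phi.
have Hle := hardy_potential_le gamma n3 sphi.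
set H := hardy_potential gamma phi in mH H0 Hle *.
have eta0 : (0 <= eta)%R.
  by rewrite -lee_fin; apply: le_trans hE; apply: integral_ge0 => w _; rewrite lee_fin.
have totH : \int[leb]_w H w <= (16 * 2 ^+ n)%:E * N.
  have mpsi : measurable_fun setT (fun v : 'rV[R]_n => ((bracket v `^ (gamma / 2) * phi v) ^+ 2)%R).
    apply: measurable_funX; apply: continuous_measurable_rV; exact: continuous_weighted.
  have mK : measurable_fun setT (fun p : 'rV[R]_n * 'rV[R]_n =>
      ((bracket p.1 `^ (gamma / 2) * phi p.1) ^+ 2 * hardy_kernel (p.1 - p.2))%:E).
    apply/measurable_EFinP; apply: measurable_funM.
      by apply: (measurableT_comp mpsi); exact: measurable_fst.
    by apply: (measurableT_comp measurable_hardy_kernel); exact: measurable_rV_sub.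
  have K0 (p : 'rV[R]_n * 'rV[R]_n) :
      0 <= ((bracket p.1 `^ (gamma / 2) * phi p.1) ^+ 2 * hardy_kernel (p.1 - p.2))%:E.
    by rewrite lee_fin; nonneg.
  rewrite -[leLHS](fubini_tonelli (m1 := leb) (m2 := leb) _ mK K0).
  have -> : N = \int[leb]_v ((bracket v `^ (gamma / 2) * phi v) ^+ 2)%:E.
    apply: eq_integral => v _; congr EFin; rewrite exprMn mulrC; congr (_ * _)%R.
    rewrite -powR_mulrn ?powR_ge0// -powRrM; congr (_ `^ _)%R; by field.
  rewrite -ge0_integralZl_EFin//; last 2 first.
  - by move=> v _; rewrite lee_fin; nonneg.
  - exact/measurable_EFinP.
  apply: ge0_le_integral.
  - exact: measurableT.
  - by move=> v _; apply: integral_ge0 => w _; exact: (K0 (v, w)).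
  - exact: (measurable_fun_fubini_tonelli_F _ mK K0).
  - by apply/measurable_EFinP; apply: measurable_funM => //; exact: measurable_cst.
  move=> v _ /=; have mhk : measurable_fun setT (fun w : 'rV[R]_n => hardy_kernel (v - w)).
    by apply: (measurableT_comp measurable_hardy_kernel); exact: measurable_rV_subr.
  under eq_integral do rewrite EFinM.
  rewrite ge0_integralZl_EFin//; last 3 first.
  - by move=> w _; rewrite lee_fin; nonneg.
  - exact/measurable_EFinP.
  - by nonneg.
  rewrite muleC lee_wpmul2r ?integral_hardy_kernel// lee_fin; nonneg.
have -> : \int[leb]_w ((h w)%:E * H w) =
    \int[leb]_(w in E) ((h w)%:E * H w) + \int[leb]_(w in ~` E) ((h w)%:E * H w).
  rewrite -ge0_integral_setU ?setUv//; first exact: measurableC.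
  - by apply: emeasurable_funM => //; exact/measurable_EFinP.
  - by move=> w _; rewrite mule_ge0 ?lee_fin.
  - exact/disj_setPCl.
have S0 : 0 <= 8%:E * G + 16%:E * N by rewrite adde_ge0// mule_ge0// lee_fin.
have p1 : \int[leb]_(w in E) ((h w)%:E * H w) <= eta%:E * (8%:E * G + 16%:E * N).
  apply: (@le_trans _ _ (\int[leb]_(w in E) ((h w)%:E * (8%:E * G + 16%:E * N)))).
    apply: ge0_le_integral => //.
    - by move=> w _; rewrite mule_ge0 ?lee_fin.
    - by apply: measurable_funTS; apply: emeasurable_funM => //; exact/measurable_EFinP.
    - apply: measurable_funTS; apply: emeasurable_funM; first exact/measurable_EFinP.
      exact: measurable_cst.
    - by move=> w _; rewrite lee_wpmul2l ?lee_fin.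
  rewrite ge0_integralZr//; last 2 first.
  - by apply: measurable_funTS; exact/measurable_EFinP.
  - by move=> w _; rewrite lee_fin.
  by rewrite lee_wpmul2r.
have p2 : \int[leb]_(w in ~` E) ((h w)%:E * H w) <= L%:E * ((16 * 2 ^+ n)%:E * N).
  apply: (@le_trans _ _ (\int[leb]_w (L%:E * H w))); last first.
    by rewrite ge0_integralZl_EFin// lee_wpmul2l ?lee_fin.
  apply: (@le_trans _ _ (\int[leb]_(w in ~` E) (L%:E * H w))).
    apply: ge0_le_integral => //.
    - exact: measurableC.
    - by move=> w _; rewrite mule_ge0 ?lee_fin.
    - by apply: measurable_funTS; apply: emeasurable_funM => //; exact/measurable_EFinP.
    - by apply: measurable_funTS; apply: emeasurable_funM => //; exact: measurable_cst.
    - by move=> w nE; rewrite lee_wpmul2r ?lee_fin// hL.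
  apply: ge0_subset_integral => //; first exact: measurableC.
  - by apply: emeasurable_funM => //; exact: measurable_cst.
  - by move=> w _; rewrite mule_ge0 ?lee_fin.
apply: le_trans (leeD p1 p2) _.
rewrite ge0_muleDr ?mule_ge0 ?lee_fin// !muleA -!EFinM -addeA -ge0_muleDl ?lee_fin; last 2 first.
- by rewrite mulr_ge0.
- by rewrite mulr_ge0// mulr_ge0// exprn_ge0.
by rewrite ![(eta * _)%R]mulrC [(L * _)%R]mulrC.
Qed.

End critical_split.

(** * Uniform integrability from the entropy *)

Lemma enorm_rV_cons (R : realType) n (x : R) (v : 'rV[R]_n) :
  enorm (rV_cons (x, v)) ^+ 2 = x ^+ 2 + enorm v ^+ 2.
Proof.
rewrite !enorm_sqr big_ord_recl mxE unlift_none; congr (_ + _).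
by apply: eq_bigr => i _; rewrite mxE liftK.
Qed.

Section gaussian.
Context {R : realType}.
Local Notation leb n := (@lebesgue_rV R n).
Local Notation mu := (@lebesgue_measure R).
Local Open Scope ereal_scope.

Lemma measurable_gaussian n : measurable_fun setT (fun v : 'rV[R]_n => expR (- enorm v ^+ 2)).
Proof.
apply: (measurableT_comp (@measurable_expR R)); apply: measurable_funN.
by apply: measurable_funX; exact: measurable_enorm.
Qed.

(** The Gaussian factorizes over coordinates; the induction starts in dimension 0, where the measure
    is a Dirac mass. *)
Lemma integrable_gaussian n : (leb n).-integrable setT (fun v => (expR (- enorm v ^+ 2))%:E).
Proof.
have mG k : measurable_fun setT (fun v : 'rV[R]_k => (expR (- enorm v ^+ 2))%:E).
  by apply/measurable_EFinP; exact: measurable_gaussian.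
apply/integrableP; split; first exact: mG.
rewrite (_ : \int[_]_v _ = \int[leb n]_v (expR (- enorm v ^+ 2))%:E); last first.
  by apply: eq_integral => v _; rewrite gee0_abs// lee_fin expR_ge0.
elim: n => [|n IH].
  rewrite integral_dirac//; last exact: mG.
  by rewrite diracT mul1e ltry.
rewrite ge0_integral_rV_cons//.
have E (p : R * 'rV[R]_n) : (expR (- enorm (rV_cons p) ^+ 2) =
    gauss_fun p.1 * expR (- enorm p.2 ^+ 2))%R.
  by case: p => x v; rewrite enorm_rV_cons opprD expRD.
have mE : measurable_fun [set: measurableTypeR R * 'rV[R]_n]
    (fun p => (gauss_fun p.1 * expR (- enorm p.2 ^+ 2))%:E).
  apply/measurable_EFinP; apply: measurable_funM.
    exact: (measurableT_comp (@measurable_gauss_fun R)).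
  apply: (measurableT_comp (f := fun v : 'rV[R]_n => expR (- enorm v ^+ 2))).
    exact: measurable_gaussian.
  exact: measurable_snd.
have E0 (p : measurableTypeR R * 'rV[R]_n) : 0 <= (gauss_fun p.1 * expR (- enorm p.2 ^+ 2))%:E.
  by rewrite lee_fin mulr_ge0 ?expR_ge0.
have -> : \int[mu \x leb n]_p (expR (- enorm (rV_cons p) ^+ 2))%:E =
    \int[mu]_x ((gauss_fun x)%:E * \int[leb n]_v (expR (- enorm v ^+ 2))%:E).
  under eq_integral do rewrite E.
  rewrite (fubini_tonelli1 (m1 := mu) (m2 := leb n) _ mE E0).
  apply: eq_integral => x _; rewrite /fubini_F/=.
  under eq_integral do rewrite EFinM.
  rewrite ge0_integralZl_EFin ?expR_ge0//.
  exact: mG.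
rewrite ge0_integralZr//; last 3 first.
- by apply/measurable_EFinP; exact: measurable_gauss_fun.
- by move=> x _; rewrite lee_fin expR_ge0.
- by apply: integral_ge0 => v _; rewrite lee_fin expR_ge0.
rewrite integralT_gauss.
by rewrite lte_mul_pinfty ?lee_fin ?sqrtr_ge0.
Qed.

End gaussian.

Section entropy.
Context {R : realType} {n : nat}.
Local Notation leb := (@lebesgue_rV R n).

(** Convex duality: [exp(-a) = x exp(-(ln x + a)) >= x (1 - ln x - a)], so the sum is at least [x].
    The case [x = 0] rests on the convention for [ln 0]. *)
Lemma entropy_young (x a : R) : 0 <= x -> 0 <= x * ln x + x * a + expR (- a).
Proof.
rewrite le_eqVlt => /predU1P[<-|x0]; first by rewrite !mul0r !add0r expR_ge0.
have -> : expR (- a) = x * expR (- (ln x + a)).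
  rewrite opprD expRD mulrA (_ : x * expR (- ln x) = 1) ?mul1r//.
  by rewrite expRN lnK ?posrE// divff// gt_eqF.
rewrite -!mulrDr mulr_ge0 ?ltW//.
have := expR_ge1Dx (- (ln x + a)); lra.
Qed.

Variable f : 'rV[R]_n -> R.
Hypothesis Lf : (Lps 1 2 `&` LlogL) f.
Hypothesis f0 : {ae leb, forall v, 0 <= f v}.

Let mf : measurable_fun setT f. Proof. by have [[]] := Lf. Qed.

Lemma integrable_entropy : leb.-integrable setT (fun v => (f v * ln (f v))%:E).
Proof.
have mfl : measurable_fun setT (fun v => f v * ln (f v)).
  by apply: measurable_funM => //; exact: (measurableT_comp (@measurable_ln R)).
apply/integrableP; split; first exact/measurable_EFinP.
have [_ [_]] := Lf; apply: le_lt_trans.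
rewrite /LlogL_int le_eqVlt; apply/orP; left; apply/eqP.
apply: ae_eq_integral => //.
- by apply: measurableT_comp => //; exact/measurable_EFinP.
- apply/measurable_EFinP; apply: measurable_funM; first exact: measurableT_comp.
  apply: measurableT_comp => //; apply: (measurableT_comp (@measurable_ln R)).
  exact: measurableT_comp.
- by apply: filterS f0 => v fv _; rewrite abse_EFin normrM (ger0_norm fv).
Qed.

Definition gaussian_mass : R := fine (\int[leb]_v (expR (- enorm v ^+ 2))%:E).

(** By [entropy_young] with [a = |v|^2], the density [f ln f + f |v|^2 + exp(-|v|^2)] is nonnegative
    everywhere. Where [f > K] it is at least [f ln K], so Chebyshev's argument applies although
    [f ln f] changes sign. *)
Lemma entropy_tail (K : R) : 1 < K ->
  (\int[leb]_(v in [set v | (K < `|f v|)%R]) (`|f v|%R)%:E <=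
  ((\int[leb]_v (f v * ln (f v)) + \int[leb]_v (f v * enorm v ^+ 2) + gaussian_mass) / ln K)%R%:E)%E.
Proof.
move=> K1; have lnK : 0 < ln K by rewrite ln_gt0.
have i1 := integrable_entropy.
have i2 : leb.-integrable setT (fun w => (f w * enorm w ^+ 2)%:E).
  apply: Lps12_dominated; first by have [] := Lf.
    by apply: measurable_funX; exact: measurable_enorm.
  by move=> v; rewrite ger0_norm ?sqr_ge0// bracket_sqr lerDr.
have i3 := @integrable_gaussian R n.
have -> : (((\int[leb]_v (f v * ln (f v)) + \int[leb]_v (f v * enorm v ^+ 2) + gaussian_mass) / ln K)%R%:E =
  \int[leb]_v ((ln K)^-1%:E * ((f v * ln (f v))%:E + (f v * enorm v ^+ 2)%:E + (expR (- enorm v ^+ 2))%:E)))%E.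
  rewrite integralZl//; last by apply: integrableD => //; exact: integrableD.
  rewrite integralD//; last exact: integrableD.
  rewrite integralD// mulrC EFinM !EFinD /gaussian_mass /Rintegral !fineK//; exact: integrable_fin_num.
have mS : measurable [set v : 'rV[R]_n | K < `|f v|].
  have : measurable_fun setT (fun v => `|f v|) by exact: measurableT_comp.
  move=> /(_ measurableT `]K, +oo[%classic (measurable_itv _)).
  rewrite setTI; congr measurable; apply/seteqP.
  by split => v /=; rewrite in_itv/= andbT.
have mf' : measurable_fun setT (fun v => `|f v|) by exact: measurableT_comp.
have mg : measurable_fun setT (fun v => `|f v| * ln `|f v| + `|f v| * enorm v ^+ 2 + expR (- enorm v ^+ 2)).
  apply: measurable_funD; last exact: measurable_gaussian.
  apply: measurable_funD; apply: measurable_funM => //.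
    exact: (measurableT_comp (@measurable_ln R)).
  by apply: measurable_funX; exact: measurable_enorm.
(* Replaces [f] by its absolute value, so that the nonnegativity holds at every point. *)
rewrite [leRHS](_ : _ = \int[leb]_v ((ln K)^-1 *
    (`|f v| * ln `|f v| + `|f v| * enorm v ^+ 2 + expR (- enorm v ^+ 2)))%:E)%E; last first.
  apply: ae_eq_integral => //.
  - apply: emeasurable_funM; first exact: measurable_cst.
    apply: emeasurable_funD; last exact: measurable_int i3.
    by apply: emeasurable_funD; [exact: measurable_int i1|exact: measurable_int i2].
  - by apply/measurable_EFinP; apply: measurable_funM => //; exact: measurable_cst.
  - by apply: filterS f0 => v fv _; rewrite ger0_norm.
have h v := entropy_young (enorm v ^+ 2) (normr_ge0 (f v)).
have iK : 0 <= (ln K)^-1 by rewrite invr_ge0 ltW.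
rewrite integral_mkcond; apply: ge0_le_integral => //.
- by move=> v _; rewrite patchE; case: ifP => // _; rewrite lee_fin.
- by apply/(measurable_restrictT _ mS); apply: measurable_funTS; apply/measurable_EFinP.
- by apply/measurable_EFinP; apply: measurable_funM => //; exact: measurable_cst.
- move=> v _; rewrite patchE; case: ifPn => [|_]; last by rewrite lee_fin mulr_ge0.
  rewrite inE/= lee_fin mulrC ler_pdivlMr// => Kf.
  have fv := normr_ge0 (f v); move: (`|f v|) fv Kf => x x0 Kx.
  have : x * ln K <= x * ln x by rewrite ler_wpM2l// ler_ln ?posrE ?(ltW Kx)//; lra.
  have : 0 <= x * enorm v ^+ 2 by rewrite mulr_ge0// sqr_ge0.
  have := expR_ge0 (- enorm v ^+ 2); lra.
Qed.

End entropy.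

(** * A smooth truncation of the energy *)

Section flat_exp.
Context {R : realType}.

(* x^-k exp(-1/x), extended by 0 to x <= 0; this family is closed under derivation. *)
Definition flat_exp (k : nat) (x : R) : R := if 0 < x then x ^- k * expR (- x^-1) else 0.

Lemma flat_exp_le0 k x : x <= 0 -> flat_exp k x = 0.
Proof. by rewrite /flat_exp ltNge => ->. Qed.

Lemma flat_exp_ge0 k x : 0 <= flat_exp k x.
Proof.
rewrite /flat_exp; case: ifP => // x0.
by rewrite mulr_ge0 ?expR_ge0// invr_ge0 exprn_ge0// ltW.
Qed.

Lemma flat_exp0_gt0 x : 0 < x -> 0 < flat_exp 0 x.
Proof. by move=> x0; rewrite /flat_exp x0 expr0 invr1 mul1r expR_gt0. Qed.

(** One term of the exponential series: [exp(y) >= y^(k+2)/(k+2)!] at [y = 1/x]. This bound gives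
    the zero derivative at 0. *)
Lemma flat_exp_quadratic k x : flat_exp k x <= (k.+2)`!%:R * x ^+ 2.
Proof.
rewrite /flat_exp; case: ifP => x0; last by rewrite mulr_ge0// sqr_ge0.
have y0 : 0 < x^-1 by rewrite invr_gt0.
have h := expR_ge1Dxn k.+1 (ltW y0).
have f0 : 0 < (k.+2)`!%:R :> R by rewrite ltr0n fact_gt0.
have h1 : x^-1 ^+ k.+2 / (k.+2)`!%:R <= expR x^-1 by apply: le_trans h; rewrite lerDr.
have -> : x ^- k = x ^+ 2 * x^-1 ^+ k.+2.
  by rewrite -(addn2 k) exprD mulrCA -exprMn mulfV ?gt_eqF// expr1n mulr1 exprVn.
rewrite -mulrA mulrC ler_wpM2r ?sqr_ge0// expRN ler_pdivrMr ?expR_gt0// mulrC.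
by rewrite -ler_pdivrMr.
Qed.

Lemma is_derive_flat_exp k x :
  is_derive x (1 : R) (flat_exp k) (flat_exp k.+2 x - k%:R * flat_exp k.+1 x).
Proof.
have [x0|x0|->] := ltgtP x 0.
- have near0 : \near x, cst 0 x = flat_exp k x.
    have : \forall y \near x, y < 0 by exact: lt_nbhsl.
    by apply: filterS => y y0; rewrite flat_exp_le0// ltW.
  rewrite !flat_exp_le0 ?ltW// mulr0 subr0.
  exact: near_eq_is_derive near0 _.
- have nearE : \near x, (x ^- k * expR (- x^-1)) = flat_exp k x.
    have : \forall y \near x, 0 < y by exact: lt_nbhsr.
    by apply: filterS => y y0; rewrite /flat_exp y0.
  have xn0 : x != 0 by rewrite gt_eqF.
  apply: near_eq_is_derive nearE _.
  rewrite (_ : _ - _ = - (k%:R * x ^- k.+1) * expR (- x^-1) +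
      x ^- k * (expR (- x^-1) * (- - (1 / x ^+ 2)))); last first.
    rewrite /flat_exp x0 opprK mul1r -(addn2 k) exprD invfM; ring.
  apply: is_derive_mulf.
    case: k => [|k].
      rewrite mul0r oppr0 (_ : (fun x => _) = cst 1); first exact: is_derive_cst.
      by apply/funext => y; rewrite expr0 invr1.
    rewrite (_ : - _ = - (k.+1%:R * x ^+ k / (x ^+ k.+1) ^+ 2)); last first.
      by rewrite !exprS; field; rewrite expf_neq0.
    apply: is_derive_invf; first by rewrite expf_neq0.
    split; first exact: exprn_derivable.
    by rewrite exp_derive /GRing.scale/= mulr1.
  apply: is_derive_compf.
  apply: is_derive_oppf; apply: is_derive_invf => //.
- rewrite !flat_exp_le0// mulr0 subr0.
  apply: (@is_derive_quadratic _ _ _ _ (k.+2)`!%:R) => h.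
  rewrite add0r mul0r subr0 (flat_exp_le0 k (lexx 0)) subr0 ger0_norm ?flat_exp_ge0//.
  exact: flat_exp_quadratic.
Qed.

End flat_exp.

(** * Smoothness by closure under differentiation *)

Section smooth_class.
Context {R : realType} {n : nat}.
Implicit Types f g : 'rV[R]_n -> R.

(** A syntactic class that contains the truncated energy and is stable under partial derivatives.
    Smoothness of every order then follows by induction on the list of derivatives, without formulas
    for iterated derivatives of products and composites. *)
Inductive elementary_smooth : ('rV[R]_n -> R) -> Prop :=
| es_cst c : elementary_smooth (fun=> c)
| es_coord j : elementary_smooth (fun v => v ord0 j)
| es_add f g : elementary_smooth f -> elementary_smooth g ->
    elementary_smooth (fun v => f v + g v)
| es_mul f g : elementary_smooth f -> elementary_smooth g ->
    elementary_smooth (fun v => f v * g v)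
| es_inv f : (forall v, f v != 0) -> elementary_smooth f ->
    elementary_smooth (fun v => (f v)^-1)
| es_flat k f : elementary_smooth f -> elementary_smooth (fun v => flat_exp k (f v)).

Lemma es_sum (I : Type) (r : seq I) (F : I -> 'rV[R]_n -> R) :
  (forall i, elementary_smooth (F i)) ->
  elementary_smooth (fun v => \sum_(i <- r) F i v).
Proof.
move=> sF; elim: r => [|i r IH].
  by rewrite (_ : (fun v => _) = fun=> 0) => [|]; [exact: es_cst|apply/funext => v; rewrite big_nil].
rewrite (_ : (fun v => _) = fun v => F i v + \sum_(j <- r) F j v); first exact: es_add.
by apply/funext => v; rewrite big_cons.
Qed.

Lemma es_differentiable f v : elementary_smooth f -> differentiable f v.
Proof.
elim=> {f} [c|j|f g _ df _ dg|f g _ df _ dg|f f0 _ df|k f _ df].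
- exact: differentiable_cst.
- exact: differentiable_coord.
- exact: differentiableD.
- exact: differentiableM.
- exact: differentiableV.
- apply: (@differentiable_comp _ _ _ _ f (flat_exp k)) => //.
  by apply/derivable1_diffP; have [] := is_derive_flat_exp k (f v).
Qed.

Lemma es_continuous f : elementary_smooth f -> continuous f.
Proof. by move=> sf v; apply: differentiable_continuous; exact: es_differentiable. Qed.

Lemma es_derive f i : elementary_smooth f ->
  exists2 g, elementary_smooth g & forall v, is_derive v (delta_mx ord0 i) f (g v).
Proof.
elim=> {f} [c|j|f1 f2 s1 [g1 t1 d1] s2 [g2 t2 d2]|f1 f2 s1 [g1 t1 d1] s2 [g2 t2 d2]|
  f f0 s [g t d]|k f s [g t d]].
- by exists (fun=> 0); [exact: es_cst|move=> v; exact: is_derive_cst].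
- by exists (fun=> (j == i)%:R); [exact: es_cst|move=> v; exact: is_derive_coord].
- exists (fun v => g1 v + g2 v); first exact: es_add.
  by move=> v; exact: is_derive_addf.
- exists (fun v => g1 v * f2 v + f1 v * g2 v); first by apply: es_add; exact: es_mul.
  by move=> v; exact: is_derive_mulf.
- exists (fun v => (- 1) * (g v * ((f v)^-1 * (f v)^-1))).
    apply: es_mul; first exact: es_cst.
    by apply: es_mul => //; apply: es_mul; exact: es_inv.
  move=> v; rewrite mulN1r -invfM -expr2; exact: is_derive_invf.
- exists (fun v => (flat_exp k.+2 (f v) + (- k%:R) * flat_exp k.+1 (f v)) * g v).
    apply: es_mul => //; apply: es_add; first exact: es_flat.
    by apply: es_mul; [exact: es_cst|exact: es_flat].
  move=> v; apply: is_derive_compf => //; rewrite mulNr; exact: is_derive_flat_exp.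
Qed.

Lemma es_partial f i : elementary_smooth f -> elementary_smooth (partial i f).
Proof.
move=> /(es_derive i)[g sg dg]; rewrite (_ : partial i f = g)//.
by apply/funext => v; have [] := dg v.
Qed.

Lemma es_smooth f : elementary_smooth f -> smooth f.
Proof.
move=> sf s; have {}sf : elementary_smooth (partials s f).
  by elim: s => [//|i s IH]; exact: es_partial.
split; first exact: es_continuous.
by move=> i v; apply: diff_derivable; exact: es_differentiable.
Qed.

End smooth_class.

Section partial_lemmas.
Context {R : realType} {n : nat}.
Implicit Types f g : 'rV[R]_n -> R.

Lemma partial_open (U : set 'rV[R]_n) f g i v : open U -> (forall u, U u -> f u = g u) ->
  U v -> partial i f v = partial i g v.
Proof.
move=> oU fg Uv; apply: near_eq_derive.
have : nbhs v U by exact: open_nbhs_nbhs.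
by apply: filterS.
Qed.

Lemma es_scale f (c : R) : elementary_smooth f -> elementary_smooth (fun v => f (c *: v)).
Proof.
elim=> {f} [k|j|f g _ sf _ sg|f g _ sf _ sg|f f0 _ sf|k f _ sf].
- exact: es_cst.
- rewrite (_ : (fun v => _) = fun v : 'rV[R]_n => c * v ord0 j).
    by apply: es_mul; [exact: es_cst|exact: es_coord].
  by apply/funext => v; rewrite mxE.
- exact: es_add.
- exact: es_mul.
- by apply: es_inv => // v; exact: f0.
- exact: es_flat.
Qed.

Lemma partial_scale f (c : R) i v : elementary_smooth f ->
  partial i (fun u => f (c *: u)) v = c * partial i f (c *: v).
Proof.
move=> sf; have df : is_derive (c *: v) (delta_mx ord0 i) f (partial i f (c *: v)).
  by apply: derivableP; apply: diff_derivable; exact: es_differentiable.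
suff h : is_derive v (delta_mx ord0 i) (fun u => f (c *: u)) (c * partial i f (c *: v)).
  by have [] := h.
apply/is_derive_lineP.
rewrite (_ : (fun h => _) = fun h : R => f ((c * h) *: delta_mx ord0 i + c *: v)); last first.
  by apply/funext => h; rewrite scalerDr scalerA.
rewrite mulrC.
apply: (@is_derive_compf _ _ (fun y : R => f (y *: delta_mx ord0 i + c *: v)) (fun h : R => c * h)).
  by rewrite mulr0; move/is_derive_lineP: df.
apply: (@is_derive_quadratic _ _ _ _ 0) => h.
by rewrite add0r mulr0 subr0 subrr normr0 mul0r.
Qed.

Lemma derive_es f (u v : 'rV[R]_n) : elementary_smooth f ->
  is_derive v u f (\sum_j u ord0 j * partial j f v).
Proof.
move=> sf; have df := es_differentiable v sf.
suff <- : 'D_u f v = \sum_j u ord0 j * partial j f v.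
  by apply: derivableP; exact: diff_derivable.
rewrite deriveE// {1}(row_sum_delta u) linear_sum; apply: eq_bigr => j _.
by rewrite linearZ/= /partial deriveE.
Qed.

(** Mean value theorem on the segment from [w] to [v]; the factor [n] comes from bounding each of
    the [n] terms of the directional derivative separately. *)
Lemma es_lipschitz f (B : R) v w : elementary_smooth f -> 0 <= B ->
  (forall j u, `|partial j f u| <= B) -> `|f v - f w| <= n%:R * B * enorm (v - w).
Proof.
move=> sf B0 fB.
pose F (t : R) := f (t *: (v - w) + w).
have dF (t : R) : is_derive t (1:R) F (\sum_j (v - w) ord0 j * partial j f (t *: (v - w) + w)).
  apply: is_derive_transfer (derive_es (v - w) (t *: (v - w) + w) sf) => h.
  have -> : h *: (1 : R) = h by rewrite /GRing.scale/= mulr1.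
  by rewrite /F scalerDl addrA.
have cF : {within `[0, 1], continuous F}.
  apply: derivable_within_continuous => t _; by have [] := dF t.
have [t _] := @MVT_segment R F _ 0 1 ler01 (fun t _ => dF t) cF.
rewrite /F scale1r subrK scale0r add0r subr0 mulr1 => ->.
apply: le_trans (ler_norm_sum _ _ _) _.
rewrite -mulrA mulr_natl -[n in _ *+ n]card_ord -sumr_const.
apply: ler_sum => j _; rewrite normrM mulrC ler_pM//.
exact: coord_le_enorm.
Qed.

End partial_lemmas.

Section cutoff_energy.
Context {R : realType} {n : nat}.
Implicit Types v w : 'rV[R]_n.

(** The classical partition quotient: 1 for [|v| <= 1] and 0 for [|v| >= 2]. The two terms of the
    denominator never vanish together. *)
Definition cutoff v : R :=
  flat_exp 0 (4 - enorm v ^+ 2) /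
  (flat_exp 0 (4 - enorm v ^+ 2) + flat_exp 0 (enorm v ^+ 2 - 1)).

Let den_gt0 v : 0 < flat_exp 0 (4 - enorm v ^+ 2) + flat_exp 0 (enorm v ^+ 2 - 1).
Proof.
have a0 := flat_exp_ge0 0 (4 - enorm v ^+ 2); have b0 := flat_exp_ge0 0 (enorm v ^+ 2 - 1).
have [h|h] := ltP (enorm v ^+ 2) 4.
  by rewrite ltr_pwDl// flat_exp0_gt0//; lra.
by rewrite ltr_wpDl// flat_exp0_gt0//; lra.
Qed.

Let es_sq : elementary_smooth (fun v => enorm v ^+ 2).
Proof.
rewrite (_ : (fun v => _) = fun v : 'rV[R]_n => \sum_i v ord0 i * v ord0 i).
  by apply: es_sum => i; apply: es_mul; exact: es_coord.
by apply/funext => v; rewrite enorm_sqr; apply: eq_bigr => i _; rewrite expr2.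
Qed.

Let es_cutoff : elementary_smooth cutoff.
Proof.
have s1 : elementary_smooth (fun v : 'rV[R]_n => flat_exp 0 (4 - enorm v ^+ 2)).
  apply: es_flat; rewrite (_ : (fun v => _) = fun v : 'rV[R]_n => 4 + (- 1) * enorm v ^+ 2).
    by apply: es_add; [exact: es_cst|apply: es_mul => //; exact: es_cst].
  by apply/funext => v; rewrite mulN1r.
have s2 : elementary_smooth (fun v : 'rV[R]_n => flat_exp 0 (enorm v ^+ 2 - 1)).
  by apply: es_flat; apply: es_add => //; exact: es_cst.
apply: es_mul => //; apply: es_inv; last exact: es_add.
by move=> v; rewrite gt_eqF.
Qed.

Let cutoff_ge0 v : 0 <= cutoff v.
Proof. by rewrite divr_ge0 ?flat_exp_ge0// ltW. Qed.

Let cutoff_le1 v : cutoff v <= 1.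
Proof. by rewrite ler_pdivrMr// mul1r lerDl flat_exp_ge0. Qed.

Let cutoff1 v : enorm v ^+ 2 <= 1 -> cutoff v = 1.
Proof.
move=> h; rewrite /cutoff (flat_exp_le0 0 (x := enorm v ^+ 2 - 1)); last by lra.
by rewrite addr0 divff// gt_eqF// flat_exp0_gt0//; lra.
Qed.

Let cutoff0 v : 4 <= enorm v ^+ 2 -> cutoff v = 0.
Proof. by move=> h; rewrite /cutoff flat_exp_le0 ?mul0r//; lra. Qed.

Let energy1 v : R := enorm v ^+ 2 * cutoff v.

Let es_energy1 : elementary_smooth energy1.
Proof. exact: es_mul. Qed.

(** Equal to [|v|^2] times the cutoff at scale [rho], but written as a dilation of one profile: the
    factor [rho^2] exactly compensates two derivatives, whence bounds independent of [rho]. *)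
Definition cutoff_energy (rho : R) v : R := rho ^+ 2 * energy1 (rho^-1 *: v).

Lemma enormZ (c : R) v : enorm (c *: v) ^+ 2 = c ^+ 2 * enorm v ^+ 2.
Proof.
by rewrite !enorm_sqr mulr_sumr; apply: eq_bigr => i _; rewrite mxE exprMn.
Qed.

Lemma es_cutoff_energy rho : elementary_smooth (cutoff_energy rho).
Proof. by apply: es_mul; [exact: es_cst|exact: es_scale]. Qed.

Lemma cutoff_energyE rho v : 0 < rho ->
  cutoff_energy rho v = enorm v ^+ 2 * cutoff (rho^-1 *: v).
Proof.
move=> r0; rewrite /cutoff_energy /energy1 enormZ exprVn; field.
by rewrite gt_eqF.
Qed.

Lemma cutoff_energy_ge0 rho v : 0 < rho -> 0 <= cutoff_energy rho v.
Proof. by move=> r0; rewrite cutoff_energyE// mulr_ge0// sqr_ge0. Qed.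

Lemma cutoff_energy_le rho v : 0 < rho -> cutoff_energy rho v <= enorm v ^+ 2.
Proof. by move=> r0; rewrite cutoff_energyE// ler_piMr// sqr_ge0. Qed.

Lemma cutoff_energy_in rho v : 0 < rho -> enorm v <= rho -> cutoff_energy rho v = enorm v ^+ 2.
Proof.
move=> r0 vr; rewrite cutoff_energyE// cutoff1 ?mulr1// enormZ exprVn mulrC.
rewrite ler_pdivrMr ?exprn_gt0// mul1r ler_pXn2r ?nnegrE ?enorm_ge0//; exact: ltW.
Qed.

Lemma cutoff_energy_out rho v : 0 < rho -> 2 * rho <= enorm v -> cutoff_energy rho v = 0.
Proof.
move=> r0 vr; rewrite cutoff_energyE// cutoff0 ?mulr0// enormZ exprVn mulrC.
rewrite ler_pdivlMr ?exprn_gt0// (_ : 4 * rho ^+ 2 = (2 * rho) ^+ 2); last by ring.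
by rewrite ler_pXn2r ?nnegrE ?enorm_ge0// mulr_ge0// ltW.
Qed.

Lemma open_enorm_lt (r : R) : open [set v : 'rV[R]_n | enorm v < r].
Proof.
apply: (@open_comp _ _ (@enorm R n) [set x | x < r]); last exact: open_lt.
by move=> v _; exact: continuous_enorm.
Qed.

Lemma open_enorm_gt (r : R) : open [set v : 'rV[R]_n | r < enorm v].
Proof.
apply: (@open_comp _ _ (@enorm R n) [set x | r < x]); last exact: open_gt.
by move=> v _; exact: continuous_enorm.
Qed.

Lemma partial_cutoff_energy_in rho i v : 0 < rho -> enorm v < rho ->
  partial i (cutoff_energy rho) v = 2 * v ord0 i.
Proof.
move=> r0 vr.
rewrite (@partial_open _ _ _ _ (fun v : 'rV[R]_n => \sum_j v ord0 j ^+ 2) i v (@open_enorm_lt rho))//.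
  have h : is_derive v (delta_mx ord0 i) (fun v : 'rV[R]_n => \sum_j v ord0 j ^+ 2)
      (\sum_j 2 * v ord0 j * (j == i)%:R).
    by apply: is_derive_sumf => j; apply: is_derive_sqrf; exact: is_derive_coord.
  have [_] := h; rewrite /partial => ->.
  rewrite (bigD1 i)//= eqxx mulr1 big1 ?addr0// => j /negbTE ->.
  by rewrite mulr0.
by move=> u /= ur; rewrite cutoff_energy_in ?enorm_sqr// ltW.
Qed.

Lemma partials_cutoff_energy_in rho i j v : 0 < rho -> enorm v < rho ->
  partials [:: i; j] (cutoff_energy rho) v = 2 * (i == j)%:R.
Proof.
move=> r0 vr /=.
rewrite (@partial_open _ _ _ _ (fun v : 'rV[R]_n => 2 * v ord0 j) i v (@open_enorm_lt rho))//.
  have h : is_derive v (delta_mx ord0 i) (fun v : 'rV[R]_n => 2 * v ord0 j)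
      (0 * v ord0 j + 2 * (j == i)%:R).
    by apply: is_derive_mulf; exact: is_derive_coord.
  by have [_] := h; rewrite /partial => ->; rewrite mul0r add0r eq_sym.
by move=> u /= ur; exact: partial_cutoff_energy_in.
Qed.

(** The second derivatives are continuous, hence bounded on a cube of radius 2, and vanish for
    [|v| > 2]. *)
Let energy1_bound : exists2 B : R, 0 <= B &
  forall i j v, `|partials [:: i; j] energy1 v| <= B.
Proof.
have ex i j : exists M : R, forall v, `|partials [:: i; j] energy1 v| <= M.
  have cp : continuous (partials [:: i; j] energy1).
    by apply: es_continuous; do 2 apply: es_partial.
  have [M hM] := continuous_bounded_box 0 2 cp.
  exists (Num.max 0 M) => v; have [v2|v2] := leP (enorm v) 2.
    rewrite le_max hM ?orbT// => k; rewrite mxE subr0.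
    exact: le_trans (coord_le_enorm _ _) v2.
  rewrite (_ : partials _ _ _ = 0) ?normr0 ?le_max ?lexx//=.
  rewrite (@partial_open _ _ _ _ (fun=> 0) i v (@open_enorm_gt 2))//.
    exact: derive_cst.
  move=> u /= u2; rewrite (@partial_open _ _ _ _ (fun=> 0) j u (@open_enorm_gt 2))//.
    exact: derive_cst.
  move=> x /= x2; rewrite /energy1 cutoff0 ?mulr0//.
  rewrite (_ : 4 = 2 ^+ 2); last by ring.
  by rewrite ler_pXn2r ?nnegrE ?enorm_ge0// ltW.
have [M hM] : exists M : 'I_n -> 'I_n -> R,
    forall i j v, `|partials [:: i; j] energy1 v| <= M i j.
  by exists (fun i => projT1 (choice (ex i))) => i; exact: projT2 (choice (ex i)).
exists (\sum_i \sum_j `|M i j|); first by apply: sumr_ge0 => i _; apply: sumr_ge0.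
move=> i j v; apply: le_trans (hM i j v) _; apply: le_trans (ler_norm _) _.
apply: (@le_trans _ _ (\sum_k `|M i k|)).
  by rewrite (bigD1 j)//= lerDl; apply: sumr_ge0.
rewrite [leRHS](bigD1 i)//= lerDl.
by apply: sumr_ge0 => k _; apply: sumr_ge0.
Qed.

Lemma cutoff_energy_bounds : exists2 B : R, 0 <= B & forall rho, 0 < rho ->
  (forall i j v, `|partials [:: i; j] (cutoff_energy rho) v| <= B) /\
  (forall i v w, `|partial i (cutoff_energy rho) v - partial i (cutoff_energy rho) w| <=
     n%:R * B * enorm (v - w)).
Proof.
have [B B0 hB] := energy1_bound; exists B; first exact: B0.
move=> rho r0.
have p2 i j v : `|partials [:: i; j] (cutoff_energy rho) v| <= B.
  have s1 : elementary_smooth (fun u => energy1 (rho^-1 *: u)) by exact: (es_scale rho^-1 es_energy1).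
  have e1 : partial j (cutoff_energy rho) = fun u => rho * partial j energy1 (rho^-1 *: u).
    apply/funext => u.
    have h : is_derive u (delta_mx ord0 j) (cutoff_energy rho)
       (0 * energy1 (rho^-1 *: u) + rho ^+ 2 * partial j (fun u => energy1 (rho^-1 *: u)) u).
      apply: is_derive_mulf.
      by apply: derivableP; apply: diff_derivable; exact: es_differentiable.
    have [_ e] := h; rewrite -[LHS]/('D_(delta_mx ord0 j) (cutoff_energy rho) u) e.
    rewrite (partial_scale _ _ _ es_energy1) mul0r add0r.
    by rewrite mulrA expr2 mulfK// gt_eqF.
  have sp : elementary_smooth (partial j energy1) by exact: es_partial.
  rewrite /= e1.
  have h : is_derive v (delta_mx ord0 i) (fun u => rho * partial j energy1 (rho^-1 *: u))
      (0 * partial j energy1 (rho^-1 *: v) + rho * partial i (fun u => partial j energy1 (rho^-1 *: u)) v).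
    apply: is_derive_mulf.
    apply: derivableP; apply: diff_derivable; exact: es_differentiable (es_scale rho^-1 sp).
  have [_ e] := h.
  rewrite /partial e (partial_scale _ _ _ sp) mul0r add0r mulrA.
  by rewrite divff ?gt_eqF// mul1r; exact: hB.
split; first exact: p2.
move=> i v w; apply: es_lipschitz; last 2 first.
- exact: B0.
- by move=> j u; exact: (p2 j i u).
by apply: es_partial; exact: es_cutoff_energy.
Qed.

End cutoff_energy.

(** * The collision functional *)

Section product_sigma_finite.
Context d1 d2 (T1 : measurableType d1) (T2 : measurableType d2) {R : realType}.
Variable m1 : {sigma_finite_measure set T1 -> \bar R}.
Variable m2 : {sigma_finite_measure set T2 -> \bar R}.

(* The library's sigma-finite instance on [m1 \x m2] is not found by unification,
   which prevents iterating products. *)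
Definition product_sigma_finite : set (T1 * T2)%type -> \bar R :=
  product_measure1 m1 m2.

HB.instance Definition _ := Measure.on product_sigma_finite.

Let sigma_finite_product : sigma_finite setT product_sigma_finite.
Proof.
have /sigma_finiteP[F [TF ndF Foo]] := sigma_finiteT m1.
have /sigma_finiteP[G [TG ndG Goo]] := sigma_finiteT m2.
exists (fun n => F n `*` G n).
 rewrite -setXTT TF TG predeqE => -[x y]; split.
    move=> [/= [k _ Fkx] [l _ Gly]]; exists (maxn k l) => //; split.
    - by move: x Fkx; exact/subsetPset/ndF/leq_maxl.
    - by move: y Gly; exact/subsetPset/ndG/leq_maxr.
  by move=> [k _ []/= ? ?]; split; exists k.
move=> k; have [? ?] := Foo k; have [? ?] := Goo k.
split; first exact: measurableX.
by rewrite /product_sigma_finite product_measure1E// lte_mul_pinfty// ge0_fin_numE.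
Qed.

HB.instance Definition _ :=
  Measure_isSigmaFinite.Build _ _ _ product_sigma_finite sigma_finite_product.

End product_sigma_finite.

Section collision_functional.
Context {R : realType} {n : nat}.
Local Notation leb := (@lebesgue_rV R n).
Local Notation mu := (@lebesgue_measure R).
Local Notation leb2 := (leb \x leb)%E.
Local Notation VV := ('rV[R]_n * 'rV[R]_n)%type.
Variable f : R -> 'rV[R]_n -> R.
Hypothesis mf : @measurable_fun _ _ (R * 'rV[R]_n)%type R
      (`[0, +oo[%classic `*` setT) (fun p => f p.1 p.2).
Variable m : R.
Hypothesis f1 : forall t, 0 <= t -> (\int[leb]_v `|f t v|%:E = m%:E)%E.
Hypothesis mft : forall t, 0 <= t -> measurable_fun setT (f t).

(** At [gamma = -2] the integrands of the weak formulation are of this kind for the truncated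
    energy. Finite mass then makes all collision integrals converge, and convergence is what permits
    splitting real-valued integrals of sums. *)
Definition bounded_kernel (k : VV -> R) : Prop :=
  measurable_fun setT k /\ exists C : R, forall p, `|k p| <= C.

Definition collision (k : VV -> R) (tau : R) : R :=
  \int[leb2]_p (f tau p.1 * f tau p.2 * k p).

Lemma integral_tensor (g1 g2 : 'rV[R]_n -> R) :
  measurable_fun setT g1 -> measurable_fun setT g2 ->
  (forall v, 0 <= g1 v) -> (forall v, 0 <= g2 v) ->
  (\int[leb2]_p (g1 p.1 * g2 p.2)%:E = (\int[leb]_v (g1 v)%:E) * (\int[leb]_v (g2 v)%:E))%E.
Proof.
move=> m1 m2 g10 g20.
have mg : measurable_fun setT (fun p : VV => (g1 p.1 * g2 p.2)%:E).
  apply/measurable_EFinP; apply: measurable_funM.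
    by apply: (measurableT_comp m1); exact: measurable_fst.
  by apply: (measurableT_comp m2); exact: measurable_snd.
have g0 (p : VV) : (0 <= (g1 p.1 * g2 p.2)%:E)%E by rewrite lee_fin mulr_ge0.
rewrite (fubini_tonelli1 (m1 := leb) (m2 := leb) _ mg g0) /fubini_F /=.
rewrite -ge0_integralZr//; last 3 first.
- exact/measurable_EFinP.
- by move=> v _; rewrite lee_fin.
- by apply: integral_ge0 => v _; rewrite lee_fin.
apply: eq_integral => v _; under eq_integral do rewrite EFinM.
rewrite ge0_integralZl_EFin//; first by move=> w _; rewrite lee_fin.
exact/measurable_EFinP.
Qed.

Let mt_abs t : 0 <= t -> measurable_fun setT (fun v => `|f t v|).
Proof. by move=> t0; apply: measurableT_comp => //; exact: mft. Qed.

Let m_tensor t k : 0 <= t -> measurable_fun setT k ->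
  measurable_fun setT (fun p : VV => f t p.1 * f t p.2 * k p).
Proof.
move=> t0 mk; apply: measurable_funM => //; apply: measurable_funM.
  by apply: (measurableT_comp (mft t0)); exact: measurable_fst.
by apply: (measurableT_comp (mft t0)); exact: measurable_snd.
Qed.

Lemma integral_abs_collision t (k : VV -> R) (C : R) : 0 <= t -> measurable_fun setT k ->
  (forall p, `|k p| <= C) ->
  (\int[leb2]_p `|(f t p.1 * f t p.2 * k p)%:E| <= (C * m ^+ 2)%:E)%E.
Proof.
move=> t0 mk kC.
have C0 : 0 <= C by apply: le_trans (kC (0, 0)).
have mabs : measurable_fun setT (fun p : VV => (`|f t p.1| * `|f t p.2|)%:E).
  apply/measurable_EFinP; apply: measurable_funM.
    by apply: (measurableT_comp (mt_abs t0)); exact: measurable_fst.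
  by apply: (measurableT_comp (mt_abs t0)); exact: measurable_snd.
apply: (@le_trans _ _ (\int[leb2]_p (C%:E * (`|f t p.1| * `|f t p.2|)%:E))%E).
  apply: ge0_le_integral.
  - exact: measurableT.
  - by move=> p _; exact: abse_ge0.
  - by apply: measurableT_comp => //; apply/measurable_EFinP; exact: m_tensor.
  - by apply: emeasurable_funM => //; exact: measurable_cst.
  - by move=> p _; rewrite abse_EFin -EFinM lee_fin !normrM mulrC ler_wpM2r//.
rewrite ge0_integralZl_EFin//.
rewrite (@integral_tensor (fun v => `|f t v|) (fun v => `|f t v|))//; last 2 first.
- exact: mt_abs.
- exact: mt_abs.
by rewrite f1// -!EFinM expr2.
Qed.

Lemma integrable_collision t k : 0 <= t -> bounded_kernel k ->
  leb2.-integrable setT (fun p : VV => (f t p.1 * f t p.2 * k p)%:E).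
Proof.
move=> t0 [mk [C kC]]; apply/integrableP; split.
  by apply/measurable_EFinP; exact: m_tensor.
by apply: le_lt_trans (integral_abs_collision t0 mk kC) _; rewrite ltry.
Qed.

Lemma collisionD t k1 k2 : 0 <= t -> bounded_kernel k1 -> bounded_kernel k2 ->
  collision (fun p => k1 p + k2 p) t = collision k1 t + collision k2 t.
Proof.
move=> t0 b1 b2; rewrite /collision -RintegralD//; last 2 first.
- exact: integrable_collision.
- exact: integrable_collision.
by apply: eq_Rintegral => p _; rewrite mulrDr.
Qed.

Lemma collisionZ t c k : 0 <= t -> bounded_kernel k ->
  collision (fun p => c * k p) t = c * collision k t.
Proof.
move=> t0 b1; rewrite /collision -RintegralZl//; last exact: integrable_collision.
by apply: eq_Rintegral => p _; rewrite mulrCA.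
Qed.

Let lebesgue_measure_itv0 (t : R) : 0 <= t -> (mu `[0%R, t]%classic = t%:E)%E.
Proof.
rewrite lebesgue_measure_itv/= lte_fin le_eqVlt => /predU1P[<-|->].
  by rewrite ltxx.
by rewrite oppr0 adde0.
Qed.

(** Joint measurability of [f] is known for nonnegative times only; extension by 0 gives a
    measurable function on the whole line. *)
Let fext (tau : R) (v : 'rV[R]_n) : R := if 0 <= tau then f tau v else 0.

Let mfext : measurable_fun [set: R * 'rV[R]_n] (fun p => fext p.1 p.2).
Proof.
have mD : measurable (`[0, +oo[%classic `*` setT : set (R * 'rV[R]_n)).
  by apply: measurableX.
have := (measurable_restrictT _ mD).1 mf.
rewrite (_ : _ \_ _ = fun p => fext p.1 p.2)//.
apply/funext => -[s v]; rewrite patchE /fext /=.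
have -> : ((s, v) \in (`[0, +oo[%classic `*` setT : set (R * 'rV[R]_n))) = (0 <= s).
  by apply/idP/idP; rewrite inE /setX/= in_itv/= andbT => // -[].
by case: ifP.
Qed.

(** Fubini on time times pairs of velocities provides measurability in [tau] together with
    integrability; the total integral is at most [C m^2 t]. *)
Lemma integrable_collision_time t k : 0 <= t -> bounded_kernel k ->
  mu.-integrable `[0, t] (fun tau => (collision k tau)%:E).
Proof.
move=> t0 [mk [C kC]].
(* The indicator of the time interval sits in the integrand, so that the product is taken over whole
   spaces. *)
pose H (q : measurableTypeR R * VV) : \bar R :=
  ((\1_(`[0, t]%classic : set R) q.1) * (fext q.1 q.2.1 * fext q.1 q.2.2 * k q.2))%:E.
have m12 : measurable_fun [set: measurableTypeR R * VV] (fun q => fext q.1 q.2.1).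
  apply: (measurableT_comp mfext (g := fun q : measurableTypeR R * VV => (q.1, q.2.1))).
  apply: measurable_fun_pair; first exact: measurable_fst.
  by apply: (measurableT_comp measurable_fst); exact: measurable_snd.
have m13 : measurable_fun [set: measurableTypeR R * VV] (fun q => fext q.1 q.2.2).
  apply: (measurableT_comp mfext (g := fun q : measurableTypeR R * VV => (q.1, q.2.2))).
  apply: measurable_fun_pair; first exact: measurable_fst.
  by apply: (measurableT_comp measurable_snd); exact: measurable_snd.
have mH : measurable_fun setT H.
  apply/measurable_EFinP; apply: measurable_funM.
    have mI : measurable_fun [set: measurableTypeR R] (\1_(`[0, t]%classic : set R) : R -> R).
      exact: measurable_indic.
    by apply: (measurableT_comp mI); exact: measurable_fst.
  apply: measurable_funM; first exact: measurable_funM.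
  by apply: (measurableT_comp mk); exact: measurable_snd.
have HE tau : (\int[leb2]_p H (tau, p) = ((fun tau : R => (collision k tau)%:E) \_ (`[0%R, t]%classic : set R)) tau)%E.
  rewrite patchE; case: ifPn => [|/negP].
    rewrite inE/= => /[dup] tau01; rewrite in_itv/= => /andP[tau0 _].
    rewrite /collision /Rintegral fineK; last first.
      by apply: integrable_fin_num => //; apply: integrable_collision => //; split=> //; exists C.
    apply: eq_integral => p _; rewrite /H /fext /= tau0.
    by rewrite indicE mem_set// mul1r.
  rewrite inE => nt; rewrite integral0_eq// => p _.
  by rewrite /H/= indicE memNset// mul0r.
have iH : (mu \x product_sigma_finite leb leb)%E.-integrable setT H.
  apply/(integrable12ltyP mu (product_sigma_finite leb leb) mH).
  apply: (@le_lt_trans _ _ (\int[mu]_tau ((cst (C * m ^+ 2)%:E) \_ (`[0%R, t]%classic : set R)) tau)%E).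
    apply: ge0_le_integral.
    - exact: measurableT.
    - by move=> tau _; apply: integral_ge0 => p _; exact: abse_ge0.
    - apply: (measurable_fun_fubini_tonelli_F (fun q => `|H q|%E)) => //.
      exact: measurableT_comp.
    - apply: (measurable_restrictT _ (measurable_itv _)).1.
      exact: measurable_cst.
    move=> tau _; rewrite patchE; case: ifPn => [|/negP].
      rewrite inE/= => /[dup] tau01; rewrite in_itv/= => /andP[tau0 _].
      apply: le_trans (integral_abs_collision tau0 mk kC).
      rewrite le_eqVlt; apply/orP; left; apply/eqP; apply: eq_integral => p _.
      by rewrite /H /fext /= tau0 indicE mem_set// mul1r.
    rewrite inE => nt; rewrite integral0_eq// => p _.
    by rewrite /H/= indicE memNset// mul0r normr0.
  rewrite -integral_mkcond integral_cst; last exact: measurable_itv.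
  by rewrite [X in (_ * X)%E](_ : _ = t%:E) ?ltry//; exact: lebesgue_measure_itv0.
rewrite integrable_mkcond; last exact: measurable_itv.
have := integrable_fubini_F iH; apply: eq_integrable => // tau _.
by rewrite -HE.
Qed.

Definition collision_time (t : R) (k : VV -> R) : R :=
  \int[mu]_(tau in `[0, t]) collision k tau.

Lemma bounded_kernelD k1 k2 : bounded_kernel k1 -> bounded_kernel k2 ->
  bounded_kernel (fun p => k1 p + k2 p).
Proof.
move=> [m1 [C1 k1C]] [m2 [C2 k2C]]; split; first exact: measurable_funD.
by exists (C1 + C2) => p; apply: le_trans (ler_normD _ _) _; exact: lerD.
Qed.

Lemma bounded_kernelZ c k : bounded_kernel k -> bounded_kernel (fun p => c * k p).
Proof.
move=> [mk [C kC]]; split; first by apply: measurable_funM => //; exact: measurable_cst.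
by exists (`|c| * C) => p; rewrite normrM ler_wpM2l.
Qed.

Lemma collision_timeD t k1 k2 : 0 <= t -> bounded_kernel k1 -> bounded_kernel k2 ->
  collision_time t (fun p => k1 p + k2 p) = collision_time t k1 + collision_time t k2.
Proof.
move=> t0 b1 b2; rewrite /collision_time -RintegralD//; last 2 first.
- exact: integrable_collision_time.
- exact: integrable_collision_time.
by apply: eq_Rintegral => tau; rewrite inE/= in_itv/= => /andP[tau0 _]; exact: collisionD.
Qed.

Lemma collision_timeZ t c k : 0 <= t -> bounded_kernel k ->
  collision_time t (fun p => c * k p) = c * collision_time t k.
Proof.
move=> t0 b1; rewrite /collision_time -RintegralZl//; last exact: integrable_collision_time.
by apply: eq_Rintegral => tau; rewrite inE/= in_itv/= => /andP[tau0 _]; exact: collisionZ.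
Qed.

Lemma bounded_kernel_cst c : bounded_kernel (fun=> c).
Proof. by split; [exact: measurable_cst|exists `|c|]. Qed.

Lemma bounded_kernel_sum (I : Type) (r : seq I) (k : I -> VV -> R) :
  (forall i, bounded_kernel (k i)) -> bounded_kernel (fun p => \sum_(i <- r) k i p).
Proof.
move=> bk; elim: r => [|i r IH].
  by rewrite (_ : (fun p => _) = fun=> 0) => [|]; [exact: bounded_kernel_cst|apply/funext => p; rewrite big_nil].
rewrite (_ : (fun p => _) = fun p => k i p + \sum_(j <- r) k j p); first exact: bounded_kernelD.
by apply/funext => p; rewrite big_cons.
Qed.

Lemma collision_time_sum (I : Type) (r : seq I) (k : I -> VV -> R) t : 0 <= t ->
  (forall i, bounded_kernel (k i)) ->
  collision_time t (fun p => \sum_(i <- r) k i p) = \sum_(i <- r) collision_time t (k i).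
Proof.
move=> t0 bk; elim: r => [|i r IH].
  rewrite big_nil (_ : (fun p => _) = fun p => 0 * 0); last by apply/funext => p; rewrite big_nil mul0r.
  by rewrite (collision_timeZ 0 t0 (bounded_kernel_cst 0)) mul0r.
rewrite big_cons -IH (_ : (fun p => _) = fun p => k i p + \sum_(j <- r) k j p).
  by rewrite collision_timeD//; exact: bounded_kernel_sum.
by apply/funext => p; rewrite big_cons.
Qed.

Lemma collision_time_le t k (C : R) : 0 <= t -> bounded_kernel k ->
  (forall tau, 0 <= tau <= t -> `|collision k tau| <= C) ->
  `|collision_time t k| <= C * t.
Proof.
move=> t0 bk kC.
have ik := integrable_collision_time t0 bk.
apply: le_trans (le_normr_Rintegral _ ik) _ => //.
have muI : (mu `[0%R, t]%classic = t%:E)%E by exact: lebesgue_measure_itv0.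
apply: (@le_trans _ _ (\int[mu]_(tau in `[0, t]) C)).
  apply: le_Rintegral.
  - exact: measurable_itv.
  - exact: integrable_norm.
  - apply: measurable_bounded_integrable.
    + exact: measurable_itv.
    + by rewrite [X in (X < _)%E]muI ltry.
    + exact: measurable_cst.
    + by exists `|C|; split => [|x xC y _]; [exact: num_real|exact: ltW].
  - by move=> tau; rewrite /= in_itv/= => ht; exact: kC.
rewrite Rintegral_cst; last exact: measurable_itv.
by rewrite [X in fine X]muI.
Qed.

End collision_functional.

(** * The collision kernel for gamma = -2 *)

Section critical_kernel.
Context {R : realType} {n : nat}.
Local Notation leb := (@lebesgue_rV R n).
Local Notation leb2 := (leb \x leb)%E.
Local Notation VV := ('rV[R]_n * 'rV[R]_n)%type.

(** The exponent [gamma + 2] is 0 and the power equals 1, also at [z = 0]; this is why [a] is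
    bounded. *)
Lemma coef_a_critical i j (z : 'rV[R]_n) :
  coef_a (-2) i j z = (i == j)%:R - z ord0 i * z ord0 j / enorm z ^+ 2.
Proof. by rewrite /coef_a addNr powRr0 mul1r. Qed.

Lemma coef_b_critical i (z : 'rV[R]_n) :
  coef_b (-2) i z = - (n%:R - 1) * z ord0 i / enorm z ^+ 2.
Proof. by rewrite /coef_b powRN powR_mulrn// enorm_ge0. Qed.

Lemma coef_a_critical_le i j (z : 'rV[R]_n) : `|coef_a (-2) i j z| <= 2.
Proof.
rewrite coef_a_critical.
have h : `|z ord0 i * z ord0 j / enorm z ^+ 2| <= 1.
  have [e0|e0] := eqVneq (enorm z) 0.
    by rewrite e0 expr0n invr0 mulr0 normr0.
  have e1 : 0 < enorm z by rewrite lt_def e0 enorm_ge0.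
  rewrite !normrM normfV (ger0_norm (sqr_ge0 _)) ler_pdivrMr ?exprn_gt0// mul1r expr2.
  by apply: ler_pM => //; exact: coord_le_enorm.
apply: le_trans (ler_normB _ _) _.
have : `|(i == j)%:R| <= 1 :> R by case: (i == j); rewrite ?normr0 ?normr1.
lra.
Qed.

Lemma coef_b_critical_le i (z : 'rV[R]_n) : `|coef_b (-2) i z| * enorm z <= n%:R.
Proof.
have n1 : (1 <= n)%N by case: n i z => [[]|].
have n1R : 1 <= n%:R :> R by rewrite ler1n.
rewrite coef_b_critical; have [e0|e0] := eqVneq (enorm z) 0.
  by rewrite e0 mulr0 ler0n.
have e1 : 0 < enorm z by rewrite lt_def e0 enorm_ge0.
rewrite !normrM normfV (ger0_norm (sqr_ge0 _)) normrN (ger0_norm (_ : 0 <= n%:R - 1)) ?subr_ge0//.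
rewrite (_ : _ * _ = (n%:R - 1) * (`|z ord0 i| / enorm z)); last by field.
have : `|z ord0 i| / enorm z <= 1 by rewrite ler_pdivrMr// mul1r coord_le_enorm.
have : 0 <= `|z ord0 i| / enorm z by rewrite divr_ge0// enorm_ge0.
nra.
Qed.

Let measurable_normed (c : 'rV[R]_n -> R) : measurable_fun setT c ->
  measurable_fun setT (fun z => c z / enorm z ^+ 2).
Proof.
move=> mc; apply: measurable_funM => //.
apply: (measurableT_comp (@measurable_invr R)).
by apply: measurable_funX; exact: measurable_enorm.
Qed.

Lemma measurable_coef_a_critical i j : measurable_fun setT (fun z : 'rV[R]_n => coef_a (-2) i j z).
Proof.
rewrite (_ : (fun _ => _) = fun z : 'rV[R]_n => (i == j)%:R - z ord0 i * z ord0 j / enorm z ^+ 2).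
  apply: measurable_funB; first exact: measurable_cst.
  by apply: measurable_normed; apply: measurable_funM; exact: measurable_coord.
by apply/funext => z; rewrite coef_a_critical.
Qed.

Lemma measurable_coef_b_critical i : measurable_fun setT (fun z : 'rV[R]_n => coef_b (-2) i z).
Proof.
rewrite (_ : (fun _ => _) = fun z : 'rV[R]_n => - (n%:R - 1) * z ord0 i / enorm z ^+ 2).
  apply: measurable_normed; apply: measurable_funM; first exact: measurable_cst.
  exact: measurable_coord.
by apply/funext => z; rewrite coef_b_critical.
Qed.

Definition kernel_a (phi : 'rV[R]_n -> R) i j (p : VV) : R :=
  coef_a (-2) i j (p.1 - p.2) * (partials [:: i; j] phi p.1 + partials [:: i; j] phi p.2).

Definition kernel_b (phi : 'rV[R]_n -> R) i (p : VV) : R :=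
  coef_b (-2) i (p.1 - p.2) * (partial i phi p.1 - partial i phi p.2).

(** The diffusion and drift terms of the weak formulation in a single integrand, so that their
    cancellation can be used pointwise. *)
Definition landau_kernel (phi : 'rV[R]_n -> R) (p : VV) : R :=
  2^-1 * (\sum_i \sum_j kernel_a phi i j p) + \sum_i kernel_b phi i p.

Section cutoff_kernel.
Variables (rho B : R).
Hypothesis rho0 : 0 < rho.
Hypothesis B0 : 0 <= B.
Local Notation phi := (@cutoff_energy R n rho).
Hypothesis phiB : (forall i j v, `|partials [:: i; j] phi v| <= B) /\
  (forall i v w, `|partial i phi v - partial i phi w| <= n%:R * B * enorm (v - w)).

Lemma kernel_a_le i j p : `|kernel_a phi i j p| <= 4 * B.
Proof.
rewrite normrM (_ : 4 * B = 2 * (B + B)); last by ring.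
apply: ler_pM => //; first exact: coef_a_critical_le.
by apply: le_trans (ler_normD _ _) _; apply: lerD; exact: phiB.1.
Qed.

(** [b] is singular like [1/|z|], but it multiplies a difference of gradients, which is Lipschitz
    and contributes a factor [|z|]. *)
Lemma kernel_b_le i p : `|kernel_b phi i p| <= n%:R * (n%:R * B).
Proof.
rewrite normrM.
apply: (@le_trans _ _ (`|coef_b (-2) i (p.1 - p.2)| * (n%:R * B * enorm (p.1 - p.2)))).
  by rewrite ler_wpM2l//; exact: phiB.2.
rewrite (_ : _ * _ = `|coef_b (-2) i (p.1 - p.2)| * enorm (p.1 - p.2) * (n%:R * B)); last by ring.
by rewrite ler_wpM2r ?mulr_ge0//; exact: coef_b_critical_le.
Qed.

Let measurable_p1 (k : 'rV[R]_n -> R) : elementary_smooth k ->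
  measurable_fun setT (fun p : VV => k p.1).
Proof.
move=> sk; apply: (measurableT_comp (continuous_measurable_rV (es_continuous sk))).
exact: measurable_fst.
Qed.

Let measurable_p2 (k : 'rV[R]_n -> R) : elementary_smooth k ->
  measurable_fun setT (fun p : VV => k p.2).
Proof.
move=> sk; apply: (measurableT_comp (continuous_measurable_rV (es_continuous sk))).
exact: measurable_snd.
Qed.

Lemma bounded_kernel_a i j : bounded_kernel (kernel_a phi i j).
Proof.
have s2 : elementary_smooth (partials [:: i; j] phi).
  by do 2 apply: es_partial; exact: es_cutoff_energy.
split; last by exists (4 * B); exact: kernel_a_le.
apply: measurable_funM.
  exact: (measurableT_comp (measurable_coef_a_critical i j) (@measurable_rV_sub R n)).
by apply: measurable_funD; [exact: (measurable_p1 s2)|exact: (measurable_p2 s2)].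
Qed.

Lemma bounded_kernel_b i : bounded_kernel (kernel_b phi i).
Proof.
have s1 : elementary_smooth (partial i phi) by apply: es_partial; exact: es_cutoff_energy.
split; last by exists (n%:R * (n%:R * B)); exact: kernel_b_le.
apply: measurable_funM.
  exact: (measurableT_comp (measurable_coef_b_critical i) (@measurable_rV_sub R n)).
by apply: measurable_funB; [exact: (measurable_p1 s1)|exact: (measurable_p2 s1)].
Qed.

Lemma bounded_landau_kernel : bounded_kernel (landau_kernel phi).
Proof.
apply: bounded_kernelD.
  apply: bounded_kernelZ; apply: bounded_kernel_sum => i.
  by apply: bounded_kernel_sum => j; exact: bounded_kernel_a.
by apply: bounded_kernel_sum => i; exact: bounded_kernel_b.
Qed.

Let sum_cst (c : R) : \sum_(i < n) c = n%:R * c.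
Proof. by rewrite sumr_const card_ord mulr_natl. Qed.

Lemma landau_kernel_le p :
  `|landau_kernel phi p| <= 2 * n%:R ^+ 2 * B + n%:R ^+ 3 * B.
Proof.
apply: le_trans (ler_normD _ _) _; apply: lerD.
  rewrite normrM (ger0_norm (_ : 0 <= 2^-1)) ?invr_ge0//.
  have h : `|\sum_i \sum_j kernel_a phi i j p| <= \sum_(i < n) \sum_(j < n) 4 * B.
    apply: le_trans (ler_norm_sum _ _ _) _; apply: ler_sum => i _.
    apply: le_trans (ler_norm_sum _ _ _) _; apply: ler_sum => j _.
    exact: kernel_a_le.
  move: h; rewrite !sum_cst => h.
  apply: le_trans (ler_wpM2l _ h) _; first by rewrite invr_ge0.
  by rewrite le_eqVlt; apply/orP; left; apply/eqP; field.
have h : `|\sum_i kernel_b phi i p| <= \sum_(i < n) n%:R * (n%:R * B).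
  by apply: le_trans (ler_norm_sum _ _ _) _; apply: ler_sum => i _; exact: kernel_b_le.
apply: le_trans h _; rewrite sum_cst.
by rewrite le_eqVlt; apply/orP; left; apply/eqP; ring.
Qed.

(* For the exact energy |v|^2 the trace of a and the divergence term cancel: this
   is conservation of energy, which only fails where the cutoff acts. *)
Lemma landau_kernel0 p : p.1 != p.2 -> enorm p.1 < rho -> enorm p.2 < rho ->
  landau_kernel phi p = 0.
Proof.
move=> p12 p1 p2; rewrite /landau_kernel /kernel_a /kernel_b.
have e0 : enorm (p.1 - p.2) ^+ 2 != 0.
  by rewrite sqrf_eq0 enorm_eq0 subr_eq0.
have -> : \sum_i \sum_j coef_a (-2) i j (p.1 - p.2) *
    (partials [:: i; j] phi p.1 + partials [:: i; j] phi p.2) =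
    \sum_i (4 - 4 * (p.1 - p.2) ord0 i ^+ 2 / enorm (p.1 - p.2) ^+ 2).
  apply: eq_bigr => i _; rewrite (bigD1 i)//= big1 ?addr0; last first.
    move=> j ji; have := partials_cutoff_energy_in i j rho0 p1.
    have := partials_cutoff_energy_in i j rho0 p2.
    by rewrite (negbTE (_ : i != j)) 1?eq_sym//= => -> ->; rewrite mulr0 addr0 mulr0.
  have := partials_cutoff_energy_in i i rho0 p1.
  have := partials_cutoff_energy_in i i rho0 p2.
  rewrite /= => -> ->; rewrite coef_a_critical eqxx.
  rewrite (_ : true%:R = 1 :> R)//.
  by set y := (_ ^+ 2)^-1; set x := fun_of_matrix _ _ i; ring.
have -> : \sum_i coef_b (-2) i (p.1 - p.2) * (partial i phi p.1 - partial i phi p.2) =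
    \sum_i (- 2 * (n%:R - 1) * (p.1 - p.2) ord0 i ^+ 2 / enorm (p.1 - p.2) ^+ 2).
  apply: eq_bigr => i _; rewrite (partial_cutoff_energy_in _ rho0 p1) (partial_cutoff_energy_in _ rho0 p2).
  rewrite coef_b_critical !mxE; set y := (_ ^+ 2)^-1.
  by set x1 := p.1 ord0 i; set x2 := p.2 ord0 i; ring.
rewrite sumrB sum_cst -!mulr_suml -!mulr_sumr -enorm_sqr !mulfK//.
by field.
Qed.

End cutoff_kernel.
End critical_kernel.

Section collision_tail.
Context {R : realType} {n : nat}.
Local Notation leb := (@lebesgue_rV R n).
Local Notation leb2 := (leb \x leb)%E.
Local Notation VV := ('rV[R]_n * 'rV[R]_n)%type.
Hypothesis n0 : (0 < n)%N.

(** Each section is a cube of radius 0, of volume [0^n = 0]. The diagonal must be set aside because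
    the default value of [a] at 0 spoils the cancellation there. *)
Lemma negligible_diagonal : leb2.-negligible [set p : VV | p.1 = p.2].
Proof.
have mD : measurable [set p : VV | p.1 = p.2].
  rewrite (_ : [set _ | _] = (fun p : VV => enorm (p.1 - p.2)) @^-1` [set 0]).
    rewrite -[X in measurable X]setTI.
    apply: (measurableT_comp (@measurable_enorm R n) (@measurable_rV_sub R n)) => //.
  apply/seteqP; split => p /=; first by move=> ->; rewrite subrr; apply/eqP; rewrite enorm_eq0.
  by move/eqP; rewrite enorm_eq0 subr_eq0 => /eqP.
exists [set p : VV | p.1 = p.2]; split => //.
rewrite /product_measure1 /= integral0_eq// => v _.
rewrite (_ : xsection _ v = box v 0).
  by rewrite lebesgue_box// mulr0 expr0n (gtn_eqF n0).
apply/seteqP; split => w; rewrite /xsection /= inE/=; first by move=> -> i; rewrite subrr normr0.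
move=> h; apply/rowP => i; apply/eqP; rewrite eq_sym -subr_eq0 -normr_le0; exact: h.
Qed.

Variables (g : 'rV[R]_n -> R) (M : R).
Hypothesis mg : measurable_fun setT g.
Hypothesis g1 : (\int[leb]_v `|g v|%:E = 1)%E.
Hypothesis gM : (\int[leb]_v (bracket v ^+ 2 * `|g v|)%:E = M%:E)%E.
Variable rho : R.
Hypothesis rho0 : 0 < rho.

Let A : set 'rV[R]_n := ~` [set v | enorm v < rho].

Let mA : measurable A.
Proof. by apply: measurableC; apply: open_measurable_rV; exact: open_enorm_lt. Qed.

Let gA v := `|g v| * \1_A v.

Let mabs : measurable_fun setT (fun v => `|g v|).
Proof. exact: measurableT_comp. Qed.

Let mgA : measurable_fun setT gA.
Proof. by apply: measurable_funM => //; exact: measurable_indic. Qed.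

Let gA0 v : 0 <= gA v. Proof. by rewrite mulr_ge0. Qed.

(** Chebyshev's inequality, from [<v>^2 >= rho^2] on [A]. *)
Let gA_le : (\int[leb]_v (gA v)%:E <= (M / rho ^+ 2)%:E)%E.
Proof.
have r2 : 0 < rho ^+ 2 by rewrite exprn_gt0.
apply: (@le_trans _ _ (\int[leb]_v ((rho ^+ 2)^-1%:E * (bracket v ^+ 2 * `|g v|)%:E))%E).
  apply: ge0_le_integral.
  - exact: measurableT.
  - by move=> v _; rewrite lee_fin.
  - exact/measurable_EFinP.
  - apply: emeasurable_funM; first exact: measurable_cst.
    apply/measurable_EFinP; apply: measurable_funM => //.
    by apply: measurable_funX; exact: measurable_bracket.
  move=> v _; rewrite -EFinM lee_fin /gA indicE.
  have [vA|vA] := boolP (v \in A); last first.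
    by rewrite mulr0 mulr_ge0 ?invr_ge0 ?sqr_ge0// mulr_ge0 ?sqr_ge0.
  rewrite mulr1 mulrA ler_peMl// ler_pdivlMl// mulr1 bracket_sqr.
  move: vA; rewrite inE /A /= => /negP; rewrite -leNgt => vr.
  have : rho ^+ 2 <= enorm v ^+ 2 by rewrite ler_pXn2r ?nnegrE ?enorm_ge0// ltW.
  by move=> h; apply: le_trans h _; rewrite lerDr.
rewrite ge0_integralZl_EFin.
- by rewrite gM -EFinM mulrC.
- exact: measurableT.
- by move=> v _; rewrite lee_fin mulr_ge0// sqr_ge0.
- apply/measurable_EFinP; apply: measurable_funM => //.
  by apply: measurable_funX; exact: measurable_bracket.
- by rewrite invr_ge0 ltW.
Qed.

(** Off the diagonal the kernel is nonzero only if one of the two velocities leaves the ball. Each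
    of the two possibilities has weight at most [M / rho^2] by [gA_le], the other factor having mass
    1. *)
Lemma collision_tail (k : VV -> R) (C : R) : measurable_fun setT k ->
  (forall p, `|k p| <= C) ->
  (forall p, p.1 != p.2 -> enorm p.1 < rho -> enorm p.2 < rho -> k p = 0) ->
  `|\int[leb2]_p (g p.1 * g p.2 * k p)| <= 2 * C * M / rho ^+ 2.
Proof.
move=> mk kC k0.
have C0 : 0 <= C by apply: le_trans (kC (0, 0)).
have mgg : measurable_fun setT (fun p : VV => g p.1 * g p.2 * k p).
  apply: measurable_funM => //; apply: measurable_funM.
    by apply: (measurableT_comp mg); exact: measurable_fst.
  by apply: (measurableT_comp mg); exact: measurable_snd.
have mF (a b : 'rV[R]_n -> R) : measurable_fun setT a -> measurable_fun setT b ->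
    measurable_fun setT (fun p : VV => (a p.1 * b p.2)%:E).
  move=> ma mb; apply/measurable_EFinP; apply: measurable_funM.
    by apply: (measurableT_comp ma); exact: measurable_fst.
  by apply: (measurableT_comp mb); exact: measurable_snd.
have mF1 := mF gA (fun v => `|g v|) mgA mabs.
have mF2 := mF (fun v => `|g v|) gA mabs mgA.
have key : (\int[leb2]_p `|(g p.1 * g p.2 * k p)%:E| <= (2 * C * M / rho ^+ 2)%:E)%E.
  apply: (@le_trans _ _ (\int[leb2]_p (C%:E * ((gA p.1 * `|g p.2|)%:E + (`|g p.1| * gA p.2)%:E)))%E).
    apply: ae_ge0_le_integral.
    - exact: measurableT.
    - by move=> p _; exact: abse_ge0.
    - by apply: measurableT_comp => //; exact/measurable_EFinP.
    - by move=> p _; rewrite -EFinD -EFinM lee_fin mulr_ge0// addr_ge0// mulr_ge0.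
    - apply: emeasurable_funM; first exact: measurable_cst.
      exact: (emeasurable_funD mF1 mF2).
    apply: (@negligibleS _ _ _ leb2 [set p : VV | p.1 = p.2]); last exact: negligible_diagonal.
    move=> p /= h; apply: contrapT => /eqP p12; apply: h => _.
    rewrite -EFinD -EFinM lee_fin !normrM mulrC.
    have [i1|i1] := ltP (enorm p.1) rho; last first.
      apply: ler_pM => //; rewrite ?mulr_ge0// {1}/gA indicE mem_set ?mulr1 ?lerDl ?mulr_ge0//=.
      by apply/negP; rewrite -leNgt.
    have [i2|i2] := ltP (enorm p.2) rho.
      by rewrite k0// normr0 mul0r mulr_ge0// addr_ge0// mulr_ge0.
    apply: ler_pM => //; rewrite ?mulr_ge0// {2}/gA indicE mem_set ?mulr1 ?lerDr ?mulr_ge0//=.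
    by apply/negP; rewrite -leNgt.
  rewrite ge0_integralZl_EFin//; last 2 first.
  - by move=> p _; rewrite -EFinD lee_fin addr_ge0// mulr_ge0.
  - exact: (emeasurable_funD mF1 mF2).
  rewrite ge0_integralD//; last 2 first.
  - by move=> p _; rewrite lee_fin mulr_ge0.
  - by move=> p _; rewrite lee_fin mulr_ge0.
  rewrite (@integral_tensor _ _ gA (fun v => `|g v|))// (@integral_tensor _ _ (fun v => `|g v|) gA)//.
  rewrite g1 mule1 mul1e.
  rewrite (_ : 2 * C * M / rho ^+ 2 = C * (M / rho ^+ 2 + M / rho ^+ 2)); last by ring.
  by rewrite EFinM lee_wpmul2l// ?lee_fin// EFinD leeD.
have ih : leb2.-integrable setT (fun p : VV => (g p.1 * g p.2 * k p)%:E).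
  apply/integrableP; split; first exact/measurable_EFinP.
  by apply: le_lt_trans key _; rewrite ltry.
rewrite -lee_fin; apply: le_trans key.
rewrite -abse_EFin /Rintegral fineK; last exact: integrable_fin_num.
by apply: le_abse_integral => //; exact/measurable_EFinP.
Qed.

End collision_tail.

(** * Propagation of the energy tail *)

Section energy_tail.
Context {R : realType} {n : nat}.
Local Notation leb := (@lebesgue_rV R n).
Local Notation mu := (@lebesgue_measure R).

Lemma Lps12_integral_abs (f k : 'rV[R]_n -> R) : Lps 1 2 f ->
  {ae leb, forall v, 0 <= f v} -> measurable_fun setT k ->
  (forall v, 0 <= k v) -> (forall v, k v <= bracket v ^+ 2) ->
  (\int[leb]_v (k v * `|f v|)%:E = (\int[leb]_v (f v * k v)%R)%:E)%E.
Proof.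
move=> Lf f0 mk k0 kb; have [mf _] := Lf.
have ik : leb.-integrable setT (fun v => (f v * k v)%:E).
  by apply: Lps12_dominated => // v; rewrite ger0_norm.
rewrite /Rintegral fineK; last exact: integrable_fin_num.
apply: ae_eq_integral => //.
- by apply/measurable_EFinP; apply: measurable_funM => //; exact: measurableT_comp.
- exact: measurable_int ik.
- by apply: filterS f0 => v fv _; rewrite ger0_norm// mulrC.
Qed.

Lemma test_curve_cst (phi : 'rV[R]_n -> R) (r : R) : smooth phi ->
  (forall v, r < enorm v -> phi v = 0) -> test_curve_C1 (fun=> phi) (fun=> fun=> 0).
Proof.
move=> sphi rphi.
have p0 s : partials s (fun _ : 'rV[R]_n => 0 : R) = (fun _ : 'rV[R]_n => 0 : R).
  elim: s => //= i s ->; apply/funext => v; exact: derive_cst.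
split.
- split=> [//|T|s t e t0 e0]; first by exists r => t v _; exact: rphi.
  by apply: (@nearW _ (nbhs t)) => t' _ v; rewrite subrr normr0 ltW.
- split=> [t t0|T|s t e t0 e0]; first exact: es_smooth (es_cst _).
    by exists 0.
  by apply: (@nearW _ (nbhs t)) => t' _ v; rewrite subrr normr0 ltW.
- move=> s t e t0 e0; apply: (@nearW _ (nbhs t)) => t' _ v.
  by rewrite p0 mulr0 subr0 subrr normr0 mulr_ge0// ltW.
Qed.

(** Zero for [|v| <= rho] and [|v|^2] for [|v| >= 2 rho]: a smooth substitute for the energy
    restricted to large velocities. *)
Definition energy_deficit (rho : R) (v : 'rV[R]_n) : R := enorm v ^+ 2 - cutoff_energy rho v.

Lemma energy_deficit_ge0 rho v : 0 < rho -> 0 <= energy_deficit rho v.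
Proof. by move=> r0; rewrite subr_ge0; exact: cutoff_energy_le. Qed.

Lemma energy_deficit_le rho v : 0 < rho -> energy_deficit rho v <= enorm v ^+ 2.
Proof. by move=> r0; rewrite gerBl; exact: cutoff_energy_ge0. Qed.

Lemma measurable_cutoff_energy rho : measurable_fun setT (@cutoff_energy R n rho).
Proof. by apply: continuous_measurable_rV; apply: es_continuous; exact: es_cutoff_energy. Qed.

Lemma measurable_energy_deficit rho : measurable_fun setT (energy_deficit rho).
Proof.
apply: measurable_funB; last exact: measurable_cutoff_energy.
by apply: measurable_funX; exact: measurable_enorm.
Qed.

Lemma integrable_energy_deficit (g : 'rV[R]_n -> R) rho : Lps 1 2 g -> 0 < rho ->
  leb.-integrable setT (fun v => (g v * energy_deficit rho v)%:E).
Proof.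
move=> Lg r0; apply: Lps12_dominated => // [|v]; first exact: measurable_energy_deficit.
rewrite ger0_norm ?energy_deficit_ge0// bracket_sqr.
by apply: le_trans (energy_deficit_le _ r0) _; rewrite lerDr.
Qed.

Lemma energy_deficitE (g : 'rV[R]_n -> R) rho : Lps 1 2 g -> 0 < rho ->
  \int[leb]_v (g v * energy_deficit rho v) =
  \int[leb]_v (g v * enorm v ^+ 2) - \int[leb]_v (g v * cutoff_energy rho v).
Proof.
move=> Lg r0.
have i1 : leb.-integrable setT (fun v => (g v * enorm v ^+ 2)%:E).
  apply: Lps12_dominated => // [|v]; first by apply: measurable_funX; exact: measurable_enorm.
  by rewrite ger0_norm ?sqr_ge0// bracket_sqr lerDr.
have i2 : leb.-integrable setT (fun v => (g v * cutoff_energy rho v)%:E).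
  apply: Lps12_dominated => // [|v]; first exact: measurable_cutoff_energy.
  rewrite ger0_norm ?cutoff_energy_ge0// bracket_sqr.
  by apply: le_trans (cutoff_energy_le _ r0) _; rewrite lerDr.
rewrite -RintegralB//; apply: eq_Rintegral => v _.
by rewrite mulrBr.
Qed.

(** Dominated convergence with dominating function [|g| |v|^2]: at a fixed [v] the deficit is 0 as
    soon as the radius exceeds [|v|]. *)
Lemma energy_deficit_cvg (g : 'rV[R]_n -> R) : Lps 1 2 g ->
  \int[leb]_v (g v * energy_deficit k.+1%:R v) @[k --> \oo] --> (0 : R).
Proof.
move=> Lg; have [mg _] := Lg.
have mh k : measurable_fun setT (fun v => (g v * energy_deficit k.+1%:R v)%:E).
  exact: measurable_int (integrable_energy_deficit Lg (ltr0Sn _ k)).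
have ig : leb.-integrable setT (fun v => (`|g v| * enorm v ^+ 2)%:E).
  have : leb.-integrable setT (fun v => (g v * enorm v ^+ 2)%:E).
    apply: Lps12_dominated => // [|v]; first by apply: measurable_funX; exact: measurable_enorm.
    by rewrite ger0_norm ?sqr_ge0// bracket_sqr lerDr.
  move/integrable_norm; apply: eq_integrable => // v _ /=.
  by rewrite normrM [X in _ * X]ger0_norm// sqr_ge0.
have [] := @dominated_convergence _ _ R leb setT measurableT
  (fun k v => (g v * energy_deficit k.+1%:R v)%:E) (cst 0%E)
  (fun v => (`|g v| * enorm v ^+ 2)%:E) mh (@measurable_cst _ _ _ _ _ _) _ ig _.
- apply: nearW => v _; apply: cvg_near_cst.
  have := @nbhs_infty_ger R (enorm v); apply: filterS => k kv.
  rewrite /energy_deficit cutoff_energy_in ?subrr ?mulr0// ?ltr0Sn//.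
  by apply: le_trans kv _; rewrite ler_nat.
- apply: nearW => v k _; rewrite abse_EFin lee_fin normrM ler_wpM2l//.
  by rewrite ger0_norm ?energy_deficit_ge0 ?energy_deficit_le// ltr0Sn.
move=> _ _; rewrite integral0_eq// => h.
exact: fine_cvg h.
Qed.

Hypothesis n0 : (0 < n)%N.

(* Testing the weak formulation with the truncated energy: energy leaks to infinity
   at speed O(rho^-2). *)
Lemma energy_propagation : exists2 C : R, 0 <= C &
  forall (fin : 'rV[R]_n -> R) f, normalized_datum fin -> weak_solution (-2) fin f ->
  forall rho t, 0 < rho -> 0 <= t ->
  \int[leb]_v (f t v * energy_deficit rho v) <=
  \int[leb]_v (fin v * energy_deficit rho v) + C / rho ^+ 2 * t.
Proof.
have [B B0 hB] := @cutoff_energy_bounds R n.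
pose K : R := 2 * n%:R ^+ 2 * B + n%:R ^+ 3 * B.
have K0 : 0 <= K by rewrite addr_ge0// !mulr_ge0// exprn_ge0.
exists (2 * K * (1 + n%:R)); first by rewrite !mulr_ge0// addr_ge0.
move=> fin f nd ws rho t r0 t0.
have Lft s : 0 <= s -> Lps 1 2 (f s) by move=> s0; have [] := ws_space ws s0.
have mft s : 0 <= s -> measurable_fun setT (f s) by move=> s0; have [] := Lft s s0.
have f1 s : 0 <= s -> (\int[leb]_v `|f s v|%:E = 1%:E)%E.
  move=> s0; transitivity (\int[leb]_v (1 * `|f s v|)%:E)%E.
    by apply: eq_integral => v _; rewrite mul1r.
  rewrite (@Lps12_integral_abs (f s) (fun=> 1))//.
  - under eq_Rintegral do rewrite mulr1.
    by rewrite (ws_mass ws s0) (nd_mass nd).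
  - exact: Lft.
  - exact: (ws_ge0 ws s0).
  - by move=> v; rewrite bracket_sqr lerDl sqr_ge0.
have mf := ws_measurable ws.
pose phi := @cutoff_energy R n rho.
have hB' := hB rho r0.
have sphi : smooth phi by apply: es_smooth; exact: es_cutoff_energy.
have tc : test_curve_C1 (fun=> phi) (fun=> fun=> 0).
  apply: (@test_curve_cst _ (2 * rho)) => // v v2.
  by apply: cutoff_energy_out => //; exact: ltW.
have bLa i j := @bounded_kernel_a R n rho B hB' i j.
have bLb i := @bounded_kernel_b R n rho B B0 hB' i.
have wf : \int[leb]_v (f t v * phi v) =
    \int[leb]_v (fin v * phi v) + collision_time f t (landau_kernel phi).
  have bS1 i : bounded_kernel (fun p => \sum_j kernel_a phi i j p).
    by apply: bounded_kernel_sum.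
  have bS2 : bounded_kernel (fun p => \sum_i \sum_j kernel_a phi i j p).
    by apply: bounded_kernel_sum.
  have bS3 : bounded_kernel (fun p => \sum_i kernel_b phi i p).
    by apply: bounded_kernel_sum.
  rewrite (collision_timeD mf f1 mft t0 (bounded_kernelZ _ bS2) bS3).
  rewrite (collision_timeZ mf f1 mft _ t0 bS2).
  rewrite (collision_time_sum mf f1 mft _ t0 bS1).
  rewrite (collision_time_sum mf f1 mft _ t0 bLb).
  rewrite (ws_weak_form ws tc t0).
  (* The test function does not depend on time. *)
  have -> : \int[mu]_(tau in `[0, t]) \int[leb]_v (f tau v * (fun=> 0) v) = 0.
    rewrite /Rintegral integral0_eq// => s _.
    by rewrite integral0_eq// => v _; rewrite mulr0.
  rewrite addr0.
  have : forall a b c b' c' : R, b = b' -> c = c' -> a + 2^-1 * b + c = a + (2^-1 * b' + c').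
    by move=> a b c b' c' -> ->; rewrite addrA.
  apply.
    apply: eq_bigr => i _; rewrite (collision_time_sum mf f1 mft _ t0 (bLa i)).
    apply: eq_bigr => j _; apply: eq_Rintegral => s _.
    by apply: eq_Rintegral => p _; rewrite /kernel_a mulrA.
  apply: eq_bigr => i _; apply: eq_Rintegral => s _.
  by apply: eq_Rintegral => p _; rewrite /kernel_b mulrA.
have Lfin : Lps 1 2 fin by have [] := nd_space nd.
have bL := @bounded_landau_kernel R n rho B B0 hB'.
have ct : `|collision_time f t (landau_kernel phi)| <= 2 * K * (1 + n%:R) / rho ^+ 2 * t.
  apply: (collision_time_le mf f1 mft t0 bL) => s /andP[s0 _].
  apply: (@collision_tail R n n0 (f s) (1 + n%:R) (mft _ s0) (f1 _ s0)
    (weak_solution_moment nd ws s0) rho r0 (landau_kernel phi) K).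
  - by have [] := bL.
  - by move=> p; exact: landau_kernel_le.
  - by move=> p; exact: landau_kernel0.
(* Total energy is conserved, so the deficit grows by exactly what the truncated energy loses. *)
rewrite (energy_deficitE (Lft _ t0) r0) (energy_deficitE Lfin r0).
rewrite (ws_energy ws t0) -/phi wf.
move: ct; rewrite ler_norml => /andP[ct _].
lra.
Qed.

Lemma uniform_energy_tail (fin : 'rV[R]_n -> R) (T eta : R) :
  normalized_datum fin -> 0 < eta ->
  exists2 rho : R, 1 <= rho & forall f, weak_solution (-2) fin f ->
  forall t, 0 <= t <= T ->
  (\int[leb]_(v in [set v | (2 * rho < enorm v)%R]) (bracket v ^+ 2 * `|f t v|)%:E <= eta%:E)%E.
Proof.
move=> nd eta0; have [C C0 prop] := energy_propagation.
have Lfin : Lps 1 2 fin by have [] := nd_space nd.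
have e4 : 0 < eta / 4 by rewrite divr_gt0.
have h1 := energy_deficit_cvg Lfin.
move/cvgrPdist_le : h1 => /(_ _ e4) h1.
have h2 := @nbhs_infty_ger R (C * T / (eta / 4)).
have [k [h1k h2k]] := filter_ex (filterI h1 h2).
have k1 : 1 <= k.+1%:R :> R by rewrite ler1n.
have r0 : 0 < k.+1%:R :> R by rewrite ltr0Sn.
exists k.+1%:R => // f ws t /andP[t0 tT].
have Lf : Lps 1 2 (f t) by have [] := ws_space ws t0.
have [mf _] := Lf.
have mD : measurable [set v : 'rV[R]_n | 2 * k.+1%:R < enorm v].
  by apply: open_measurable_rV; exact: open_enorm_gt.
have mint : measurable_fun setT (fun v => (energy_deficit k.+1%:R v * `|f t v|)%:E).
  apply/measurable_EFinP; apply: measurable_funM; first exact: measurable_energy_deficit.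
  exact: measurableT_comp.
(* Beyond twice the radius the deficit is [|v|^2 >= 1], so [<v>^2 <= 2 |v|^2]; this factor 2 turns
   two quarters of [eta] into [eta]. *)
apply: (@le_trans _ _ (\int[leb]_v (2%:E * (energy_deficit k.+1%:R v * `|f t v|)%:E))%E).
  rewrite integral_mkcond; apply: ge0_le_integral.
  - exact: measurableT.
  - by move=> v _; rewrite patchE; case: ifP => // _; rewrite lee_fin mulr_ge0// sqr_ge0.
  - apply: (measurable_restrictT _ mD).1; apply: measurable_funTS.
    apply/measurable_EFinP; apply: measurable_funM; last exact: measurableT_comp.
    by apply: measurable_funX; exact: measurable_bracket.
  - by apply: emeasurable_funM => //; exact: measurable_cst.
  - move=> v _; rewrite -EFinM patchE; case: ifPn => [|_]; last first.
      by rewrite lee_fin mulr_ge0// mulr_ge0// energy_deficit_ge0.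
    rewrite inE/= => v2; rewrite lee_fin mulrA ler_wpM2r//.
    rewrite /energy_deficit cutoff_energy_out ?(ltW v2)// bracket_sqr.
    have : 1 <= enorm v ^+ 2 by rewrite expr_ge1// ?enorm_ge0//; lra.
    lra.
rewrite ge0_integralZl_EFin//; last first.
  by move=> v _; rewrite lee_fin mulr_ge0// energy_deficit_ge0.
rewrite (Lps12_integral_abs Lf (ws_ge0 ws t0)); last 3 first.
- exact: measurable_energy_deficit.
- by move=> v; exact: energy_deficit_ge0.
- move=> v; rewrite bracket_sqr; apply: le_trans (energy_deficit_le _ r0) _.
  by rewrite lerDr.
rewrite -EFinM lee_fin.
have p := prop fin f nd ws k.+1%:R t r0 t0.
move: h1k; rewrite sub0r normrN => h1k.
have h3 := ler_norm (\int[leb]_v (fin v * energy_deficit k.+1%:R v)).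
have h4 : C / k.+1%:R ^+ 2 * t <= eta / 4.
  apply: (@le_trans _ _ (C / k.+1%:R ^+ 2 * T)).
    by rewrite ler_wpM2l// divr_ge0// sqr_ge0.
  rewrite mulrAC ler_pdivrMr ?exprn_gt0//.
  move: h2k; rewrite ler_pdivrMr// => h2k; apply: le_trans h2k _.
  rewrite mulrC ler_wpM2l ?(ltW e4)// (@le_trans _ _ k.+1%:R)//; first by rewrite ler_nat.
  by rewrite expr2 ler_peMr// ltW.
have h5 := le_trans h3 h1k.
have h6 := le_trans p (lerD h5 h4).
apply: le_trans (ler_wpM2l _ h6) _ => //.
by rewrite le_eqVlt; apply/orP; left; apply/eqP; field.
Qed.

End energy_tail.

(** * The case gamma = -2 *)

Section critical.
Context {R : realType} {n : nat}.
Local Notation leb := (@lebesgue_rV R n).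
Hypothesis n3 : (3 <= n)%N.

(** [E] collects the large velocities, handled by the energy tail, and the large values of [f],
    handled by the entropy; each part receives [eta / 2]. Off [E] both factors of the density are
    bounded. *)
Lemma uniform_concentration (fin : 'rV[R]_n -> R) (T eta : R) :
  normalized_datum fin -> 0 < eta ->
  exists2 L : R, 0 <= L & forall f, weak_solution (-2) fin f ->
  forall t, 0 <= t <= T -> exists E : set 'rV[R]_n,
  [/\ measurable E,
      (\int[leb]_(w in E) (bracket w ^+ 2 * `|f t w|)%:E <= eta%:E)%E &
      forall w, ~ E w -> bracket w ^+ 2 * `|f t w| <= L].
Proof.
move=> nd eta0.
have e2 : 0 < eta / 2 by rewrite divr_gt0.
have n0 : (0 < n)%N by apply: leq_trans n3.
have [rho rho1 tail] := uniform_energy_tail n0 T nd e2.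
pose b : R := 1 + (2 * rho) ^+ 2.
have b0 : 0 < b by rewrite ltr_wpDr// sqr_ge0.
(* Bounds the numerator in [entropy_tail] at every time: the entropy never exceeds its initial value
   and the energy stays equal to [n]. *)
pose X : R := `|\int[leb]_v (fin v * ln (fin v)) + n%:R + gaussian_mass (n := n)|.
have X0 : 0 <= X by rewrite /X.
(* At the level [exp(S)] the logarithm is [S], so the mass of large values is at most [X / S]; this
   [S] gives [b X / S <= eta / 2], and the added 1 keeps it positive. *)
pose S : R := b * X / (eta / 2) + 1.
have S0 : 0 < S by rewrite /S ltr_wpDl// divr_ge0 ?(ltW e2)// mulr_ge0// ltW.
have K1 : 1 < expR S by rewrite expR_gt1.
exists (b * expR S); first by rewrite mulr_ge0 ?expR_ge0// ltW.
move=> f ws t /[dup] tT /andP[t0 _].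
have Lf := ws_space ws t0.
have [[mf _] _] := Lf.
have mabs : measurable_fun setT (fun v => `|f t v|) by exact: measurableT_comp.
pose A := [set v : 'rV[R]_n | 2 * rho < enorm v].
pose D := [set v : 'rV[R]_n | expR S < `|f t v|].
have mA : measurable A by apply: open_measurable_rV; exact: open_enorm_gt.
have mD : measurable D.
  rewrite (_ : D = (fun v => `|f t v|) @^-1` `]expR S, +oo[); last first.
    by apply/seteqP; split => v; rewrite /D /= in_itv/= andbT.
  by rewrite -[X in measurable X]setTI; exact: mabs.
have mh : measurable_fun setT (fun w => (bracket w ^+ 2 * `|f t w|)%:E).
  apply/measurable_EFinP; apply: measurable_funM => //.
  by apply: measurable_funX; exact: measurable_bracket.
have hb w : ~ A w -> bracket w ^+ 2 <= b.
  move=> /negP; rewrite -leNgt => w2; rewrite bracket_sqr /b lerD2l.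
  by rewrite ler_pXn2r ?nnegrE ?enorm_ge0// (le_trans (enorm_ge0 w)).
exists (A `|` D); split; first exact: measurableU.
- have dD : (\int[leb]_(w in D) `|f t w|%:E <= (X / S)%:E)%E.
    apply: le_trans (entropy_tail Lf (ws_ge0 ws t0) K1) _.
    rewrite lee_fin expRK ler_wpM2r ?invr_ge0 ?(ltW S0)//.
    rewrite (ws_energy ws t0) (nd_energy nd).
    apply: le_trans (ler_norm _); rewrite !lerD2r.
    exact: (ws_entropy ws t0).
  have dA := tail f ws t tT.
  apply: (@le_trans _ _ (\int[leb]_(w in A) (bracket w ^+ 2 * `|f t w|)%:E +
    b%:E * \int[leb]_(w in D) `|f t w|%:E)%E); last first.
    apply: (@le_trans _ _ ((eta / 2)%:E + b%:E * (X / S)%:E)%E).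
      by apply: leeD => //; rewrite lee_wpmul2l// lee_fin ltW.
    suff : (eta / 2 + b * (X / S) <= eta)%R by rewrite -lee_fin.
    have : b * (X / S) <= eta / 2.
      rewrite mulrA ler_pdivrMr// -ler_pdivrMl// mulrC /S.
      by rewrite lerDl.
    lra.
  rewrite [leLHS]integral_mkcond [X in (_ <= X + _)%E]integral_mkcond.
  rewrite [X in (_ <= _ + _ * X)%E]integral_mkcond.
  have mrA := (measurable_restrictT _ mA).1 (measurable_funTS mh).
  have mabsE : measurable_fun setT (fun v => (`|f t v|)%:E) by exact/measurable_EFinP.
  have mrD := (measurable_restrictT _ mD).1 (measurable_funTS mabsE).
  have h0 w : (0 <= (bracket w ^+ 2 * `|f t w|)%:E)%E by rewrite lee_fin mulr_ge0// sqr_ge0.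
  have r0 (B : set 'rV[R]_n) w : (0 <= ((fun w => (bracket w ^+ 2 * `|f t w|)%:E) \_ B) w)%E.
    by rewrite patchE; case: ifP.
  have r1 (B : set 'rV[R]_n) w : (0 <= ((fun w => (`|f t w|)%:E) \_ B) w)%E.
    by rewrite patchE; case: ifP => // _; rewrite lee_fin.
  rewrite -ge0_integralZl_EFin; last 4 first.
  - exact: measurableT.
  - by move=> w _; exact: r1.
  - exact: mrD.
  - exact: ltW.
  rewrite -ge0_integralD; last 5 first.
  - exact: measurableT.
  - by move=> w _; exact: r0.
  - exact: mrA.
  - by move=> w _; rewrite mule_ge0// lee_fin ltW.
  - by apply: emeasurable_funM; [exact: measurable_cst|exact: mrD].
  apply: ge0_le_integral.
  - exact: measurableT.
  - by move=> w _; exact: r0.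
  - exact: ((measurable_restrictT _ (measurableU _ _ mA mD)).1 (measurable_funTS mh)).
  - apply: emeasurable_funD; first exact: mrA.
    by apply: emeasurable_funM; [exact: measurable_cst|exact: mrD].
  move=> w _.
  have [wA|wA] := pselect (A w).
    rewrite [leLHS](_ : _ = (bracket w ^+ 2 * `|f t w|)%:E); last first.
      by rewrite patchE mem_set//; left.
    rewrite [X in (_ <= X + _)%E](_ : _ = (bracket w ^+ 2 * `|f t w|)%:E); last first.
      by rewrite patchE mem_set.
    by rewrite leeDl// mule_ge0// lee_fin ltW.
  rewrite patchE; case: ifPn => [|_]; last by rewrite adde_ge0// mule_ge0// lee_fin ltW.
  rewrite inE => -[//|wD].
  rewrite [X in (_ <= X + _)%E](_ : _ = 0%E) ?add0e; last by rewrite patchE memNset.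
  rewrite [X in (_ <= _ * X)%E](_ : _ = `|f t w|%:E); last by rewrite patchE mem_set.
  by rewrite -EFinM lee_fin ler_wpM2r//; exact: hb.
- move=> w /not_orP[wA /negP]; rewrite -leNgt => wD.
  by apply: ler_pM => //; [exact: sqr_ge0|exact: hb].
Qed.

Lemma eps_poincare_critical (fin : 'rV[R]_n -> R) (T eps : R) :
  normalized_datum fin -> 0 < eps ->
  exists2 C : R, 0 < C & forall f, weak_solution (-2) fin f ->
  forall (phi : 'rV[R]_n -> R) (t : R), smooth phi -> 0 <= t <= T ->
  eps_poincare (-2) eps C (f t) phi.
Proof.
move=> nd eps0.
have n3R : 3%:R <= n%:R :> R by rewrite ler_nat.
have g : -2 <= (-2 : R) < 0 by apply/andP; split; lra.
pose c0 : R := (n%:R - 1) * (-2 + n%:R).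
have c00 : 0 < c0 by rewrite /c0 mulr_gt0//; lra.
(* Solves [c0 * 4 * (8 * eta) = eps], the Dirichlet coefficient when [r^(2 + gamma) = 1]. *)
pose eta := eps / (32 * c0).
have eta0 : 0 < eta by rewrite divr_gt0// mulr_gt0.
have [L L0 conc] := uniform_concentration T nd eta0.
pose b : R := 16 * eta + 16 * 2 ^+ n * L.
have b0 : 0 <= b.
  apply: addr_ge0; first by rewrite mulr_ge0 ?(ltW eta0).
  by rewrite mulr_ge0 ?mulr_ge0 ?exprn_ge0.
pose r : R := 2^-1.
have p0 := powR_ge0 r (-2).
have rr : r `^ (2 - 2) = 1 by rewrite subrr powRr0.
pose C1 := c0 * (4 * (1 + r `^ (-2)) * (1 + n%:R) + 4 * r `^ (2 - 2) * b).
have C10 : 0 <= C1.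
  rewrite /C1 rr mulr1 mulr_ge0 ?(ltW c00)//; apply: addr_ge0; last by rewrite mulr_ge0.
  by rewrite !mulr_ge0 ?addr_ge0.
exists (C1 + 1); first by rewrite ltr_wpDl.
move=> f ws phi t sphi /[dup] tT /andP[t0 _].
have [mf _] := (ws_space ws t0).1.
have [E [mE hE hL]] := conc f ws t tT.
apply: (@eps_poincare_of_hardy _ _ _ _ n3 g mf (ws_ge0 ws t0) (1 + n%:R)
  (weak_solution_moment nd ws t0) phi r (8 * eta) b).
- exact: sphi.
- by rewrite invr_gt0 ltr0n lexx.
- by rewrite mulr_ge0// ltW.
- exact: b0.
- exact: eps0.
- by rewrite ltr_wpDl.
- exact: (hardy_potential_split n3 (-2) mf sphi mE hE hL L0).
- rewrite -/c0 rr le_eqVlt; apply/orP; left; apply/eqP; rewrite /eta; field.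
  by rewrite gt_eqF.
- by rewrite -/c0 -/C1 lerDl.
Qed.

End critical.

Theorem theorem1p3 (R : realType) (d : nat) (gamma : R)
    (hd : (3 <= d)%N) (hgamma : -2 <= gamma < 0) :
  (forall (T : R) (fin : 'rV[R]_d -> R), 0 < T -> normalized_datum fin ->
     forall eps : R, 0 < eps ->
     exists2 C : R, 0 < C &
       forall f : R -> 'rV[R]_d -> R, weak_solution gamma fin f ->
       forall (phi : 'rV[R]_d -> R) (t : R), smooth phi -> 0 <= t <= T ->
       eps_poincare gamma eps C (f t) phi)
  /\
  (-2 < gamma ->
     exists2 C0 : R -> R, (forall m : R, 0 < C0 m) &
       forall (T : R) (fin : 'rV[R]_d -> R), 0 < T -> normalized_datum fin ->
       forall eps : R, 0 < eps ->
       forall f : R -> 'rV[R]_d -> R, weak_solution gamma fin f ->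
       forall (phi : 'rV[R]_d -> R) (t : R), smooth phi -> 0 <= t <= T ->
       eps_poincare gamma eps
         (C0 (fine (Lps_norm 1 2 fin)) * (1 + eps `^ (gamma / (2 + gamma))))
         (f t) phi).
Proof.
have [g2 g0] := andP hgamma; split => [T fin _ nd eps eps0|g2'].
  move: g2; rewrite le_eqVlt => /predU1P[<-|g2].
    exact: eps_poincare_critical.
  have g : -2 < gamma < 0 by rewrite g2.
  have [K K0 hK] := eps_poincare_subcritical hd g.
  exists (K * (1 + eps `^ (gamma / (2 + gamma)))).
    by rewrite mulr_gt0// ltr_pwDl// powR_ge0.
  by move=> f ws phi t sphi /andP[t0 _]; exact: (hK fin).
have g : -2 < gamma < 0 by rewrite g2'.
have [K K0 hK] := eps_poincare_subcritical hd g.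
(* For a normalized datum the [L^1_2] norm is always [1 + d], so a constant function expresses the
   dependence on it. *)
exists (fun=> K) => // T fin _ nd eps eps0 f ws phi t sphi /andP[t0 _].
exact: (hK fin).
Qed.
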